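(* Let $A$ be a graded unitary associative algebra over $\mathbb{K}$. For every $n\ge 0$, every homogeneous $x,a_1,\ldots,a_n\in A$ and every homogeneous $f\in\mathrm{Hom}^*_{\mathbb{K}}(A,A)$, the Koszul brackets satisfy \[ \Psi_x^n(a_1,\ldots,a_n)=\sum_{\pi\in \Sigma_n}\epsilon(\pi)\sum_{k=0}^{n}\frac{(-1)^nB_{n-k}}{k!(n-k)!}\{\{\cdots\{x\,a_{\pi(1)}\cdots a_{\pi(k)},a_{\pi(k+1)}\},\ldots\},a_{\pi(n)}\}, \] \[ \Psi_f^n(a_1,\ldots,a_n)=\sum_{\pi\in \Sigma_n}\epsilon(\pi)\sum_{k=0}^{n}\frac{B_{n-k}}{k!(n-k)!}\{\{\cdots\{f_k(a_{\pi(1)},\ldots,a_{\pi(k)}),a_{\pi(k+1)}\},\ldots\},a_{\pi(n)}\}, \] where $\{a,b\}=ab-(-1)^{|a||b|}ba$, and $f_k\colon A^{\otimes k}\to A$ is the sequence of operators \[ f_0=f(1),\qquad f_k(a_1,\ldots,a_k)=[\cdots[[f,L_{a_1}],L_{a_2}],\ldots,L_{a_k}](1)\quad (k\ge 1).\]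
   Context: $\mathbb{K}$ is a fixed field of characteristic $0$; all graded vector spaces and graded algebras are $\mathbb{Z}$-graded over $\mathbb{K}$, and $|v|$ denotes the degree of a homogeneous element $v$. $\Sigma_n$ is the symmetric group and $\epsilon(\pi)$ is the Koszul sign of $\pi$ with respect to $a_1,\ldots,a_n$. $L_a\colon A\to A$, $L_a(b)=ab$, is left multiplication, and the brackets $[-,-]$ in the definition of $f_k$ are graded commutators in $\mathrm{End}^*(A)$. The Bernoulli numbers $B_n$ are defined by $\sum_{n\ge 0}B_n\frac{x^n}{n!}=\frac{x}{e^x-1}$ (so $B_1=-\frac12$). The Lie algebra $D(V)$: $V^{\odot n}$ is the $n$th (graded) symmetric power of $V$; a linear map $f\colon V^{\odot n}\to W$ is identified with the graded symmetric multilinear operator $f(v_1,\ldots,v_n)=f(v_1\odot\cdots\odot v_n)$. $\mathrm{End}^*(V)=\mathrm{Hom}^*_{\mathbb{K}}(V,V)=\bigoplus_{n\in\mathbb{Z}}\mathrm{Hom}^n_{\mathbb{K}}(V,V)$. Put $D(V)=\prod_{n\ge -1}D_n(V)$, with $D_{-1}(V)=V$ and $D_n(V)=\mathrm{Hom}^*_{\mathbb{K}}(V^{\odot n+1},V)$ for $n\ge 0$. $D(V)$ is a graded Lie algebra under the Nijenhuis-Richardson bracket $[f,g]=f\barwedge g-(-1)^{|f||g|}g\barwedge f$, where for $f\in D_n(V)$, $g\in D_m(V)$ the product $f\barwedge g\in D_{n+m}(V)$ is: $f\barwedge g=0$ if $f\in D_{-1}(V)=V$; $f\barwedge g(v_1,\ldots,v_n)=f(g,v_1,\ldots,v_n)$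 if $n\ge 0$ and $g\in V$; and for $n,m\ge 0$ \[ f\barwedge g(v_0,\ldots,v_{n+m})=\sum_{\sigma\in S(m+1,n)}\epsilon(\sigma)f(g(v_{\sigma(0)},\ldots,v_{\sigma(m)}),v_{\sigma(m+1)},\ldots,v_{\sigma(m+n)}),\] where $S(m+1,n)$ is the set of permutations $\sigma$ of $0,\ldots,n+m$ with $\sigma(0)<\cdots<\sigma(m)$ and $\sigma(m+1)<\cdots<\sigma(m+n)$, and $\epsilon(\sigma)$ is the Koszul sign. $\mathrm{Aff}^*(V)$ denotes the graded Lie subalgebra $D_{-1}(V)\times D_0(V)=V\times\mathrm{End}^*(V)$ of $D(V)$. The Koszul brackets: $\Psi$ is the unique assignment to every unitary graded associative algebra $A$ of a degree-preserving linear map $\Psi\colon\mathrm{Aff}^*(A)\to D(A)$, $u\mapsto\Psi_u=\sum_{n\ge 0}\Psi^n_u$, $\Psi^n_u\in D_{n-1}(A)$, such that (it is known that such an assignment exists and is unique): (1) $\Psi$ is a morphism of graded Lie algebras; (2) for every morphism $\alpha\colon A\to B$ of unitary graded algebras, $x\in A$, $f\in\mathrm{End}^*(A)$, $g\in\mathrm{End}^*(B)$ with $g\alpha=\alpha f$, one has $\alpha\Psi^n_x=\Psi^n_{\alpha(x)}\alpha^{\odot n}$ and $\alpha\Psi^n_f=\Psi^n_g\alpha^{\odot n}$; (3) if $c\in A$ is homogeneous with $ac=(-1)^{|a||c|}ca$ for all homogeneous $a\in A$, then $\Psi^n_1(a_1,\ldots,a_nc)=\Psi^n_1(a_1,\ldots,a_n)c$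 and $\Psi^n_{Id}(a_1,\ldots,a_nc)=\Psi^n_{Id}(a_1,\ldots,a_n)c$; (4) $\Psi^0_x=x$ and $\Psi^0_f=f(1)$ for $x\in A$, $f\in\mathrm{End}^*(A)$; (5) for $A=\mathbb{K}$, $\Psi^n_{Id}=0$ for every $n>0$. *)

(* Defs.v *)
From HB Require Import structures.
From mathcomp Require Import all_boot all_order perm all_algebra.
Set Implicit Arguments.
Unset Strict Implicit.
Unset Printing Implicit Defensive.
Import GRing.Theory.
Local Open Scope ring_scope.

Section GradedSpaces.

Variables (K : fieldType) (V : lmodType K).

(* An internal grading: the spaces [set v | gr i v] are subspaces of V and V
   is their direct sum.  As always, 0 is homogeneous of every degree. *)
Record grading (gr : int -> V -> Prop) : Prop := Grading {
  grading0 : forall i, gr i 0;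
  grading_lin : forall i (c : K) u v, gr i u -> gr i v -> gr i (c *: u + v);
  grading_sum : forall v, exists (s : seq int) (w : int -> V),
    (forall i, gr i (w i)) /\ v = \sum_(i <- s) w i;
  grading_direct : forall (s : seq int) (w : int -> V), uniq s ->
    (forall i, gr i (w i)) -> \sum_(i <- s) w i = 0 ->
    forall i, i \in s -> w i = 0
}.

End GradedSpaces.

(* Unitary associative graded algebras; the zero algebra is allowed, which is
   why this is not built on algType. *)
Record grAlg (K : fieldType) := GrAlg {
  carrier_lmod : lmodType K;
  gone : carrier_lmod;
  gmul : carrier_lmod -> carrier_lmod -> carrier_lmod;
  gdeg : int -> carrier_lmod -> Prop;
  gmulA : associative gmul;
  gmul1x : left_id gone gmul;
  gmulx1 : right_id gone gmul;
  gmulDl : left_distributive gmul +%R;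
  gmulDr : right_distributive gmul +%R;
  gmulZl : forall (c : K) a b, gmul (c *: a) b = c *: gmul a b;
  gmulZr : forall (c : K) a b, gmul a (c *: b) = c *: gmul a b;
  gdeg_grading : grading gdeg;
  gdeg_one : gdeg 0 gone;
  gdeg_mul : forall i j a b, gdeg i a -> gdeg j b -> gdeg (i + j) (gmul a b)
}.

Definition carrier (K : fieldType) (A : grAlg K) : Type := carrier_lmod A.
Coercion carrier : grAlg >-> Sortclass.

HB.instance Definition _ (K : fieldType) (A : grAlg K) :=
  GRing.Lmodule.copy (carrier A) (carrier_lmod A).
HB.instance Definition _ (K : fieldType) (A : grAlg K) :=
  GRing.Zmodule_isPzRing.Build (carrier A)
    (@gmulA K A) (@gmul1x K A) (@gmulx1 K A) (@gmulDl K A) (@gmulDr K A).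

Definition hdeg (K : fieldType) (A : grAlg K) (i : int) (a : A) : Prop :=
  gdeg i a.

Record grAlg_morphism (K : fieldType) (A B : grAlg K) (alpha : A -> B) : Prop :=
  GrAlgMorphism {
    grAlg_morphism_lin : linear alpha;
    grAlg_morphism1 : alpha 1 = 1;
    grAlg_morphismM : forall a b, alpha (a * b) = alpha a * alpha b;
    grAlg_morphism_deg : forall i a, hdeg i a -> hdeg i (alpha a)
  }.

Section GroundField.

Variable K : fieldType.

Definition ground_deg (i : int) (a : K^o) : Prop := i = 0 \/ a = 0.

Lemma ground_grading : grading ground_deg.
Proof.
split.
- by move=> i; right.
- move=> i c u v [->|->]; first by left.
  by case=> ->; [left | right; rewrite scaler0 addr0].
- move=> v; exists [:: 0], (fun i => if i == 0 then v else 0); split.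
    by move=> i; case: eqP => [->|_]; [left | right].
  by rewrite big_seq1 eqxx.
- move=> s w us hw sw0 i si; case: (hw i) => // i0; move: sw0 si.
  rewrite i0 => sw0 s0; rewrite -{}sw0 (bigD1_seq 0) //= big1 ?addr0 //.
  by move=> j /eqP j0; case: (hw j).
Qed.

Lemma ground_one : ground_deg 0 1. Proof. by left. Qed.

Lemma ground_mul i j a b :
  ground_deg i a -> ground_deg j b -> ground_deg (i + j) (a * b).
Proof.
case=> [->|->]; last by right; rewrite mul0r.
by case=> [->|->]; [left; rewrite addr0 | right; rewrite mulr0].
Qed.

(* K itself, concentrated in degree 0. *)
Definition groundAlg : grAlg K :=
  @GrAlg K K^o 1 *%R ground_deg (@mulrA K) (@mul1r K) (@mulr1 K)
    (@mulrDl K) (@mulrDr K) (fun c a b => esym (@scalerAl K K^o c a b))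
    (fun c a b => esym (@scalerAr K K^o c a b))
    ground_grading ground_one ground_mul.

End GroundField.

(* A pair (d, a) : int * A records an element a together with a chosen degree;
   signs are computed from the first components. *)
Definition homog (K : fieldType) (A : grAlg K) (s : seq (int * A)) : Prop :=
  forall p, p \in s -> hdeg p.1 p.2.

Definition degs T (s : seq (int * T)) : seq int := [seq p.1 | p <- s].
Definition elts T (s : seq (int * T)) : seq T := [seq p.2 | p <- s].

Definition permute (n : nat) (T : nmodType) (pi : 'S_n) (s : seq T) : seq T :=
  [seq s`_(pi i) | i <- enum 'I_n].

Section Signs.

Variable K : fieldType.

Definition sgn (m : int) : K := (-1) ^ m.

(* a_1 (.) ... (.) a_n = koszul pi d *: a_(pi 1) (.) ... (.) a_(pi n)
   where a_i has degree d_i. *)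
Definition koszul (n : nat) (pi : 'S_n) (d : seq int) : K :=
  \prod_(i < n) \prod_(j < n | (i < j)%N && (pi j < pi i)%N)
     sgn (d`_(pi i) * d`_(pi j)).

End Signs.

(* the set S(m, n - m) of unshuffles *)
Definition shuffle (n m : nat) (pi : 'S_n) : bool :=
  [forall i : 'I_n, forall j : 'I_n,
     ((i < j)%N && ((j < m)%N || (m <= i)%N)) ==> (pi i < pi j)%N].

Section OperatorsOnA.

Variables (K : fieldType) (A : grAlg K).

Definition homEnd (i : int) (f : A -> A) : Prop :=
  linear f /\ forall j a, hdeg j a -> hdeg (i + j) (f a).

Definition endStar (f : A -> A) : Prop :=
  exists (s : seq int) (g : int -> A -> A),
    (forall i, homEnd i (g i)) /\ forall a, f a = \sum_(i <- s) g i a.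

(* An element (F_n)_(n >= -1) of D(A) is represented by a function on lists:
   F_n is its restriction to lists of length n + 1, so that F_(-1) in A is the
   value at the empty list. *)
Definition multilinear (F : seq A -> A) : Prop :=
  forall (s1 s2 : seq A) (c : K) u v,
    F (s1 ++ (c *: u + v) :: s2) = c *: F (s1 ++ u :: s2) + F (s1 ++ v :: s2).

Definition graded_symmetric (F : seq A -> A) : Prop :=
  forall s : seq (int * A), homog s -> forall pi : 'S_(size s),
    F (elts s) = koszul K pi (degs s) *: F (elts (permute pi s)).

Definition has_degree (i : int) (F : seq A -> A) : Prop :=
  forall s : seq (int * A), homog s ->
    hdeg (i + \sum_(d <- degs s) d) (F (elts s)).

Definition inD (i : int) (F : seq A -> A) : Prop :=
  [/\ multilinear F, graded_symmetric F & has_degree i F].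

(* F barwedge G and the Nijenhuis-Richardson bracket [F, G], for F, G of
   degrees i, j, evaluated at a list of homogeneous elements (which
   determines them by multilinearity); m is the arity of the component of G. *)
Definition barwedge (F G : seq A -> A) (s : seq (int * A)) : A :=
  \sum_(m < (size s).+1) \sum_(pi : 'S_(size s) | shuffle m pi)
    koszul K pi (degs s) *:
      F (G (elts (take m (permute pi s))) :: elts (drop m (permute pi s))).

Definition NRbracket (i j : int) (F G : seq A -> A) (s : seq (int * A)) : A :=
  barwedge F G s - sgn K (i * j) *: barwedge G F s.

(* Aff^*(A) = A x End^*(A) inside D(A) *)
Definition aff : Type := (A * (A -> A))%type.

Definition inAff (u : aff) : Prop := endStar u.2.
Definition inAff_deg (i : int) (u : aff) : Prop := hdeg i u.1 /\ homEnd i u.2.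

Definition affElt (x : A) : aff := (x, fun=> 0).
Definition affEnd (f : A -> A) : aff := (0, f).

Definition affLin (c : K) (u w : aff) : aff :=
  (c *: u.1 + w.1, fun a => c *: u.2 a + w.2 a).

Definition aff_to_D (u : aff) (s : seq A) : A :=
  match s with
  | [::] => u.1
  | [:: a] => u.2 a
  | _ => 0
  end.

(* the Nijenhuis-Richardson bracket of u, w of degrees i, j; see affBracketE *)
Definition affBracket (i j : int) (u w : aff) : aff :=
  (u.2 w.1 - sgn K (i * j) *: w.2 u.1,
   fun a => u.2 (w.2 a) - sgn K (i * j) *: w.2 (u.2 a)).

Lemma barwedge_affE (u w : aff) (s : seq (int * A)) : u.2 0 = 0 ->
  barwedge (aff_to_D u) (aff_to_D w) s =
  aff_to_D (u.2 w.1, u.2 \o w.2) (elts s).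
Proof.
move=> u0; have sP m n (pi : 'S_n) :
    size (elts (drop m (permute pi s))) = (n - m)%N.
  by rewrite size_map size_drop size_map size_enum_ord.
have sT m n (pi : 'S_n) : (m <= n)%N -> size (elts (take m (permute pi s))) = m.
  by move=> mn; rewrite size_map size_takel // size_map size_enum_ord.
have aD (v : aff) t : (1 < size t)%N -> aff_to_D v t = 0.
  by case: t => [|x [|y t]].
rewrite /barwedge big_ord_recr big1 => [|m _]; last first.
  rewrite big1 // => pi _; rewrite (aD u) ?scaler0 //= sP ltnS subn_gt0.
  exact: ltn_ord.
rewrite [LHS]add0r; have kE n (pi : 'S_n) d : (n < 2)%N -> koszul K pi d = 1.
  move=> n2; rewrite /koszul big1 // => i _; rewrite big_pred0 // => j.
  case: i j => i Hi [j Hj] /=; apply/negbTE.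
  by move: n i j Hi Hj n2 pi => [|[|n]] // [|i] [|j].
case: s sP sT => [|p [|q s]] sP sT.
- rewrite (big_pred1 (1%g : 'S_0)) => [|pi]; last first.
    have -> : pi = 1%g by apply/permP => -[].
    by rewrite /= eqxx; apply/forallP => -[].
  rewrite kE // scale1r.
  have P t : size t = 0%N -> t = [::] :> seq A by case: t.
  by rewrite (P _ (sP 0%N 0%N 1%g)) (P _ (sT 0%N 0%N 1%g isT)).
- rewrite (big_pred1 (1%g : 'S_1)) => [|pi]; last first.
    have -> : pi = 1%g by apply/permP => i; rewrite !ord1.
    by rewrite /= eqxx; apply/forallP => i; apply/forallP => j; rewrite !ord1.
  have sz : (size (permute (1%g : 'S_1) [:: p]) <= 1)%N.
    by rewrite size_map size_enum_ord.
  rewrite kE // scale1r take_oversize // drop_oversize //.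
  rewrite /permute enum_ordSl /= perm1.
  by have -> : enum 'I_0 = [::] by apply/size0nil; rewrite size_enum_ord.
- rewrite big1 // => pi _.
  have sz : (size (permute pi [:: p, q & s]) <= size [:: p, q & s])%N.
    by rewrite size_map size_enum_ord.
  by rewrite drop_oversize // (aD w) ?sT //= u0 scaler0.
Qed.

Lemma affBracketE (i j : int) (u w : aff) : inAff_deg i u -> inAff_deg j w ->
  forall s : seq (int * A),
    aff_to_D (affBracket i j u w) (elts s) =
    NRbracket i j (aff_to_D u) (aff_to_D w) s.
Proof.
move=> [_ [lu _]] [_ [lw _]] s.
have lin0 (f : A -> A) : linear f -> f 0 = 0.
  by move=> lf; have := lf (-1) 0 0; rewrite !scaleN1r oppr0 addr0 addNr.
rewrite /NRbracket !barwedge_affE; try exact: lin0.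
by case: s => [|p [|q s]] //=; rewrite scaler0 subrr.
Qed.

End OperatorsOnA.

Section KoszulBrackets.

Variable K : fieldType.

Definition bracketAssignment : Type :=
  forall A : grAlg K, aff A -> seq A -> A.

Record isKoszul (Psi : bracketAssignment) : Prop := IsKoszul {
  koszul_lin : forall (A : grAlg K) (c : K) (u w : aff A) (s : seq A),
    inAff u -> inAff w ->
    Psi A (affLin c u w) s = c *: Psi A u s + Psi A w s;
  koszul_deg : forall (A : grAlg K) (i : int) (u : aff A),
    inAff_deg i u -> inD i (Psi A u);
  koszul_lie : forall (A : grAlg K) (i j : int) (u w : aff A),
    inAff_deg i u -> inAff_deg j w ->
    forall s : seq (int * A), homog s ->
      Psi A (affBracket i j u w) (elts s) =
      NRbracket i j (Psi A u) (Psi A w) s;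
  koszul_nat_elt : forall (A B : grAlg K) (alpha : A -> B),
    grAlg_morphism alpha -> forall (x : A) (s : seq A),
      alpha (Psi A (affElt x) s) = Psi B (affElt (alpha x)) (map alpha s);
  koszul_nat_end : forall (A B : grAlg K) (alpha : A -> B),
    grAlg_morphism alpha -> forall (f : A -> A) (g : B -> B),
      endStar f -> endStar g -> (forall a, g (alpha a) = alpha (f a)) ->
      forall s : seq A,
        alpha (Psi A (affEnd f) s) = Psi B (affEnd g) (map alpha s);
  koszul_central_elt : forall (A : grAlg K) (i : int) (c : A), hdeg i c ->
    (forall j (a : A), hdeg j a -> a * c = sgn K (j * i) *: (c * a)) ->
    forall (s : seq A) (a : A),
      Psi A (affElt 1) (rcons s (a * c)) = Psi A (affElt 1) (rcons s a) * c;
  koszul_central_end : forall (A : grAlg K) (i : int) (c : A), hdeg i c ->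
    (forall j (a : A), hdeg j a -> a * c = sgn K (j * i) *: (c * a)) ->
    forall (s : seq A) (a : A),
      Psi A (affEnd id) (rcons s (a * c)) = Psi A (affEnd id) (rcons s a) * c;
  koszul0_elt : forall (A : grAlg K) (x : A), Psi A (affElt x) [::] = x;
  koszul0_end : forall (A : grAlg K) (f : A -> A), endStar f ->
    Psi A (affEnd f) [::] = f 1;
  koszul_ground : forall s : seq (groundAlg K), (0 < size s)%N ->
    Psi (groundAlg K) (affEnd id) s = 0
}.

End KoszulBrackets.

(* Coefficientwise form of the identity of formal power series
   (\sum_n B_n x^n / n!) * (e^x - 1) = x. *)
Definition isBernoulli (K : fieldType) (B : nat -> K) : Prop :=
  forall n : nat,
    \sum_(k < n.+1) (B k / k`!%:R) *
       (if (n - k == 0)%N then 0 else (n - k)`!%:R^-1) = (n == 1)%:R.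

Section Formulas.

Variables (K : fieldType) (A : grAlg K).

Definition hmul (p q : int * A) : int * A := (p.1 + q.1, p.2 * q.2).

Definition hbrace (p q : int * A) : int * A :=
  (p.1 + q.1, p.2 * q.2 - sgn K (p.1 * q.1) *: (q.2 * p.2)).

(* [f, L_a] for f of degree g.1, the graded commutator in End^*(A) *)
Definition adL (g : int * (A -> A)) (p : int * A) : int * (A -> A) :=
  (g.1 + p.1,
   fun b => g.2 (p.2 * b) - sgn K (g.1 * p.1) *: (p.2 * g.2 b)).

(* f_k(a_1, ..., a_k) together with its degree *)
Definition fop (g : int * (A -> A)) (s : seq (int * A)) : int * A :=
  let h := foldl adL g s in (h.1, h.2 1).

(* {{... {p, b_1}, ...}, b_r} *)
Definition nestBrace (p : int * A) (s : seq (int * A)) : A :=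
  (foldl hbrace p s).2.

End Formulas.

(* Main.v *)
(**
  Graded symmetric multilinear maps are read as formal vector fields in a
  generic element a of A, and the Nijenhuis-Richardson bracket as their
  commutator.  The affine field u corresponds under Psi to its pullback along
  the exponential a |-> e^a; this is derived from the axioms as follows.

  A natural operation with values in A is a noncommutative polynomial in its
  arguments, with coefficients that do not depend on the degrees (multiply an
  argument by a central element of arbitrary degree), so that it is determined
  by its value on (1, ..., 1) in K.  Hence Psi_Id is the constant field 1 and,
  as [Id, 1] = 1, Psi_1 is the field e^(-a).

  Let D_u be the derivative of e^a along Psi_u.  From [Id, x] = x and
  [x, 1] = 0 one gets D_x = x.  From [f, x] = f(x) it follows that D_f and
  f(e^a) have the same derivative along every Psi_x; they agree at a = 0, hence
  D_f = f(e^a).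

  Finally let L and R be the left and right multiplication by a.  The
  derivative of e^a along Y is ((e^L - e^R) / (L - R)) Y, whose inverse is
  B(L - R) e^(-R) = B(R - L) e^(-L) with B(z) = z / (e^z - 1).  Nested braces
  are powers of R - L, and e^(-L) f(e^a) is the sum of the f_k(a, ..., a) / k!.
*)
From HB Require Import structures.
Require Import Defs.
From mathcomp Require Import all_boot all_order perm all_algebra.
From mathcomp Require Import boolp functions.
From mathcomp Require Import ring zify.
Set Implicit Arguments.
Unset Strict Implicit.
Unset Printing Implicit Defensive.
Import GRing.Theory.
Local Open Scope ring_scope.

(** The obstacle is the Koszul sign. Treating multilinear maps as functions of one generic element a
    is legitimate only if signs never have to be tracked by hand. Hence sums over permutations and
    unshuffles are replaced by recursions obeying the laws of a graded bialgebra: coassociativity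
    and cocommutativity of unshuffling, and its compatibility with cutting a word in two. All
    identities are asserted on lists of homogeneous elements with chosen degrees.

    A second obstacle is that free algebras are truncated to keep them finite, so they do not map to
    an arbitrary A. They do map to A[t] modulo a power of t, by sending a generator to a_i t, and
    the power of t then selects the arity.

    The two forms of the inverse explain the shape of the two formulas. For Psi_x the target is the
    constant x, and e^(-R) x has terms (-1)^k x a^k / k!; since B(L - R) is a series in -(R - L), it
    adds (-1)^(n-k), whence (-1)^n. For Psi_f the target is f(e^a), on which e^(-L) produces
    iterated commutators with L evaluated at 1, and B(R - L) adds no sign. *)

Section LinearFunctions.

Variables (K : fieldType) (V W : lmodType K) (f : V -> W).
Hypothesis lf : linear f.

Lemma linear_fun0 : f 0 = 0.
Proof. by have := lf (-1) 0 0; rewrite scaler0 addr0 scaleN1r addNr. Qed.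

Lemma linear_funD : {morph f : x y / x + y}.
Proof. by move=> x y; have := lf 1 x y; rewrite !scale1r. Qed.

Lemma linear_funZ c x : f (c *: x) = c *: f x.
Proof. by have := lf c x 0; rewrite linear_fun0 !addr0. Qed.

End LinearFunctions.

(** * Koszul signs and sums over unshuffles *)

Section Sign.
Variable K : fieldType.

Lemma sgn0 : sgn K 0 = 1. Proof. by rewrite /sgn expr0z. Qed.

Lemma sgnD m n : sgn K (m + n) = sgn K m * sgn K n.
Proof. by rewrite /sgn expfzDr // oppr_eq0 oner_eq0. Qed.

Lemma sgn_dbl m : sgn K (m + m) = 1.
Proof. by rewrite sgnD /sgn -exprMz_comm ?unitrN1 // ?mulrNN ?mulr1 ?exp1rz. Qed.

Lemma sgn_sqr m : sgn K m * sgn K m = 1.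
Proof. by rewrite -sgnD sgn_dbl. Qed.

(** Signs depend on exponents modulo 2, which [ring] cannot see; each use supplies half of the even
    discrepancy as k and leaves an integer identity. *)
Lemma sgn_par m n k : m = n + (k + k) -> sgn K m = sgn K n.
Proof. by move=> ->; rewrite sgnD sgn_dbl mulr1. Qed.

Lemma sgnMM m n : sgn K m * sgn K n = sgn K (m + n).
Proof. by rewrite sgnD. Qed.

End Sign.

Section Factorizations.

Variables (X : Type) (V : nmodType).
Implicit Types (w x y : seq X) (F G : seq X -> seq X -> V).

(** Deconcatenation of the word w, paired with F. It gives both the product of word algebras and the
    cutting of a rearranged list. *)
Fixpoint sum_split w F : V :=
  F [::] w + if w is q :: w' then sum_split w' (fun x y => F (q :: x) y) else 0.

Lemma eq_sum_split w F G : (forall x y, x ++ y = w -> F x y = G x y) ->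
  sum_split w F = sum_split w G.
Proof.
elim: w F G => [|q w IH] F G FG /=; rewrite FG //; congr (_ + _).
by apply: IH => x y xy; rewrite FG //= xy.
Qed.

Lemma sum_splitD w F G : sum_split w (fun x y => F x y + G x y) = sum_split w F + sum_split w G.
Proof.
by elim: w F G => [|q w IH] F G /=; rewrite ?IH ?addr0 // addrACA.
Qed.

Lemma sum_split0 w : sum_split w (fun _ _ => 0) = 0.
Proof. by elim: w => [|q w IH] /=; rewrite ?IH addr0. Qed.

(** Coassociativity: both sides run over the factorizations of w into three words. *)
Lemma sum_splitA w (H : seq X -> seq X -> seq X -> V) :
  sum_split w (fun x z => sum_split x (fun a b => H a b z)) =
  sum_split w (fun a y => sum_split y (fun b z => H a b z)).
Proof.
elim: w H => [//|q w IH] H /=.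
by rewrite addr0 sum_splitD IH -addrA.
Qed.

Lemma sum_split0l w (f : seq X -> V) :
  sum_split w (fun x y => if x is [::] then f y else 0) = f w.
Proof. by case: w => [|q w] /=; rewrite ?sum_split0 addr0. Qed.

Lemma sum_split0r w (f : seq X -> V) :
  sum_split w (fun x y => if y is [::] then f x else 0) = f w.
Proof.
by elim: w f => [|q w IH] f /=; rewrite ?addr0 // IH add0r.
Qed.

Lemma sum_split_closed (Q : V -> Prop) w F : Q 0 ->
  (forall a b, Q a -> Q b -> Q (a + b)) ->
  (forall x y, x ++ y = w -> Q (F x y)) -> Q (sum_split w F).
Proof.
move=> Q0 QD; elim: w F => [|q w IH] F QF /=; apply: QD => //; try exact: QF.
by apply: IH => x y xy; apply: QF; rewrite /= xy.
Qed.

End Factorizations.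

Lemma sum_split_map (X : Type) (V W : nmodType) (f : V -> W) (w : seq X) F :
  f 0 = 0 -> {morph f : a b / a + b} ->
  f (sum_split w F) = sum_split w (fun x y => f (F x y)).
Proof.
by move=> f0 fD; elim: w F => [|q w IH] F /=; rewrite fD ?IH ?f0.
Qed.

Section SignedSums.

Variables (K : fieldType) (T : nmodType).
Local Notation P := (int * T)%type.
Local Notation sg := (sgn K).
Implicit Types (p q : P) (s u v w x y : seq P).

Definition tdeg s : int := \sum_(p <- s) p.1.

Lemma tdeg_nil : tdeg [::] = 0. Proof. exact: big_nil. Qed.
Lemma tdeg_cons p s : tdeg (p :: s) = p.1 + tdeg s.
Proof. exact: big_cons. Qed.
Lemma tdeg_cat s1 s2 : tdeg (s1 ++ s2) = tdeg s1 + tdeg s2.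
Proof. exact: big_cat. Qed.
Lemma tdeg_rcons s p : tdeg (rcons s p) = tdeg s + p.1.
Proof. by rewrite -cats1 tdeg_cat tdeg_cons tdeg_nil addr0. Qed.
Lemma perm_tdeg s1 s2 : perm_eq s1 s2 -> tdeg s1 = tdeg s2.
Proof. exact: perm_big. Qed.

Lemma tdeg_swap u p q v : tdeg (u ++ [:: p, q & v]) = tdeg (u ++ [:: q, p & v]).
Proof. by rewrite !tdeg_cat !tdeg_cons [p.1 + _]addrCA. Qed.

Section Ops.
Variable V : lmodType K.
Implicit Types (F G : seq P -> seq P -> V) (f g : seq P -> V).

(* Signed sums over the unshuffles (ush) and rearrangements (symr) of a list,
   and over the insertions of p into w (ins).  The continuation F absorbs the
   letters one at a time, so each Koszul sign is that of a single letter moved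
   to the left end. *)
Fixpoint ush s F : V :=
  if s is p :: s' then
    ush s' (fun u v => F (p :: u) v)
    + ush s' (fun u v => sg (p.1 * tdeg u) *: F u (p :: v))
  else F [::] [::].

Fixpoint ins p w f : V :=
  f (p :: w) +
  if w is q :: w' then sg (p.1 * q.1) *: ins p w' (fun x => f (q :: x)) else 0.

Fixpoint symr s f : V :=
  if s is p :: s' then symr s' (fun w => ins p w f) else f [::].

Lemma ush_cons p s F : ush (p :: s) F =
  ush s (fun u v => F (p :: u) v)
  + ush s (fun u v => sg (p.1 * tdeg u) *: F u (p :: v)).
Proof. by []. Qed.

Lemma symr_cons p s f : symr (p :: s) f = symr s (fun w => ins p w f).
Proof. by []. Qed.

Lemma eq_ush s F G : (forall u v, perm_eq (u ++ v) s -> F u v = G u v) ->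
  ush s F = ush s G.
Proof.
elim: s F G => [|p s IH] F G FG /=; first exact: FG.
congr (_ + _); apply: IH => u v uv; rewrite FG //=.
  by rewrite perm_cons.
by rewrite perm_catC /= perm_cons perm_catC.
Qed.

Lemma eq_ins p w f g : (forall x, perm_eq x (p :: w) -> f x = g x) ->
  ins p w f = ins p w g.
Proof.
elim: w f g => [|q w IH] f g fg /=; first by rewrite fg.
rewrite fg //; congr (_ + _ *: _); apply: IH => x xw; apply: fg.
by rewrite perm_sym -[p :: q :: w]/([:: p] ++ [:: q] ++ w) perm_catCA perm_sym perm_cons.
Qed.

Lemma eq_symr s f g : (forall w, perm_eq w s -> f w = g w) ->
  symr s f = symr s g.
Proof.
elim: s f g => [|p s IH] f g fg /=; first exact: fg.
apply: IH => w ws; apply: eq_ins => x xw; apply: fg.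
by rewrite (perm_trans xw) ?perm_cons.
Qed.

Lemma ush_lin c s F G :
  ush s (fun u v => c *: F u v + G u v) = c *: ush s F + ush s G.
Proof.
elim: s c F G => [|p s IH] c F G //=.
rewrite scalerDr addrACA -!IH; congr (_ + _); apply: eq_ush => u v _.
by rewrite scalerDr !scalerA mulrC.
Qed.

Lemma ins_lin c p w f g :
  ins p w (fun x => c *: f x + g x) = c *: ins p w f + ins p w g.
Proof.
elim: w f g => [|q w IH] f g /=; first by rewrite !addr0.
by rewrite IH !scalerDr !scalerA addrACA mulrC.
Qed.

Lemma symr_lin c s f g :
  symr s (fun x => c *: f x + g x) = c *: symr s f + symr s g.
Proof.
by elim: s f g => [|p s IH] f g //=; under eq_symr do rewrite ins_lin; rewrite IH.
Qed.

Lemma ushD s F G :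
  ush s (fun u v => F u v + G u v) = ush s F + ush s G.
Proof.
rewrite -[ush s F]scale1r -ush_lin; apply: eq_ush => u v _.
by rewrite scale1r.
Qed.

Lemma ush0 s : ush s (fun _ _ => 0) = 0 :> V.
Proof. by elim: s => //= p s IH; under [X in _ + X]eq_ush do rewrite scaler0; rewrite IH addr0. Qed.

Lemma ushZ c s F : ush s (fun u v => c *: F u v) = c *: ush s F.
Proof.
rewrite -[RHS]addr0 -(ush0 s) -ush_lin; apply: eq_ush => u v _.
by rewrite addr0.
Qed.

Lemma symrD s f g : symr s (fun x => f x + g x) = symr s f + symr s g.
Proof.
rewrite -[symr s f]scale1r -symr_lin; apply: eq_symr => u _.
by rewrite scale1r.
Qed.

Lemma symr0 s : symr s (fun _ => 0) = 0 :> V.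
Proof.
have ins0 p w : ins p w (fun _ => 0) = 0 :> V.
  by elim: w => [|q w IH] /=; rewrite ?IH ?scaler0 addr0.
by elim: s => //= p s IH; under eq_symr do rewrite ins0.
Qed.

Lemma symrZ c s f : symr s (fun x => c *: f x) = c *: symr s f.
Proof.
rewrite -[RHS]addr0 -(symr0 s) -symr_lin; apply: eq_symr => u _.
by rewrite addr0.
Qed.

Lemma insD p w f g : ins p w (fun x => f x + g x) = ins p w f + ins p w g.
Proof.
rewrite -[ins p w f]scale1r -ins_lin; apply: eq_ins => u _.
by rewrite scale1r.
Qed.

Lemma sum_splitZ c w F : sum_split w (fun x y => c *: F x y) = c *: sum_split w F.
Proof.
elim: w F => [|q w IH] F /=; first by rewrite !addr0.
by rewrite IH scalerDr.
Qed.

(** Graded cocommutativity: exchanging the two blocks costs the sign of moving one past the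
    other. *)
Lemma ushC s F :
  ush s F = ush s (fun u v => sg (tdeg u * tdeg v) *: F v u).
Proof.
elim: s F => [|p s IH] F /=; first by rewrite tdeg_nil mulr0 sgn0 scale1r.
rewrite addrC; congr (_ + _); rewrite IH; apply: eq_ush => u v _.
  rewrite tdeg_cons scalerA sgnMM; congr (sgn K _ *: _); ring.
by rewrite tdeg_cons !scalerA sgnMM; congr (_ *: _); apply: (@sgn_par _ _ _ (- (p.1 * tdeg u))); ring.
Qed.

(** Coassociativity: both sides distribute s over three blocks with the same sign. It drives all
    later regroupings of arguments. *)
Lemma ushA s (H : seq P -> seq P -> seq P -> V) :
  ush s (fun u w => ush u (fun x y => H x y w)) =
  ush s (fun x w => ush w (fun y z => H x y z)).
Proof.
elim: s H => [|p s IH] H //=.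
rewrite !ushD !IH -!addrA; congr (_ + _).
under [X in _ = X]eq_ush do rewrite scalerDr.
rewrite ushD; congr (_ + _).
  by apply: eq_ush => x w _; rewrite ushZ.
have -> : ush s (fun u v => sg (p.1 * tdeg u) *: ush u (fun x y => H x y (p :: v))) =
  ush s (fun u v => ush u (fun x y => sg (p.1 * (tdeg x + tdeg y)) *: H x y (p :: v))).
  apply: eq_ush => u v _; rewrite -ushZ; apply: eq_ush => x y xy.
  by rewrite -(perm_tdeg xy) tdeg_cat.
rewrite (IH (fun x y z => _ *: H x y (p :: z))); apply: eq_ush => x w _.
by rewrite -ushZ; apply: eq_ush => y z _; rewrite scalerA sgnMM mulrDr.
Qed.

Lemma ush0r s (f : seq P -> V) :
  ush s (fun u v => if v is [::] then f u else 0) = f s.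
Proof.
elim: s f => [|p s IH] f //=; rewrite IH.
by under [X in _ + X]eq_ush do rewrite scaler0; rewrite ush0 addr0.
Qed.

Lemma ush0l s (f : seq P -> V) :
  ush s (fun u v => if u is [::] then f v else 0) = f s.
Proof.
rewrite ushC -[RHS]ush0r; apply: eq_ush => u [|q v] _; rewrite ?scaler0 //.
by rewrite tdeg_nil mulr0 sgn0 scale1r.
Qed.

Lemma ins_rcons p w q f :
  ins p (rcons w q) f =
  ins p w (fun x => f (rcons x q))
  + sg (p.1 * (tdeg w + q.1)) *: f (rcons (rcons w q) p).
Proof.
elim: w f => [|r w IH] f /=; first by rewrite tdeg_nil add0r !addr0.
rewrite IH scalerDr !addrA scalerA sgnMM tdeg_cons; congr (_ + sgn K _ *: _); ring.
Qed.

(** Classifies rearrangements by their last letter, whereas [symr] recurses on the first letter of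
    s. Nested braces and commutators grow at the right end and need this form. For s empty the right
    side would be 0 instead of f [::]. *)
Lemma symr_rcons s f : s != [::] ->
  symr s f =
  ush s (fun u v => if v is [:: q] then symr u (fun w => f (rcons w q)) else 0).
Proof.
elim: s f => [//|p [|r s] IH] f _.
  by rewrite /= tdeg_nil mulr0 sgn0 scale1r add0r addr0.
set s' := r :: s in IH *.
(* The rearrangements in which p itself comes last: then u must be all of s'. *)
have E : ush s' (fun u v => sg (p.1 * tdeg u) *:
    (if p :: v is [:: q] then symr u (fun w => f (rcons w q)) else 0)) =
  sg (p.1 * tdeg s') *: symr s' (fun w => f (rcons w p)).
  rewrite -[RHS](@ush0r s' (fun u => sg (p.1 * tdeg u) *: _)).
  by apply: eq_ush => u [|q v] _ //; rewrite scaler0.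
rewrite symr_cons ush_cons E !IH // -ushZ -ushD.
apply: eq_ush => u [|q [|q' v]] uv; rewrite ?scaler0 ?addr0 //.
under eq_symr do rewrite ins_rcons.
rewrite symrD; congr (_ + _).
rewrite -symrZ; apply: eq_symr => w wu.
by rewrite -(perm_tdeg uv) cats1 tdeg_rcons (perm_tdeg wu).
Qed.

(** After the cut, p lies in the left piece or has jumped over it into the right one. *)
Lemma ins_sum_split p w F :
  ins p w (fun x => sum_split x F) =
  sum_split w (fun x y => ins p x (F^~ y) + sg (p.1 * tdeg x) *: ins p y (F x)).
Proof.
elim: w F => [|q w IH] F /=.
  by rewrite !addr0 tdeg_nil mulr0 sgn0 scale1r addrC.
rewrite insD IH /= tdeg_nil mulr0 sgn0 scale1r scalerDr.
have -> : sum_split w (fun x y => F [:: p, q & x] y + sg (p.1 * q.1) *: ins p x (fun z => F (q :: z) y) +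
     sg (p.1 * tdeg (q :: x)) *: ins p y (F (q :: x)))
  = sum_split w (fun x y => F [:: p, q & x] y) + sg (p.1 * q.1) *:
    sum_split w (fun x y => ins p x (fun z => F (q :: z) y) + sg (p.1 * tdeg x) *: ins p y (F (q :: x))).
  rewrite -sum_splitZ -sum_splitD; apply: eq_sum_split => x y _.
  by rewrite tdeg_cons mulrDr sgnD scalerDr scalerA addrA.

have abel (a b c d e : V) : a + (b + c) + (d + e) = b + 0 + (a + d) + (c + e).
  by rewrite addr0 [a + (b + c)]addrA addrACA [a + b]addrC -[b + a + d]addrA.
exact: abel.
Qed.

Lemma ins_symr p w v F : ins p w (fun x => symr v (fun y => F x y)) =
  symr v (fun y => ins p w (F^~ y)).
Proof.
elim: w F => [|q w IH] F /=; first by rewrite addr0; apply: eq_symr => y _; rewrite addr0.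
by rewrite IH -symrZ -symrD.
Qed.

(** Bialgebra compatibility: rearranging and then cutting amounts to distributing the letters over
    two blocks and rearranging each. Product formulas for symmetrized products rest on this. *)
Lemma symr_sum_split s F :
  symr s (fun w => sum_split w F) =
  ush s (fun u v => symr u (fun x => symr v (fun y => F x y))).
Proof.
elim: s F => [|p s IH] F /=; first by rewrite addr0.
under eq_symr do rewrite ins_sum_split.
rewrite IH -ushD; apply: eq_ush => u v _.
under [X in _ = X + _]eq_symr do rewrite ins_symr.
rewrite -[X in _ = _ + X]symrZ -symrD; apply: eq_symr => x xu.
by rewrite -(perm_tdeg xu) symrD symrZ.
Qed.

End Ops.

Lemma ush_map (V W : lmodType K) (f : V -> W) s
    (F : seq P -> seq P -> V) : linear f ->
  f (ush s F) = ush s (fun u v => f (F u v)).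
Proof.
move=> lf; elim: s F => [|p s IH] F //=.
rewrite (linear_funD lf) !IH; congr (_ + _).
by apply: eq_ush => u v _; rewrite (linear_funZ lf).
Qed.

End SignedSums.

(** * Sums over permutations as iterated insertions *)

Section PermutationSums.

Variables (K : fieldType) (T : nmodType) (V : lmodType K).
Local Notation P := (int * T)%type.
Local Notation sg := (sgn K).

Lemma size_permute (S : nmodType) n (pi : 'S_n) (s : seq S) :
  size (permute pi s) = n.
Proof. by rewrite size_map size_enum_ord. Qed.

Lemma nth_permute (S : nmodType) n (pi : 'S_n) (s : seq S) (i : 'I_n) :
  (permute pi s)`_i = s`_(pi i).
Proof. by rewrite (nth_map i) ?size_enum_ord // nth_ord_enum. Qed.

(** A permutation amounts to the position j of the first letter and an arrangement of the others,
    which is the recursion of [symr]. *)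
Lemma sum_lift_perm (U : nmodType) n (G : 'S_n.+1 -> U) :
  \sum_pi G pi = \sum_(j < n.+1) \sum_(pi : 'S_n) G (lift_perm j ord0 pi).
Proof.
rewrite (partition_big (fun s : 'S_n.+1 => (s^-1)%g ord0) predT) //=.
apply: eq_bigr => j _; rewrite (reindex (lift_perm j ord0)); last first.
  pose ulsf i (s : 'S_n.+1) k := odflt k (unlift (s i) (s (lift i k))).
  have ulsfK i (s : 'S_n.+1) k: lift (s i) (ulsf i s k) = s (lift i k).
    rewrite /ulsf; have:= neq_lift i k.
    by rewrite -(can_eq (permK s)) => /unlift_some[] ? ? ->.
  have inj_ulsf: injective (ulsf j _).
    move=> s; apply: can_inj (ulsf (s j) s^-1%g) _ => k'.
    by rewrite {1}/ulsf ulsfK !permK liftK.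
  exists (fun s => perm (inj_ulsf s)) => [s _ | s].
    by apply/permP=> k'; rewrite permE /ulsf lift_perm_lift lift_perm_id liftK.
  rewrite inE (canF_eq (permKV s)) eq_sym => /eqP sj; apply/permP=> k.
  case: (unliftP j k) => [k'|] ->; rewrite ?lift_perm_id //.
  by rewrite lift_perm_lift -sj permE ulsfK.
by apply: eq_bigl => pi; rewrite (canF_eq (permKV _)) lift_perm_id eqxx.
Qed.

Lemma permute_lift n (j : 'I_n.+1) (pi : 'S_n) (S : nmodType) (p : S) s :
  permute (lift_perm j ord0 pi) (p :: s) =
  take j (permute pi s) ++ p :: drop j (permute pi s).
Proof.
have jn : (j <= n)%N by rewrite -ltnS.
have st : size (take j (permute pi s)) = j by rewrite size_takel // size_permute.
apply: (@eq_from_nth _ 0) => [|i].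
  by rewrite size_cat /= size_drop !size_permute st addnS subnKC.
rewrite size_permute => ltin; rewrite (@nth_permute _ _ _ _ (Ordinal ltin)).
case: (unliftP j (Ordinal ltin)) => [k|] Ek; rewrite Ek; last first.
  rewrite lift_perm_id /=; have -> : i = j by have := congr1 val Ek.
  by rewrite nth_cat st ltnn subnn.
rewrite lift_perm_lift /=.
have -> : i = bump j k by have := congr1 val Ek.
rewrite -nth_permute nth_cat st /bump; case: (leqP j k) => jk.
  rewrite add1n ltnNge (leq_trans jk) //= subSn //= nth_drop subnKC //.
by rewrite add0n jk nth_take.
Qed.

Lemma prod_sgn n (P0 : pred 'I_n) (e : int) (d : 'I_n -> int) :
  \prod_(i | P0 i) sg (d i * e) = sg (e * \sum_(i | P0 i) d i).
Proof.
rewrite mulr_sumr.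
rewrite (big_morph (sgn K) (@sgnD K) (sgn0 K)).
by apply: eq_bigr => i _; rewrite mulrC.
Qed.

Lemma tdeg_take_permute n (pi : 'S_n) (s : seq P) j : (j <= n)%N ->
  tdeg (take j (permute pi s)) = \sum_(i < n | (i < j)%N) (degs s)`_(pi i).
Proof.
move=> jn; rewrite /tdeg (big_nth 0) size_takel ?size_permute //.
rewrite big_mkord (big_ord_widen _ (fun i => (nth 0 (take j (permute pi s)) i).1) jn).
apply: eq_bigr => i ij; rewrite nth_take // nth_permute.
case: (ltnP (pi i) (size s)) => ps; first by rewrite (nth_map 0).
by rewrite !nth_default // size_map.
Qed.

(** The inversions involving p are exactly those with the j letters now standing before it. *)
Lemma koszul_lift n (j : 'I_n.+1) (pi : 'S_n) (p : P) s :
  koszul K (lift_perm j ord0 pi) (degs (p :: s)) =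
  sg (p.1 * tdeg (take j (permute pi s))) * koszul K pi (degs s).
Proof.
rewrite tdeg_take_permute; last by rewrite -ltnS.
rewrite -prod_sgn [in RHS]big_mkcond -big_split /=.
rewrite /koszul (bigD1_ord j) //= [X in X * _]big1 ?mul1r; last first.
  by move=> k; rewrite lift_perm_id ltn0 andbF.
apply: eq_bigr => i _.
rewrite big_mkcond (bigD1_ord j) //=; congr (_ * _).
  rewrite lift_perm_id lift_perm_lift /= andbT /bump.
  case: (leqP j i) => ij; last by rewrite add0n ij.
  by rewrite add1n ltnNge leqW.
rewrite [RHS]big_mkcond; apply: eq_bigr => k _.
rewrite !lift_perm_lift !lift0 ltnS /=.
by have -> : (bump j i < bump j k)%N = (i < k)%N by rewrite !ltnNge leq_bump2.
Qed.

Lemma ins_take (p : P) w (f : seq P -> V) :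
  ins p w f =
  \sum_(j < (size w).+1) sg (p.1 * tdeg (take j w)) *: f (take j w ++ p :: drop j w).
Proof.
elim: w f => [|q w IH] f /=.
  by rewrite big_ord1 /= tdeg_nil mulr0 sgn0 scale1r addr0.
rewrite big_ord_recl /= tdeg_nil mulr0 sgn0 scale1r IH scaler_sumr; congr (_ + _).
by apply: eq_bigr => i _; rewrite scalerA sgnMM -mulrDr -tdeg_cons.
Qed.

(** Turns the permutation sums of the final formulas into the recursion on which the proof works. *)
Lemma symr_permE n (s : seq P) (f : seq P -> V) : size s = n ->
  \sum_(pi : 'S_n) koszul K pi (degs s) *: f (permute pi s) = symr s f.
Proof.
elim: n s f => [|n IH] [|p s] f //= => [_|[sn]].
  rewrite (big_pred1 (1%g : 'S_0)) => [|pi]; last first.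
    by have -> : pi = 1%g; [apply/permP => -[] | rewrite /= eqxx].
  rewrite /koszul big_ord0 scale1r; congr f; apply: size0nil.
  by rewrite size_permute.
rewrite sum_lift_perm exchange_big -(IH _ _ sn); apply: eq_bigr => pi _ /=.
rewrite ins_take size_permute scaler_sumr; apply: eq_bigr => j _.
by rewrite koszul_lift permute_lift scalerA mulrC.
Qed.

(** Blocks of an unshuffle are increasing, so the smallest letter must open the first block (j = 0)
    or the second one (j = m). *)
Lemma shuffle_lift n m (j : 'I_n.+1) (pi : 'S_n) :
  shuffle m (lift_perm j ord0 pi) =
  ((j == 0 :> nat) || (j == m :> nat)) && shuffle (if j == 0 :> nat then m.-1 else m) pi.
Proof.
have bumpS (a b : nat) : (bump j a < bump j b)%N = (a < b)%N by rewrite !ltnNge leq_bump2.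
apply/idP/andP => [/forallP sh | [jm /forallP sh]].
  have jm : (j == 0 :> nat) || (j == m :> nat).
    have [jm|jm|->] := ltngtP j m; last by rewrite orbT.
      have := forallP (sh ord0) j; rewrite jm lift_perm_id ltn0 implybF /= andbT.
      by rewrite lt0n orbF negbK.
    have mn : (m < n.+1)%N by rewrite (ltn_trans jm).
    have := forallP (sh (Ordinal mn)) j.
    by rewrite lift_perm_id ltn0 implybF /= jm leqnn orbT.
  split=> //; apply/forallP => a; apply/forallP => b; apply/implyP => /andP[ab bm].
  have := forallP (sh (lift j a)) (lift j b).
  rewrite !lift_perm_lift !lift0 ltnS /= bumpS ab /= => /implyP; apply.
  move: jm bm; case: eqP => [->|_] /=.
    by rewrite /bump /= !add1n => _; case: m {sh} => [|m] //; rewrite !ltnS.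
  move=> /eqP <-; rewrite /bump; case/orP => [bj|ja].
    by rewrite (ltn_geF bj) add0n bj.
  by rewrite ja /= add1n leqW // orbT.
apply/forallP => a; apply/forallP => b; apply/implyP.
case: (unliftP j a) => [a' ->|->]; case: (unliftP j b) => [b' ->|->]; last first.
- by rewrite ltnn.
- by rewrite lift_perm_id lift_perm_lift.
- move=> /= /andP[aj H]; exfalso; move: aj H; case/orP: jm => /eqP-> //.
  by rewrite ltnn /= ltnNge => /negP.
rewrite !lift_perm_lift !lift0 ltnS /= bumpS => /andP[ab bm].
have /forallP/(_ b')/implyP := sh a'; apply; rewrite ab /=.
move: jm bm; case: eqP => [->|_] /=.
  by rewrite /bump /= !add1n => _; case: m {sh} => [|m] //=; rewrite ?orbT // !ltnS.
move=> /eqP <-; rewrite /bump.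
by case: (leqP j b') => [jb|bj]; case: (leqP j a') => [//|aj]; rewrite ?add0n ?add1n ?orbT //= [(_ <= a')%N]leqNgt aj ?orbF // ltnNge leqW.
Qed.

(** For m = 0 the two cases of [shuffle_lift] coincide; the common term is counted once, as a letter
    opening the second block. *)
Lemma big_lift_shuffle (U : nmodType) n (G : nat -> 'S_n.+1 -> U) :
  \sum_(m < n.+2) \sum_(pi : 'S_n.+1 | shuffle m pi) G m pi =
  \sum_(m < n.+1) \sum_(pi : 'S_n | shuffle m pi)
     (G m.+1 (lift_perm ord0 ord0 pi) + G m (lift_perm (inord m) ord0 pi)).
Proof.
have E m : \sum_(pi : 'S_n.+1 | shuffle m pi) G m pi =
  \sum_(j < n.+1 | (j == 0 :> nat) || (j == m :> nat))
   \sum_(pi | shuffle (if j == 0 :> nat then m.-1 else m) pi) G m (lift_perm j ord0 pi).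
  rewrite big_mkcond sum_lift_perm [RHS]big_mkcond; apply: eq_bigr => j _.
  rewrite -big_mkcond /=; case: ifP => jm.
    by apply: eq_bigl => pi; rewrite shuffle_lift jm.
  by rewrite big_pred0 // => pi; rewrite shuffle_lift jm.
under eq_bigr do rewrite E.
under [RHS]eq_bigr do rewrite big_split.
rewrite big_split /=.
under eq_bigr => m _ do rewrite big_mkcond big_ord_recl /=.
rewrite big_split /=; rewrite big_ord_recl /= -addrA addrCA; congr (_ + _).
rewrite [in LHS]big_ord_recl /= [X in _ + (X + _)]big1 => [|j _]; last by [].
rewrite add0r [RHS]big_ord_recl /=; congr (_ + _).
  by apply: eq_bigr => pi _; congr (G _ (lift_perm _ _ _)); apply/val_inj; rewrite /= (@inordK n 0).
rewrite big_ord_recr /= [X in _ + X]big1 => [|j _]; last first.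
  by rewrite eqSS eqn_leq [(n <= _)%N]leqNgt ltn_ord andbF.
rewrite addr0; apply: eq_bigr => m _; rewrite /bump /= !add1n.
rewrite (bigD1 m) //= !eqxx [X in _ + X]big1 ?addr0 => [|j jm]; last first.
  by rewrite eqSS; case: eqP => // E'; case/eqP: jm; apply/val_inj.
apply: eq_bigr => pi _; congr (G _ (lift_perm _ _ _)); apply/val_inj.
by rewrite /= inordK // ltnS.
Qed.

Lemma shuffle_ushE n (s : seq P) (F : seq P -> seq P -> V) : size s = n ->
  \sum_(m < n.+1) \sum_(pi : 'S_n | shuffle m pi)
    koszul K pi (degs s) *: F (take m (permute pi s)) (drop m (permute pi s)) =
  ush s F.
Proof.
elim: n s F => [|n IH] [|p s] F //= => [_|[sn]].
  rewrite big_ord1 (big_pred1 (1%g : 'S_0)) => [|pi]; last first.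
    have -> : pi = 1%g by apply/permP => -[].
    by rewrite /= eqxx; apply/forallP => -[].
  rewrite /koszul big_ord0 scale1r.
  by rewrite (size0nil (size_permute _ _)).
rewrite (big_lift_shuffle (fun m pi => koszul K pi (degs (p :: s)) *:
  F (take m (permute pi (p :: s))) (drop m (permute pi (p :: s))))).
under eq_bigr do rewrite big_split /=.
rewrite big_split /= -!IH //; congr (_ + _); apply: eq_bigr => m _; apply: eq_bigr => pi _.
  rewrite koszul_lift permute_lift /= take0 drop0 tdeg_nil mulr0 sgn0 mul1r.
  by [].
have mn : (m <= n)%N by rewrite -ltnS.
rewrite koszul_lift permute_lift !inordK ?ltnS // scalerA mulrC.
have st : size (take m (permute pi s)) = m by rewrite size_takel // size_permute.
by rewrite take_size_cat // drop_size_cat.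
Qed.

End PermutationSums.

Section AdjacentSwap.

Variables (K : fieldType) (T : nmodType).
Local Notation P := (int * T)%type.
Local Notation sg := (sgn K).

Lemma permute1 n (S : nmodType) (s : seq S) : size s = n ->
  permute (1%g : 'S_n) s = s.
Proof.
move=> sn; apply: (@eq_from_nth _ 0) => [|i]; rewrite size_permute // => ni.
by rewrite (nth_permute _ _ (Ordinal ni)) perm1.
Qed.

Lemma koszul1 n (d : seq int) : koszul K (1%g : 'S_n) d = 1.
Proof.
rewrite /koszul big1 // => i _; rewrite big_pred0 // => j.
by rewrite !perm1; case: ltngtP.
Qed.

(** Later arguments use graded symmetry through exchanges of neighbours; this realizes such an
    exchange as a permutation with its Koszul sign. *)
Lemma adjacent_perm n (u v : seq P) (p q : P) :
  size (u ++ [:: p, q & v]) = n ->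
  exists pi : 'S_n, permute pi (u ++ [:: p, q & v]) = u ++ [:: q, p & v] /\
    koszul K pi (degs (u ++ [:: p, q & v])) = sg (p.1 * q.1).
Proof.
elim: u n => [|r u IH] [|n] //; rewrite ?cat_cons [size _]/= => -[sn].
  case: n sn => // n [sn].
  exists (lift_perm (lift ord0 ord0) ord0 1%g).
  rewrite permute_lift koszul_lift koszul1 mulr1 permute1 /= ?sn //.
  by rewrite take0 drop0 tdeg_cons tdeg_nil addr0.
have [pi [Epi Kpi]] := IH n sn; exists (lift_perm ord0 ord0 pi).
rewrite permute_lift koszul_lift take0 drop0 Epi Kpi.
by rewrite tdeg_nil mulr0 sgn0 mul1r.
Qed.

End AdjacentSwap.

(** * The composition product *)

Section PreLie.

Variables (K : fieldType) (A : grAlg K).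
Local Notation P := (int * A)%type.
Local Notation sg := (sgn K).
Implicit Types (s u v w : seq P) (p q : P) (F G H : seq P -> A).

Lemma homog_cons p s : homog (p :: s) <-> hdeg p.1 p.2 /\ homog s.
Proof.
split=> [h|[hp hs] q]; last by rewrite inE => /orP[/eqP->|/hs].
by split=> [|q qs]; apply: h; rewrite inE ?eqxx ?qs ?orbT.
Qed.

Lemma homog_cat s1 s2 : homog (s1 ++ s2) <-> homog s1 /\ homog s2.
Proof.
elim: s1 => [|p s1 IH] /=; first by split=> [|[]].
by rewrite !homog_cons IH; split=> [[? []]|[[]]].
Qed.

Lemma perm_homog s1 s2 : perm_eq s1 s2 -> homog s2 -> homog s1.
Proof. by move=> /perm_mem E h p; rewrite E => /h. Qed.

Lemma perm_homog2 u v s : perm_eq (u ++ v) s -> homog s -> homog u /\ homog v.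
Proof. by move=> /perm_homog E /E /homog_cat. Qed.

Lemma sum_degs s : \sum_(d <- degs s) d = tdeg s.
Proof. by rewrite big_map. Qed.

Lemma barwedge_ush (F G : seq A -> A) s :
  barwedge F G s = ush s (fun u v => F (G (elts u) :: elts v)).
Proof.
by rewrite -(@shuffle_ushE _ _ _ _ s (fun u v => F (G (elts u) :: elts v)) erefl).
Qed.

Definition swap_sym F := forall u p q v, homog (u ++ [:: p, q & v]) ->
  F (u ++ [:: p, q & v]) = sg (p.1 * q.1) *: F (u ++ [:: q, p & v]).

Lemma graded_symmetric_swap (F : seq A -> A) :
  graded_symmetric F -> swap_sym (fun s => F (elts s)).
Proof.
move=> Fs u p q v h.
have [pi [Epi Kpi]] := @adjacent_perm K A _ u v p q erefl.
by rewrite (Fs _ h pi) Epi Kpi.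
Qed.

(** The composition product inserts values into the first slot only, so linearity there lets sums
    pass through it. *)
Definition head_linear F := forall d v, linear (fun x => F ((d, x) :: v)).

(* The composition product Phi <| G of the Nijenhuis-Richardson bracket, for G
   of degree g, on functions of lists of elements with a chosen degree. *)
Definition grcomp (g : int) G F s : A :=
  ush s (fun u v => F ((g + tdeg u, G u) :: v)).

(* [grcomp h H (grcomp g G F) - grcomp (g + h) (grcomp h H G) F], the part of the
   double composition in which G and H fill two different slots of F *)
Definition grcomp2 g G h H F s : A :=
  ush s (fun u w => ush w (fun v z => sg ((h + tdeg u) * tdeg v) *:
    F [:: (g + tdeg v, G v), (h + tdeg u, H u) & z])).

(** The letter produced by H either enters the block of G or stays an argument of F; these are the
    two terms. *)
Lemma grcompA g G h H F s : head_linear F ->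
  grcomp h H (grcomp g G F) s = grcomp (g + h) (grcomp h H G) F s + grcomp2 g G h H F s.
Proof.
move=> lF; rewrite /grcomp /grcomp2.
under eq_ush do rewrite ush_cons /=.
rewrite ushD; congr (_ + _).
rewrite -(@ushA _ _ _ s (fun u v z => F ((g + tdeg ((h + tdeg u, H u) :: v), G ((h + tdeg u, H u) :: v)) :: z))).
apply: eq_ush => t z _; rewrite (ush_map _ _ (lF _ _)).
apply: eq_ush => u v uv; congr F; congr ((_, _) :: _).
by rewrite -(perm_tdeg uv) tdeg_cat tdeg_cons /= !addrA.
Qed.

Definition graded g G := forall s, homog s -> hdeg (g + tdeg s) (G s).

(** G and H occupy the first two slots of F, which may be exchanged. *)
Lemma grcomp2C g G h H F s : homog s -> swap_sym F -> graded g G -> graded h H ->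
  grcomp2 g G h H F s = sg (g * h) *: grcomp2 h H g G F s.
Proof.
move=> hs sF gG gH; rewrite /grcomp2.
rewrite -(@ushA _ _ _ s (fun u v z => _ *: F [:: (g + tdeg v, G v), (h + tdeg u, H u) & z])).
rewrite -(@ushA _ _ _ s (fun u v z => _ *: F [:: (h + tdeg v, H v), (g + tdeg u, G u) & z])).
rewrite -ushZ; apply: eq_ush => t z tz; rewrite ushC -ushZ.
apply: eq_ush => u v uv; rewrite (sF [::]) /=; last first.
  have [ht hz] := perm_homog2 tz hs; have [hu hv] := perm_homog2 uv ht.
  by apply/homog_cons; split; [exact: gG | apply/homog_cons; split=> //; exact: gH].
rewrite !scalerA !sgnMM; congr (_ *: _).
apply: (@sgn_par _ _ _ (tdeg u * tdeg v + h * tdeg u)); ring.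
Qed.

(** The graded pre-Lie identity: the derivative along a bracket is the commutator of the
    derivatives, since the symmetric parts [grcomp2] cancel. *)
Lemma grcomp_bracket g G h H F s : homog s -> head_linear F -> swap_sym F ->
  graded g G -> graded h H ->
  grcomp (g + h) (fun v => grcomp h H G v - sg (g * h) *: grcomp g G H v) F s =
  grcomp h H (grcomp g G F) s - sg (g * h) *: grcomp g G (grcomp h H F) s.
Proof.
move=> hs lF sF gG gH; rewrite !grcompA // (grcomp2C hs sF gG gH).
rewrite [h + g]addrC scalerDr opprD addrACA subrr addr0.
rewrite -scaleNr -ushZ -ushD; apply: eq_ush => u v _.
rewrite [RHS]addrC -scaleNr -(lF _ _ _ (grcomp g G H u) (grcomp h H G u)).
by rewrite [X in F ((_, X) :: _)]addrC.
Qed.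

End PreLie.

(** * Truncated free algebras *)

Section GradingLemmas.

Variables (K : fieldType) (V : lmodType K) (gr : int -> V -> Prop).
Hypotheses (gr0 : forall i, gr i 0)
  (gr_lin : forall i (c : K) u v, gr i u -> gr i v -> gr i (c *: u + v)).

Lemma gr_add i u v : gr i u -> gr i v -> gr i (u + v).
Proof. by rewrite -[u in gr i (u + v)]scale1r; apply: gr_lin. Qed.

Lemma gr_scale i c u : gr i u -> gr i (c *: u).
Proof. by move=> hu; rewrite -[_ *: _]addr0; apply: gr_lin. Qed.

Definition decomposable (v : V) := exists (s : seq int) (w : int -> V),
  (forall i, gr i (w i)) /\ v = \sum_(i <- s) w i.

Lemma decomposable_uniq v : decomposable v -> exists (s : seq int) (w : int -> V),
  [/\ uniq s, forall i, gr i (w i) & v = \sum_(i <- s) w i].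
Proof.
(* A degree listed several times contributes the same w i each time, so repetitions become
   multiplicities. *)
case=> s [w [hw ->]]; exists (undup s), (fun i => (count_mem i s)%:R *: w i).
split=> [|i|]; [exact: undup_uniq | exact: gr_scale |].
rewrite -(big_undup_iterop_count _ _ predT); apply: eq_bigr => i _.
by rewrite scaler_nat Monoid.iteropE /= -iter_addr_0.
Qed.

Lemma sum_mem_undup (s t : seq int) (w : int -> V) : uniq s -> {subset s <= t} ->
  uniq t -> \sum_(i <- t) (if i \in s then w i else 0) = \sum_(i <- s) w i.
Proof.
move=> us st ut; rewrite -big_mkcond -big_filter; apply: perm_big.
apply: uniq_perm; rewrite ?filter_uniq // => i; rewrite mem_filter.
by case si: (i \in s) => //=; rewrite st.
Qed.

Lemma decomposable_add u v :
  decomposable u -> decomposable v -> decomposable (u + v).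
Proof.
move=> /decomposable_uniq[s [w [us hw ->]]] /decomposable_uniq[s' [w' [us' hw' ->]]].
exists (undup (s ++ s')), (fun i => (if i \in s then w i else 0) +
  (if i \in s' then w' i else 0)); split=> [i|].
  by apply: gr_add; case: ifP.
rewrite big_split /= !sum_mem_undup ?undup_uniq // => i si;
  by rewrite mem_undup mem_cat si ?orbT.
Qed.

Lemma decomposable_homog i v : gr i v -> decomposable v.
Proof.
move=> hv; exists [:: i], (fun j => if j == i then v else 0).
by split=> [j|]; rewrite ?big_seq1 ?eqxx //; case: eqP => [->|].
Qed.

End GradingLemmas.

Section GrAlgTheory.

Variables (K : fieldType) (A : grAlg K).

Lemma hdeg_grading : grading (@hdeg K A).
Proof. by case: (gdeg_grading A) => ? ? ? ?; split. Qed.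
Lemma hdeg0 i : hdeg i (0 : A). Proof. exact: (grading0 hdeg_grading). Qed.
Lemma hdegD i (a b : A) : hdeg i a -> hdeg i b -> hdeg i (a + b).
Proof. exact: (gr_add (grading_lin hdeg_grading)). Qed.
Lemma hdegZ i c (a : A) : hdeg i a -> hdeg i (c *: a).
Proof. exact: (gr_scale hdeg0 (grading_lin hdeg_grading)). Qed.
Lemma hdegM i j (a b : A) : hdeg i a -> hdeg j b -> hdeg (i + j) (a * b).
Proof. exact: gdeg_mul. Qed.
Lemma hdeg1 : hdeg 0 (1 : A). Proof. exact: gdeg_one. Qed.

Lemma grscalerAl c (a b : A) : c *: a * b = c *: (a * b).
Proof. exact: gmulZl. Qed.
Lemma grscalerAr c (a b : A) : a * (c *: b) = c *: (a * b).
Proof. exact: gmulZr. Qed.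

End GrAlgTheory.

(** * Truncated skew word algebras over a graded algebra *)

Section SkewWords.

Variables (K : fieldType) (A : grAlg K) (sig : A -> A).
Variables (X : finType) (delta : X -> int) (N : nat).

(* Elements of A (x) k<X> / (words longer than N), where a letter x moves past
   the coefficients by x a = sig a x. *)
Definition swords : Type := {ffun N.-bseq X -> A}.
HB.instance Definition _ := GRing.Lmodule.on swords.
Implicit Types (p q r : swords) (w u v : seq X).

Definition at_ p w : A := if insub w is Some b then p b else 0.
Definition mkw (f : seq X -> A) : swords := [ffun b : N.-bseq X => f (val b)].

Lemma at_mkw f w : at_ (mkw f) w = if (size w <= N)%N then f w else 0.
Proof. by rewrite /at_; case: insubP => [b -> Eb|/negbTE-> //]; rewrite ffunE Eb. Qed.

Lemma at_val p (b : N.-bseq X) : at_ p (val b) = p b.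
Proof. by rewrite /at_ valK. Qed.

Lemma at_long p w : (N < size w)%N -> at_ p w = 0.
Proof. by move=> Nw; rewrite /at_ insubN // -ltnNge. Qed.

Lemma at_ext p q : (forall w, (size w <= N)%N -> at_ p w = at_ q w) -> p = q.
Proof.
by move=> pq; apply/ffunP => b; rewrite -!at_val pq // size_bseq.
Qed.

Lemma at_lin c p q w : at_ (c *: p + q) w = c *: at_ p w + at_ q w.
Proof. by rewrite /at_; case: insub => [b|]; rewrite ?ffunE // scaler0 addr0. Qed.

Lemma at_D p q w : at_ (p + q) w = at_ p w + at_ q w.
Proof. by rewrite -[p]scale1r at_lin !scale1r. Qed.

Lemma at_0 w : at_ 0 w = 0.
Proof. by rewrite /at_; case: insub => [b|]; rewrite ?ffunE. Qed.

Lemma at_Z c p w : at_ (c *: p) w = c *: at_ p w.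
Proof. by rewrite -[c *: p]addr0 at_lin at_0 addr0. Qed.

Definition wmul p q : swords :=
  mkw (fun w => sum_split w (fun x y => at_ p x * iter (size x) sig (at_ q y))).
Definition wone : swords := mkw (fun w => if w is [::] then 1 else 0).
Definition wdeg (i : int) p : Prop :=
  forall w, hdeg (i - \sum_(x <- w) delta x) (at_ p w).

Hypothesis sig_lin : linear sig.
Hypothesis sig1 : sig 1 = 1.
Hypothesis sigM : {morph sig : a b / a * b}.
Hypothesis sig_deg : forall i a, hdeg i a -> hdeg i (sig a).


Lemma isig0 n : iter n sig 0 = 0. Proof. by elim: n => //= n ->; exact: (linear_fun0 sig_lin). Qed.
Lemma isig1 n : iter n sig 1 = 1. Proof. by elim: n => //= n ->; exact: sig1. Qed.
Lemma isigD n : {morph iter n sig : a b / a + b}.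
Proof. by move=> a b; elim: n => //= n ->; exact: (linear_funD sig_lin). Qed.
Lemma isigM n : {morph iter n sig : a b / a * b}.
Proof. by move=> a b; elim: n => //= n ->; exact: sigM. Qed.
Lemma isigZ n c a : iter n sig (c *: a) = c *: iter n sig a.
Proof. by elim: n => //= n ->; exact: (linear_funZ sig_lin). Qed.
Lemma isig_deg n i a : hdeg i a -> hdeg i (iter n sig a).
Proof. by elim: n => //= n IH /IH; exact: sig_deg. Qed.

Lemma at_mul p q w : (size w <= N)%N ->
  at_ (wmul p q) w = sum_split w (fun x y => at_ p x * iter (size x) sig (at_ q y)).
Proof. by rewrite at_mkw => ->. Qed.

Lemma at_one w : (size w <= N)%N -> at_ wone w = if w is [::] then 1 else 0.
Proof. by rewrite at_mkw => ->. Qed.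

Lemma wmulA : associative wmul.
Proof.
move=> p q r; apply: at_ext => w wN; rewrite !at_mul //.
transitivity (sum_split w (fun x z => sum_split z (fun y t =>
   at_ p x * iter (size x) sig (at_ q y) * iter (size (x ++ y)) sig (at_ r t)))).
  apply: eq_sum_split => x z xz; rewrite at_mul; last first.
    by rewrite (leq_trans _ wN) // -xz size_cat leq_addl.
  rewrite (@sum_split_map _ _ _ (fun a => at_ p x * iter (size x) sig a)); first last.
  - by move=> a b; rewrite isigD mulrDr.
  - by rewrite isig0 mulr0.
  by apply: eq_sum_split => y t _; rewrite isigM mulrA size_cat iterD.
rewrite -(sum_splitA _ (fun x y t => at_ p x * iter (size x) sig (at_ q y) * iter (size (x ++ y)) sig (at_ r t))).
apply: eq_sum_split => x z xz; rewrite at_mul; last first.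
  by rewrite (leq_trans _ wN) // -xz size_cat leq_addr.
rewrite (@sum_split_map _ _ _ (fun a => a * _)) ?mul0r // => [|a b]; last by rewrite mulrDl.
by apply: eq_sum_split => y t <-.
Qed.

Lemma wmul1x : left_id wone wmul.
Proof.
move=> p; apply: at_ext => w wN; rewrite at_mul // -[RHS]sum_split0l.
apply: eq_sum_split => x y xy; rewrite at_one; last first.
  by rewrite (leq_trans _ wN) // -xy size_cat leq_addr.
by case: x {xy} => [|i x]; rewrite ?mul1r ?mul0r.
Qed.

Lemma wmulx1 : right_id wone wmul.
Proof.
move=> p; apply: at_ext => w wN; rewrite at_mul // -[RHS]sum_split0r.
apply: eq_sum_split => x y xy; rewrite at_one; last first.
  by rewrite (leq_trans _ wN) // -xy size_cat leq_addl.
by case: y {xy} => [|i y]; rewrite ?isig1 ?isig0 ?mulr1 ?mulr0.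
Qed.

Lemma wmulDl : left_distributive wmul +%R.
Proof.
move=> p q r; apply: at_ext => w wN; rewrite at_D !at_mul // -sum_splitD.
by apply: eq_sum_split => x y _; rewrite at_D mulrDl.
Qed.

Lemma wmulDr : right_distributive wmul +%R.
Proof.
move=> p q r; apply: at_ext => w wN; rewrite at_D !at_mul // -sum_splitD.
by apply: eq_sum_split => x y _; rewrite at_D isigD mulrDr.
Qed.

Lemma wmulZl c p q : wmul (c *: p) q = c *: wmul p q.
Proof.
apply: at_ext => w wN; rewrite at_Z !at_mul //.
rewrite (@sum_split_map _ _ _ (fun a => c *: a)) ?scaler0 // => [|a b]; last exact: scalerDr.
by apply: eq_sum_split => x y _; rewrite at_Z grscalerAl.
Qed.

Lemma wmulZr c p q : wmul p (c *: q) = c *: wmul p q.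
Proof.
apply: at_ext => w wN; rewrite at_Z !at_mul //.
rewrite (@sum_split_map _ _ _ (fun a => c *: a)) ?scaler0 // => [|a b]; last exact: scalerDr.
by apply: eq_sum_split => x y _; rewrite at_Z isigZ grscalerAr.
Qed.

Definition mono w a : swords := mkw (fun u => if u == w then a else 0).

Lemma at_mono w a u : at_ (mono w a) u = if (u == w) && (size w <= N)%N then a else 0.
Proof. by rewrite at_mkw; case: eqP => [->|_]; case: ifP. Qed.

Lemma swords_sum p : p = \sum_(b : N.-bseq X) mono (val b) (p b).
Proof.
apply: at_ext => w wN; rewrite (big_morph (at_^~ w) (fun a b => at_D a b w) (at_0 w)).
have -> : w = val (Bseq wN) by []; rewrite (bigD1 (Bseq wN)) //= big1 => [|b bw].
  by rewrite addr0 at_mono eqxx wN /= -at_val.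
rewrite at_mono; case: eqP => // Ew; case/eqP: bw; exact: val_inj.
Qed.

Lemma wdeg_grading : grading wdeg.
Proof.
have w0 i : wdeg i 0 by move=> w; rewrite at_0; exact: hdeg0.
have wl i (c : K) (u v : swords) : wdeg i u -> wdeg i v -> wdeg i (c *: u + v).
  by move=> hu hv w; rewrite at_lin; apply: hdegD => //; apply: hdegZ.
split=> //.
- move=> p; rewrite [p]swords_sum; apply: (big_ind (decomposable wdeg)).
  + exact: (decomposable_homog w0 (w0 0)).
  + exact: decomposable_add.
  move=> b _; have [s [w [hw ->]]] := grading_sum (hdeg_grading A) (p b).
  pose d := \sum_(x <- val b) delta x.
  exists [seq i + d | i <- s], (fun i => mono (val b) (w (i - d))); split.
    move=> i u; rewrite at_mono; case: ifP => [/andP[/eqP-> _]|_]; [exact: hw | exact: hdeg0].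
  rewrite big_map; apply: at_ext => u uN.
  rewrite (big_morph (at_^~ u) (fun a b => at_D a b u) (at_0 u)) at_mono.
  case: ifP => ub; last by rewrite big1 // => i _; rewrite at_mono ub.
  by apply: eq_bigr => i _; rewrite at_mono ub addrK.
- move=> s w us hw sw0 i si; apply: at_ext => u uN; rewrite at_0.
  pose d := \sum_(x <- u) delta x.
  have := @grading_direct _ _ _ (hdeg_grading A) [seq i - d | i <- s]
    (fun i => at_ (w (i + d)) u) _ _ _ (i - d) (map_f _ si).
  rewrite subrK; apply.
  + by rewrite map_inj_uniq //; apply: addIr.
  + by move=> j; have := hw (j + d) u; rewrite addrK.
  have E : \sum_(j <- s) at_ (w j) u = 0.
    by rewrite -(big_morph (at_^~ u) (fun a b => at_D a b u) (at_0 u)) sw0 at_0.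
  by rewrite big_map -[RHS]E; apply: eq_bigr => j _; rewrite subrK.
Qed.

Lemma wdeg_one : wdeg 0 wone.
Proof.
move=> w; rewrite at_mkw; case: ifP => _; last exact: hdeg0.
case: w => [|x w]; last exact: hdeg0.
by rewrite big_nil subr0; apply: hdeg1.
Qed.

Lemma wdeg_mul i j p q : wdeg i p -> wdeg j q -> wdeg (i + j) (wmul p q).
Proof.
move=> hp hq w; rewrite at_mkw; case: ifP => _; last exact: hdeg0.
apply: sum_split_closed => [|a b|x y <-]; [exact: hdeg0 | exact: hdegD |].
rewrite big_cat opprD addrACA; apply: hdegM; first exact: hp.
exact/isig_deg/hq.
Qed.

Definition skewAlg : grAlg K :=
  @GrAlg K swords wone wmul wdeg wmulA wmul1x wmulx1 wmulDl wmulDr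
    wmulZl wmulZr wdeg_grading wdeg_one wdeg_mul.

End SkewWords.

Section SkewAlgTheory.

Variables (K : fieldType) (A : grAlg K) (sig : A -> A).
Variables (X : finType) (delta : X -> int) (N : nat).
Hypothesis sig_lin : linear sig.
Hypothesis sig1 : sig 1 = 1.
Hypothesis sigM : {morph sig : a b / a * b}.
Hypothesis sig_deg : forall i a, hdeg i a -> hdeg i (sig a).

Let W := @skewAlg K A sig X delta N sig_lin sig1 sigM sig_deg.
Implicit Types (p q r : W) (w u v : seq X).

Definition wat p w : A := at_ (p : swords A X N) w.
Definition wmono w a : W := @mono K A X N w a.

Lemma wat_ext p q : (forall w, (size w <= N)%N -> wat p w = wat q w) -> p = q.
Proof. exact: at_ext. Qed.
Lemma wat_long p w : (N < size w)%N -> wat p w = 0.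
Proof. exact: at_long. Qed.
Lemma watD p q w : wat (p + q) w = wat p w + wat q w.
Proof. exact: at_D. Qed.
Lemma wat0 w : wat 0 w = 0.
Proof. exact: at_0. Qed.
Lemma watZ c p w : wat (c *: p) w = c *: wat p w.
Proof. exact: at_Z. Qed.
Lemma wat_sum (I : Type) (s : seq I) (P : pred I) (F : I -> W) w :
  wat (\sum_(i <- s | P i) F i) w = \sum_(i <- s | P i) wat (F i) w.
Proof. by rewrite (big_morph (wat^~ w) (fun a b => watD a b w) (wat0 w)). Qed.
Lemma watM p q w : (size w <= N)%N ->
  wat (p * q) w = sum_split w (fun x y => wat p x * iter (size x) sig (wat q y)).
Proof. exact: at_mul. Qed.
Lemma wat1 w : (size w <= N)%N -> wat 1 w = if w is [::] then 1 else 0.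
Proof. exact: at_one. Qed.
Lemma wat_mono w a u :
  wat (wmono w a) u = if (u == w) && (size w <= N)%N then a else 0.
Proof. exact: at_mono. Qed.
Lemma hdeg_wat i p w : hdeg i p -> hdeg (i - \sum_(x <- w) delta x) (wat p w).
Proof. by apply. Qed.
Lemma hdeg_skew i p :
  (forall w, hdeg (i - \sum_(x <- w) delta x) (wat p w)) -> hdeg i p.
Proof. by []. Qed.

Lemma hdeg_mono w i a : hdeg i a -> hdeg (i + \sum_(x <- w) delta x) (wmono w a).
Proof.
move=> ha; apply: hdeg_skew => u; rewrite wat_mono.
by case: ifP => [/andP[/eqP-> _]|_]; [rewrite addrK | apply: hdeg0].
Qed.

Lemma sum_split_pair (V : nmodType) (w u v : seq X) (c : V) :
  sum_split w (fun x y => if (x == u) && (y == v) then c else 0) =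
  if w == u ++ v then c else 0.
Proof.
elim: w u => [|x w IH] [|y u] /=; rewrite ?addr0 ?add0r //.
  by rewrite sum_split0 addr0.
rewrite eqseq_cons; case: (x =P y) => [->|xy].
  by rewrite -IH; apply: eq_sum_split => a b _; rewrite eqseq_cons eqxx.
rewrite (eq_sum_split (G := fun _ _ => 0)) ?sum_split0 // => a b _.
by rewrite eqseq_cons; case: eqP.
Qed.

Lemma wmonoM u v a b :
  wmono u a * wmono v b = wmono (u ++ v) (a * iter (size u) sig b).
Proof.
apply: wat_ext => w wN; rewrite watM // wat_mono.
transitivity (if w == u ++ v then a * iter (size u) sig b else 0); last first.
  by case: eqP => // Ew; rewrite -Ew wN.
rewrite -sum_split_pair; apply: eq_sum_split => x y xy; rewrite !wat_mono.
have xN : (size x <= N)%N by rewrite (leq_trans _ wN) // -xy size_cat leq_addr.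
have yN : (size y <= N)%N by rewrite (leq_trans _ wN) // -xy size_cat leq_addl.
case: eqP => [<-|_]; rewrite ?mul0r //= xN.
case: eqP => [<-|_]; rewrite ?yN //=.
by rewrite (isig0 sig_lin) mulr0.
Qed.

Definition embed a : W := wmono [::] a.
Definition letter x : W := wmono [:: x] 1.

Lemma wat_embed a w : wat (embed a) w = if w == [::] then a else 0.
Proof. by rewrite wat_mono andbT. Qed.

Lemma embed_morphism : grAlg_morphism embed.
Proof.
split.
- move=> c a b; apply: wat_ext => w _; rewrite watD watZ !wat_embed.
  by case: ifP => // _; rewrite scaler0 addr0.
- by apply: wat_ext => w wN; rewrite wat1 // wat_embed; case: w {wN}.
- by move=> a b; rewrite /embed wmonoM.
- by move=> i a /(hdeg_mono [::]); rewrite big_nil addr0.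
Qed.

Lemma wat_embedM a q w : wat (embed a * q) w = a * wat q w.
Proof.
case: (leqP (size w) N) => wN; last by rewrite !wat_long // mulr0.
rewrite watM // -[RHS](@sum_split0l _ _ _ (fun v => a * wat q v)).
apply: eq_sum_split => x y _; rewrite wat_embed.
by case: x => [|i x]; rewrite ?mul0r.
Qed.

Lemma wat_letterM x q w : (size w <= N)%N -> wat (letter x * q) w =
  if w is y :: w' then if y == x then sig (wat q w') else 0 else 0.
Proof.
move=> wN; rewrite watM //; case: w wN => [|y w] wN /=.
  by rewrite wat_mono mul0r addr0.
rewrite wat_mono mul0r add0r -[RHS](@sum_split0l _ _ _ (fun v => if y == x then sig (wat q v) else 0)).
apply: eq_sum_split => u v _; rewrite wat_mono eqseq_cons (leq_trans _ wN) // andbT.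
by case: u => [|z u]; rewrite ?andbF ?andbT ?mul0r //; case: eqP; rewrite ?mul1r ?mul0r.
Qed.

End SkewAlgTheory.

(** * Truncated free algebras over the field and their evaluations *)

Section FreeWords.

Variables (K : fieldType) (X : finType) (delta : X -> int) (N : nat).

Let G := groundAlg K.
Let id_lin : linear (@id G). Proof. by []. Qed.
Let id_mul : {morph (@id G) : a b / a * b}. Proof. by []. Qed.
Let id_deg i (a : G) : hdeg i a -> hdeg i (id a). Proof. by []. Qed.

(* Words are truncated at length N so that they form a finite type; in arity n
   only the words of length n contribute. *)
Definition freeAlg : grAlg K :=
  @skewAlg K G id X delta N id_lin erefl id_mul id_deg.
Implicit Types (p q : freeAlg) (u v w : seq X).

Definition wcoef p w : K := wat p w.
Definition word w : freeAlg := @wmono K G id X delta N id_lin erefl id_mul id_deg w 1.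

Lemma wcoef_ext p q : (forall w, (size w <= N)%N -> wcoef p w = wcoef q w) -> p = q.
Proof. exact: (@wat_ext K G id X delta N id_lin erefl id_mul id_deg). Qed.
Lemma wcoefD p q w : wcoef (p + q) w = wcoef p w + wcoef q w.
Proof. exact: (@watD K G id X delta N id_lin erefl id_mul id_deg). Qed.
Lemma wcoef0 w : wcoef 0 w = 0.
Proof. exact: (@wat0 K G id X delta N id_lin erefl id_mul id_deg). Qed.
Lemma wcoefZ c p w : wcoef (c *: p) w = c * wcoef p w.
Proof. exact: (@watZ K G id X delta N id_lin erefl id_mul id_deg). Qed.
Lemma wcoef_sum (I : Type) (s : seq I) (P : pred I) (F : I -> freeAlg) w :
  wcoef (\sum_(i <- s | P i) F i) w = \sum_(i <- s | P i) wcoef (F i) w.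
Proof. exact: (@wat_sum K G id X delta N id_lin erefl id_mul id_deg). Qed.

Lemma wcoef_word w u : wcoef (word w) u = ((u == w) && (size w <= N)%N)%:R.
Proof. by rewrite /wcoef wat_mono; case: ifP. Qed.

Lemma wordM u v : word u * word v = word (u ++ v).
Proof.
rewrite /word wmonoM; congr wmono.
by rewrite (_ : iter _ _ _ = 1) ?mulr1 //; elim: (size u) => //= n ->.
Qed.

Lemma word_nil : word [::] = 1.
Proof. exact: (grAlg_morphism1 (@embed_morphism K G id X delta N id_lin erefl id_mul id_deg)). Qed.

Lemma word_long w : (N < size w)%N -> word w = 0.
Proof.
move=> wN; apply: wcoef_ext => u _.
by rewrite wcoef0 wcoef_word leqNgt wN andbF.
Qed.

Lemma hdeg_word w : hdeg (\sum_(x <- w) delta x) (word w).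
Proof. by rewrite -[X in hdeg X]add0r; apply: hdeg_mono; left. Qed.

Lemma word_sum p : p = \sum_(u : N.-bseq X) wcoef p u *: word u.
Proof.
apply: wcoef_ext => w wN; rewrite wcoef_sum.
have -> : w = val (Bseq wN) by []; rewrite (bigD1 (Bseq wN)) //= big1 => [|b bw].
  by rewrite addr0 wcoefZ wcoef_word eqxx wN mulr1.
rewrite wcoefZ wcoef_word; case: eqP => [Ew|]; last by rewrite mulr0.
by case/eqP: bw; apply: val_inj.
Qed.

Lemma wcoefM p q w : (size w <= N)%N ->
  wcoef (p * q) w = sum_split w (fun x y => wcoef p x * wcoef q y).
Proof.
move=> wN; rewrite /wcoef watM //; apply: eq_sum_split => x y _; congr (_ * _).
by elim: (size x) => //= n ->.
Qed.

Lemma hdeg_wcoef i p :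
  hdeg i p <-> forall w, i = \sum_(x <- w) delta x \/ wcoef p w = 0.
Proof.
split=> hp w; first by case: (hp w) => [/subr0_eq|]; [left | right].
by case: (hp w) => [->|]; [left; rewrite subrr | right].
Qed.

(** Multiplies degree d by (-1)^(r d): the twist with which an adjoined letter of degree r becomes
    supercentral. *)
Definition sgn_aut (r : int) p : freeAlg :=
  @mkw K G X N (fun w => sgn K (r * \sum_(x <- w) delta x) * wcoef p w).

Lemma wcoef_aut r p w :
  wcoef (sgn_aut r p) w = sgn K (r * \sum_(x <- w) delta x) * wcoef p w.
Proof.
case: (leqP (size w) N) => wN; last by rewrite /wcoef !wat_long // mulr0.
by rewrite {1}/wcoef /wat at_mkw wN.
Qed.

Lemma sgn_aut_linear r : linear (sgn_aut r).
Proof.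
move=> c p q; apply: wcoef_ext => w _; rewrite wcoefD wcoefZ !wcoef_aut wcoefD wcoefZ.
by rewrite mulrDr mulrCA.
Qed.

Lemma sgn_aut_word r w :
  sgn_aut r (word w) = sgn K (r * \sum_(x <- w) delta x) *: word w.
Proof.
apply: wcoef_ext => u _; rewrite wcoef_aut wcoefZ wcoef_word.
by case: eqP => [->|]; rewrite ?mulr0.
Qed.

Lemma sgn_aut1 r : sgn_aut r 1 = 1.
Proof. by rewrite -word_nil sgn_aut_word big_nil mulr0 sgn0 scale1r. Qed.

Lemma sgn_autM r : {morph sgn_aut r : p q / p * q}.
Proof.
move=> p q; apply: wcoef_ext => w wN; rewrite wcoef_aut !wcoefM //.
rewrite (@sum_split_map _ _ _ (fun a => _ * a)) ?mulr0 // => [|a b]; last by rewrite mulrDr.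
apply: eq_sum_split => x y <-; rewrite !wcoef_aut big_cat mulrDr sgnD; ring.
Qed.

Lemma sgn_aut_sgn r i p : hdeg i p -> sgn_aut r p = sgn K (r * i) *: p.
Proof.
move=> /hdeg_wcoef hp; apply: wcoef_ext => w _; rewrite wcoef_aut wcoefZ.
by case: (hp w) => ->; rewrite ?mulr0.
Qed.

Lemma sgn_aut_deg r i p : hdeg i p -> hdeg i (sgn_aut r p).
Proof. by move=> hp; rewrite (sgn_aut_sgn _ hp); apply: hdegZ. Qed.

Section Evaluation.

Variables (B : grAlg K) (b : X -> B).
Hypothesis hb : forall x, hdeg (delta x) (b x).

Definition wprod w : B := \prod_(x <- w) b x.

Lemma wprod_cons x w : wprod (x :: w) = b x * wprod w.
Proof. exact: big_cons. Qed.

Lemma wprod_cat u v : wprod (u ++ v) = wprod u * wprod v.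
Proof. exact: big_cat. Qed.

Hypothesis wprod_long : forall w, (N < size w)%N -> wprod w = 0.

Definition eval p : B := \sum_(u : N.-bseq X) wcoef p u *: wprod u.

Lemma hdeg_wprod w : hdeg (\sum_(x <- w) delta x) (wprod w).
Proof.
rewrite /wprod; elim: w => [|x w IH]; first by rewrite !big_nil; apply: hdeg1.
by rewrite !big_cons; apply: hdegM.
Qed.

Lemma eval_linear : linear eval.
Proof.
move=> c p q; rewrite /eval scaler_sumr -big_split; apply: eq_bigr => u _ /=.
by rewrite wcoefD wcoefZ scalerDl scalerA.
Qed.

Let evalD := linear_funD eval_linear.
Let eval0 := linear_fun0 eval_linear.
Let evalZ := linear_funZ eval_linear.

Lemma eval_word w : eval (word w) = wprod w.
Proof.
case: (leqP (size w) N) => wN; last by rewrite word_long // eval0 wprod_long.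
rewrite /eval -[w]/(val (Bseq wN)) (bigD1 (Bseq wN)) //= big1 => [|u uw].
  by rewrite wcoef_word eqxx wN scale1r addr0.
rewrite wcoef_word; case: eqP => [Ew|_]; last by rewrite scale0r.
by case/eqP: uw; apply: val_inj.
Qed.

(** Multiplicativity survives the truncation because [wprod_long] kills the products of words that
    the truncated algebra drops. *)
Lemma eval_morphism : grAlg_morphism eval.
Proof.
split; first exact: eval_linear.
- by rewrite -word_nil eval_word /wprod big_nil.
- move=> p q; rewrite [in LHS](word_sum p) [in LHS](word_sum q) mulr_suml.
  rewrite (big_morph eval evalD eval0) {2}/eval mulr_suml; apply: eq_bigr => u _.
  rewrite mulr_sumr (big_morph eval evalD eval0) mulr_sumr; apply: eq_bigr => v _.
  rewrite !grscalerAl !grscalerAr wordM !evalZ eval_word !scalerA.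
  by rewrite /wprod big_cat.
- move=> i p hp; rewrite /eval; apply: (big_ind (hdeg i)) => [|x y|u _].
  + exact: hdeg0.
  + exact: hdegD.
  have := hdeg_wat u hp; rewrite -/(wcoef p u) => -[/subr0_eq->|->].
    exact/hdegZ/hdeg_wprod.
  by rewrite scale0r; apply: hdeg0.
Qed.

End Evaluation.

End FreeWords.

Definition supercentral (K : fieldType) (A : grAlg K) (i : int) (c : A) :=
  forall j (a : A), hdeg j a -> a * c = sgn K (j * i) *: (c * a).

Lemma mul_swap (K : fieldType) (B : grAlg K) (m : int) (x y z t : B) :
  z * t = sgn K m *: (t * z) -> x * (y * t * z) = sgn K m *: (x * (y * z) * t).
Proof. by move=> zt; rewrite -!mulrA zt !grscalerAr scalerA sgn_sqr scale1r. Qed.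

Section LetterRight.

Variables (K : fieldType) (A : grAlg K) (sig : A -> A).
Variables (X : finType) (delta : X -> int) (N : nat).
Hypothesis sig_lin : linear sig.
Hypothesis sig1 : sig 1 = 1.
Hypothesis sigM : {morph sig : a b / a * b}.
Hypothesis sig_deg : forall i a, hdeg i a -> hdeg i (sig a).

Let W := @skewAlg K A sig X delta N sig_lin sig1 sigM sig_deg.
Let ltr x : W := letter delta N sig_lin sig1 sigM sig_deg x.

Lemma wat_Mletter_nil (q : W) x : wat (q * ltr x) [::] = 0.
Proof. by rewrite watM //= wat_mono mulr0 addr0. Qed.

Lemma wat_Mletter (q : W) x y w : (size w < N)%N ->
  wat (q * ltr x) (rcons w y) = if y == x then wat q w else 0.
Proof.
move=> wN; rewrite watM ?size_rcons //.
transitivity (sum_split (rcons w y) (fun u v => if (u == w) && (v == [:: x]) then wat q w else 0)).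
  apply: eq_sum_split => u v uv; rewrite wat_mono /= (leq_ltn_trans _ wN) // andbT.
  case: eqP => [Ev|_]; last by rewrite (isig0 sig_lin) mulr0 andbF.
  move: uv; rewrite Ev cats1 => /rcons_inj[-> _].
  by rewrite eqxx (isig1 sig1) mulr1.
rewrite sum_split_pair cats1; congr (if _ then _ else _).
by apply/eqP/eqP => [/rcons_inj[]|->].
Qed.

End LetterRight.

Lemma unit_word (w : seq unit) : w = nseq (size w) tt.
Proof. by elim: w => //= -[] w <-. Qed.

Section TensorUnit.

Variables (K : fieldType) (A : grAlg K) (sig : A -> A) (r : int) (N : nat).
Hypothesis sig_lin : linear sig.
Hypothesis sig1 : sig 1 = 1.
Hypothesis sigM : {morph sig : a b / a * b}.
Hypothesis sig_deg : forall i a, hdeg i a -> hdeg i (sig a).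
Hypothesis sig_sgn : forall i a, hdeg i a -> sig a = sgn K (r * i) *: a.
Hypothesis rN : r = 0 \/ (N <= 1)%N.

Let W := @skewAlg K A sig unit (fun=> r) N sig_lin sig1 sigM sig_deg.
Let t : W := letter (fun=> r) N sig_lin sig1 sigM sig_deg tt.

Lemma hdeg_t : hdeg r t.
Proof.
have := @hdeg_mono K A sig unit (fun=> r) N sig_lin sig1 sigM sig_deg [:: tt] 0 1 (hdeg1 A).
by rewrite big_seq1 add0r.
Qed.

(** The twist handles coefficients, but t must also commute with itself up to (-1)^(r r). For odd r
    this forces t t = 0, hence the alternative in [rN]: degree 0, or truncation after the first
    power. *)
Lemma supercentral_t : supercentral r t.
Proof.
move=> j a ha; apply: wat_ext => w wN; rewrite watZ.
case: w wN => [|[] w] wN.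
  by rewrite wat_Mletter_nil wat_letterM // scaler0.
have -> : tt :: w = rcons w tt by rewrite (unit_word w); elim: (size w) => //= n ->.
rewrite wat_Mletter // -(_ : tt :: w = rcons w tt); last first.
  by rewrite (unit_word w); elim: (size w) => //= n ->.
rewrite wat_letterM //= (sig_sgn (hdeg_wat w ha)) scalerA sgnMM.
rewrite (_ : sgn K _ = 1) ?scale1r //.
case: rN => [->|N1]; first by rewrite mulr0 mul0r addr0 sgn0.
have -> : w = [::] by case: w wN {ha} => //= x w /leq_trans/(_ N1).
by rewrite big_nil subr0 [r * j]mulrC sgn_dbl.
Qed.

End TensorUnit.

(** * Natural operations on graded algebras *)

Section Universal.

Variables (K : fieldType) (Theta : forall A : grAlg K, seq A -> A).
Hypothesis Tlin : forall A, multilinear (@Theta A).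
Hypothesis Tsym : forall A, graded_symmetric (@Theta A).
Hypothesis Tnat : forall (A B : grAlg K) (alpha : A -> B),
  grAlg_morphism alpha -> forall s, alpha (Theta s) = Theta (map alpha s).
Hypothesis Tcentral : forall (A : grAlg K) i (c : A), hdeg i c ->
  supercentral i c -> forall s a, Theta (rcons s (a * c)) = Theta (rcons s a) * c.

Lemma Theta_0 (A : grAlg K) (u v : seq A) : Theta (u ++ 0 :: v) = 0.
Proof.
have := Tlin u v (-1) 0 0; rewrite scaler0 addr0 scaleN1r => ->.
by rewrite addNr.
Qed.

Lemma elts_cat (T : nmodType) (s1 s2 : seq (int * T)) : elts (s1 ++ s2) = elts s1 ++ elts s2.
Proof. exact: map_cat. Qed.

Lemma Theta_swap (A : grAlg K) (u : seq (int * A)) p q v :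
  homog (u ++ [:: p, q & v]) ->
  Theta (elts (u ++ [:: p, q & v])) =
  sgn K (p.1 * q.1) *: Theta (elts (u ++ [:: q, p & v])).
Proof. exact: graded_symmetric_swap. Qed.

(** The axiom concerns the last slot; exchanges of neighbours carry the argument there and back, and
    the remaining sign is that of c passing v. *)
Lemma Theta_central (A : grAlg K) r (c : A) (u v : seq (int * A)) p :
  hdeg r c -> supercentral r c -> homog (u ++ p :: v) ->
  Theta (elts (u ++ (p.1 + r, p.2 * c) :: v)) =
  sgn K (r * tdeg v) *: (Theta (elts (u ++ p :: v)) * c).
Proof.
move=> hc cc; elim: v u => [|q v IH] u h.
  by rewrite tdeg_nil mulr0 sgn0 scale1r !elts_cat /= !cats1 (Tcentral hc cc).
have /homog_cat[hu /homog_cons[hp /homog_cons[hq hv]]] := h.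
have hpc : hdeg (p.1 + r) (p.2 * c) by apply: hdegM.
rewrite (Theta_swap h) [LHS]Theta_swap; last first.
  by apply/homog_cat; split=> //; apply/homog_cons; split=> //; apply/homog_cons.
rewrite -(cat_rcons q u (_ :: v)) -(cat_rcons q u (p :: v)) IH; last first.
  rewrite cat_rcons; apply/homog_cat; split=> //.
  by apply/homog_cons; split=> //; apply/homog_cons.
rewrite grscalerAl !scalerA !sgnMM tdeg_cons; congr (sgn K _ *: _) => /=; ring.
Qed.

Lemma Theta_central_all (A : grAlg K) (c : A) (s : seq (int * A)) :
  hdeg 0 c -> supercentral 0 c -> homog s ->
  Theta [seq p.2 * c | p <- s] = Theta (elts s) * c ^+ size s.
Proof.
move=> hc cc hs; pose m (p : int * A) := (p.1 + 0, p.2 * c).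
suff E v u : homog (u ++ v) ->
    Theta (elts (u ++ map m v)) = Theta (elts (u ++ v)) * c ^+ size v.
  by have := E s [::] hs; rewrite /= /elts -map_comp.
elim: v u => [|p v IH] u h /=; first by rewrite mulr1.
have /homog_cat[hu /homog_cons[hp hv]] := h.
rewrite -cat_rcons IH ?cat_rcons; last first.
  apply/homog_cat; split=> //; apply/homog_cons; split=> //; exact: hdegM.
by rewrite Theta_central // mul0r sgn0 scale1r -mulrA exprS.
Qed.

Definition gens n (delta : 'I_n -> int) : seq (int * freeAlg K delta n) :=
  [seq (delta i, word K delta n [:: i]) | i <- enum 'I_n].

Lemma homog_gens n (delta : 'I_n -> int) : homog (gens delta).
Proof.
move=> p /mapP[i _ ->].
by have := hdeg_word K delta n [:: i]; rewrite big_seq1.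
Qed.

(** Universal coefficients: the value of the operation on free generators of degrees delta
    determines all its values. *)
Definition ucoef n (delta : 'I_n -> int) (w : seq 'I_n) : K :=
  wcoef (Theta (elts (gens delta))) w.

Lemma eval_gens n (delta : 'I_n -> int) (B : grAlg K) (b : 'I_n -> B) :
  (forall w, (n < size w)%N -> wprod b w = 0) ->
  map (eval b) (elts (gens delta)) = [seq b i | i <- enum 'I_n].
Proof.
move=> bl; rewrite /elts -!map_comp; apply: eq_map => i /=.
by rewrite eval_word // /wprod big_seq1.
Qed.

(** Products of more than n elements of A need not vanish, so generators are sent to a_i t in A[t]
    modulo t^(n+1). There the operation yields its value on s times t^n, and comparing coefficients
    of t^n keeps only the words of length n. *)
Lemma Theta_words (A : grAlg K) n (s : seq (int * A)) : size s = n -> homog s ->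
  Theta (elts s) = \sum_(u : n.-bseq 'I_n | size u == n)
    ucoef (fun i => (degs s)`_i) u *: \prod_(i <- u) (elts s)`_i.
Proof.
move=> sn hs; pose delta (i : 'I_n) := (degs s)`_i.
have lin_id : linear (@id A) by [].
have mul_id : {morph (@id A) : a b / a * b} by [].
have deg_id i (a : A) : hdeg i a -> hdeg i (id a) by [].
have sgn_id i (a : A) : hdeg i a -> id a = sgn K (0 * i) *: a.
  by rewrite mul0r sgn0 scale1r.
pose B := @skewAlg K A id unit (fun=> 0) n lin_id erefl mul_id deg_id.
pose t : B := letter (fun=> 0) n lin_id erefl mul_id deg_id tt.
pose io : A -> B := embed (fun=> 0) n lin_id erefl mul_id deg_id.
have ht : hdeg 0 t by exact: hdeg_t.
have ct : supercentral 0 t by apply: supercentral_t => //; left.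
have hio : grAlg_morphism io by apply: embed_morphism.
pose b (i : 'I_n) := io (elts s)`_i * t.
have watb w u : (size u <= n)%N -> wat (wprod b w : B) u =
    if size u == size w then \prod_(i <- w) (elts s)`_i else 0.
  rewrite /wprod; elim: w u => [|i w IH] u un.
    by rewrite !big_nil wat1 //; case: u un.
  rewrite !big_cons /b -mulrA wat_embedM wat_letterM //.
  case: u un => [|[] u] un /=; first by rewrite mulr0.
  by rewrite IH 1?ltnW // eqSS; case: ifP; rewrite ?mulr0.
have b_long w : (n < size w)%N -> wprod b w = 0.
  move=> wn; apply: wat_ext => u un; rewrite watb // wat0.
  by case: eqP => // E; move: wn; rewrite -E ltnNge un.
have hb i : hdeg (delta i) (b i).
  rewrite -[delta i]addr0; apply: hdegM => //; apply: (grAlg_morphism_deg hio).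
  rewrite /delta /degs /elts !(nth_map 0) ?sn // .
  by apply: hs; apply: mem_nth; rewrite sn.
have := congr1 (fun p : B => wat p (nseq n tt))
  (Tnat (eval_morphism hb b_long) (elts (gens delta))).
rewrite eval_gens // -(_ : [seq p.2 * t | p <- [seq (p.1, io p.2) | p <- s]] = map b (enum 'I_n)).
  rewrite Theta_central_all //; last first.
    by move=> p /mapP[q qs ->]; apply: (grAlg_morphism_deg hio); apply: hs.
  have -> : elts [seq (p.1, io p.2) | p <- s] = map io (elts s) by rewrite /elts -!map_comp.
  rewrite -(Tnat hio) wat_embedM size_map sn.
  have -> : wat (t ^+ n) (nseq n tt) = 1.
    have E k : (k <= n)%N -> wat (t ^+ k) (nseq k tt) = 1.
      elim: k => [|k IH] kn; first by rewrite wat1.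
      by rewrite exprS wat_letterM ?size_nseq //= IH // ltnW.
    exact: E.
  rewrite mulr1 => <-; rewrite /eval wat_sum [RHS]big_mkcond; apply: eq_bigr => u _.
  rewrite watZ watb ?size_nseq // [n == _]eq_sym.
  by case: ifP => // _; rewrite scaler0.
have es : elts s = [seq (elts s)`_(val i) | i <- enum 'I_n].
  rewrite -{1}(@permute1 n _ (elts s)) ?size_map //.
  by apply: eq_map => i; rewrite perm1.
transitivity [seq io x * t | x <- elts s]; first by rewrite /elts -!map_comp.
by rewrite es -map_comp.
Qed.

(** The substitution of 0 for the generator i kills the operation, by multilinearity, but fixes
    every word avoiding i. *)
Lemma ucoef_missing n (delta : 'I_n -> int) (u : seq 'I_n) i :
  i \notin u -> ucoef delta u = 0.
Proof.
case: (leqP (size u) n) => un iu; last by rewrite /ucoef /wcoef wat_long.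
pose W := word K delta n; pose b (j : 'I_n) := if j == i then 0 else W [:: j].
have Eb w : wprod b w = if i \in w then 0 else W w.
  rewrite /wprod; elim: w => [|j w IH]; first by rewrite big_nil [W _]word_nil.
  rewrite big_cons {}IH /b in_cons [i == j]eq_sym.
  case: eqP => _; first by rewrite mul0r.
  by case: ifP => _; rewrite ?mulr0 // [W _ * _]wordM.
have b_long w : (n < size w)%N -> wprod b w = 0.
  by move=> wn; rewrite Eb [W w]word_long //; case: ifP.
have hb j : hdeg (delta j) (b j).
  rewrite /b; case: ifP => _; first exact: hdeg0.
  by have := hdeg_word K delta n [:: j]; rewrite big_seq1.
have := congr1 (fun p => wcoef p u) (Tnat (eval_morphism hb b_long) (elts (gens delta))).
rewrite eval_gens // wcoef_sum /=.
have -> : [seq b j | j <- enum 'I_n] =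
    map b (take (index i (enum 'I_n)) (enum 'I_n)) ++ 0 ::
    map b (drop (index i (enum 'I_n)).+1 (enum 'I_n)).
  have <- : b i = 0 by rewrite /b eqxx.
  rewrite -map_cons -map_cat; congr map.
  have ie : i \in enum 'I_n by rewrite mem_enum.
  by rewrite -{2}(nth_index i ie) -drop_nth ?index_mem // cat_take_drop.
rewrite Theta_0 wcoef0 => <-; rewrite (bigD1 (Bseq un)) //= big1 => [|v vu].
  by rewrite wcoefZ Eb (negbTE iu) wcoef_word eqxx un mulr1 addr0.
rewrite wcoefZ Eb; case: ifP => _; first by rewrite wcoef0 mulr0.
rewrite wcoef_word; case: eqP => [Eu|]; last by rewrite mulr0.
by case/eqP: vu; apply: val_inj.
Qed.

Lemma Theta_koszul (A : grAlg K) n (s : seq (int * A)) : size s = n -> homog s ->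
  forall pi : 'S_n, Theta (elts s) = koszul K pi (degs s) *: Theta (elts (permute pi s)).
Proof. by move=> <- hs pi; apply: Tsym. Qed.

(** Combines graded symmetry with naturality under the renaming of generators by pi. *)
Lemma ucoef_perm n (delta : 'I_n -> int) (pi : 'S_n) :
  ucoef delta [seq pi i | i <- enum 'I_n] =
  koszul K pi (degs (gens delta)) * ucoef (fun i => delta (pi i)) (enum 'I_n).
Proof.
have sg : size (gens delta) = n by rewrite size_map size_enum_ord.
rewrite /ucoef (Theta_koszul sg (@homog_gens _ _) pi) wcoefZ; congr (_ * _).
pose b (i : 'I_n) := word K delta n [:: pi i].
have Eb w : wprod b w = word K delta n [seq pi i | i <- w].
  rewrite /wprod; elim: w => [|j w IH]; first by rewrite big_nil word_nil.
  by rewrite big_cons {}IH wordM.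
have b_long w : (n < size w)%N -> wprod b w = 0.
  by move=> wn; rewrite Eb word_long // size_map.
have hb j : hdeg (delta (pi j)) (b j).
  by have := hdeg_word K delta n [:: pi j]; rewrite big_seq1.
have := congr1 (fun p => wcoef p [seq pi i | i <- enum 'I_n])
  (Tnat (eval_morphism hb b_long) (elts (gens (fun i => delta (pi i))))).
rewrite eval_gens //.
have -> : [seq b i | i <- enum 'I_n] = elts (permute pi (gens delta)).
  rewrite /elts /permute -[RHS]map_comp.
  apply: eq_map => i /=.
  by rewrite (nth_map i) ?size_enum_ord // nth_ord_enum.
move=> <-; rewrite wcoef_sum.
have en : (size (enum 'I_n) <= n)%N by rewrite size_enum_ord.
rewrite (bigD1 (Bseq en)) //= big1 => [|v vu].
  by rewrite wcoefZ Eb wcoef_word eqxx size_map en mulr1 addr0.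
rewrite wcoefZ Eb wcoef_word; case: eqP => [/(inj_map perm_inj) Eu|]; last by rewrite mulr0.
by case/eqP: vu; apply: val_inj.
Qed.

(** Multiply generator i by a supercentral letter t of degree r with t t = 0. Moving t to the right
    end gives the same sign in the universal word and in the operation, so the two coefficients
    agree. *)
Lemma ucoef_shift n (delta : 'I_n -> int) i r :
  ucoef (fun j => delta j + (if j == i then r else 0)) (enum 'I_n) =
  ucoef delta (enum 'I_n).
Proof.
set delta' := fun j => _; pose W := word K delta n.
pose B := skewAlg (fun _ : unit => r) 1 (@sgn_aut_linear K _ delta n r)
  (sgn_aut1 K delta n r) (@sgn_autM K _ delta n r) (@sgn_aut_deg K _ delta n r).
pose t : B := letter (fun _ : unit => r) 1 (@sgn_aut_linear K _ delta n r)
  (sgn_aut1 K delta n r) (@sgn_autM K _ delta n r) (@sgn_aut_deg K _ delta n r) tt.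
pose io : freeAlg K delta n -> B := embed (fun _ : unit => r) 1 (@sgn_aut_linear K _ delta n r)
  (sgn_aut1 K delta n r) (@sgn_autM K _ delta n r) (@sgn_aut_deg K _ delta n r).
have ht : hdeg r t by exact: hdeg_t.
have ct : supercentral r t.
  by apply: supercentral_t => [j a ha|]; [exact: sgn_aut_sgn | right].
have hio : grAlg_morphism io by apply: embed_morphism.
have ioM a c : io (a * c) = io a * io c by exact: grAlg_morphismM.
pose b j := if j == i then io (W [:: j]) * t else io (W [:: j]).
(* Each word keeps its own support, so only [enum 'I_n] contributes to the coefficient compared
   below. *)
have supp w u : exists l, wat (wprod b w : B) u = l *: W w.
  case: (leqP (size u) 1) => u1; last first.
    by exists 0; rewrite wat_long // scale0r.
  rewrite /wprod; elim: w u u1 => [|j w IH] u u1.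
    rewrite big_nil wat1 //; case: u u1 => [|y u] _.
      by exists 1; rewrite scale1r [W _]word_nil.
    by exists 0; rewrite scale0r.
  rewrite big_cons /b; case: eqP => [->|_].
    rewrite -mulrA wat_embedM wat_letterM //.
    case: u u1 => [|[] u] u1 /=; first by exists 0; rewrite mulr0 scale0r.
    have [|l ->] := IH u; first by rewrite ltnW.
    rewrite (linear_funZ (@sgn_aut_linear K _ delta n r)) sgn_aut_word scalerA grscalerAr wordM.
    by eexists.
  rewrite wat_embedM; have [|l ->] := IH u; first by [].
  by exists l; rewrite grscalerAr [W _ * _]wordM.
have b_long w : (n < size w)%N -> wprod b w = 0.
  move=> wn; apply: wat_ext => u _; have [l ->] := supp w u.
  by rewrite [W w]word_long // wat0 scaler0.
have hW w : hdeg (\sum_(x <- w) delta x) (io (W w)).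
  exact/(grAlg_morphism_deg hio)/hdeg_word.
have hW1 j : hdeg (delta j) (io (W [:: j])) by have := hW [:: j]; rewrite big_seq1.
have hb j : hdeg (delta' j) (b j).
  by rewrite /delta' /b; case: eqP => _; rewrite ?addr0 //; apply: hdegM.
have wt (a : freeAlg K delta n) : wat (io a * t) [:: tt] = a.
  by rewrite wat_embedM wat_mono mulr1.
have wprod_io w : i \notin w -> wprod b w = io (W w).
  rewrite /wprod; elim: w => [|j w IH].
    by move=> _; rewrite big_nil [W _]word_nil (grAlg_morphism1 hio).
  rewrite in_cons negb_or big_cons => /andP[ij /IH->].
  by rewrite /b eq_sym (negbTE ij) -ioM [W _ * _]wordM.
set e := enum 'I_n; have ie : i \in e by rewrite mem_enum.
have [e1 [e2 Ee]] : exists e1 e2, e = e1 ++ i :: e2.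
  by case/splitPr: ie => e1 e2; exists e1, e2.
have /and3P[_ /norP[i1 _] i2] : [&& uniq e1, ~~ has (mem e1) (i :: e2) & (i \notin e2)].
  have := enum_uniq 'I_n; rewrite -/e Ee cat_uniq => /and3P[-> -> /=].
  by case/andP.
pose D := \sum_(x <- e2) delta x.
have We : wprod b e = sgn K (r * D) *: (io (W e) * t).
  rewrite Ee wprod_cat wprod_cons !wprod_io //.
  rewrite {1}/b eqxx; have -> : W (e1 ++ i :: e2) = W e1 * (W [:: i] * W e2).
    by rewrite [W _ * W e2]wordM [W _ * _]wordM.
  rewrite !ioM (mulrC r D); apply: mul_swap; exact: ct (hW e2).
have en : (size e <= n)%N by rewrite size_enum_ord.
have := congr1 (fun p : B => wcoef (wat p [:: tt]) e)
  (Tnat (eval_morphism hb b_long) (elts (gens delta'))).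
rewrite eval_gens // /eval wat_sum wcoef_sum.
rewrite (bigD1 (Bseq en)) //= big1 => [|v ve]; last first.
  have [l El] := supp v [:: tt]; rewrite watZ El !wcoefZ wcoef_word.
  case: eqP => [Ev|]; last by rewrite !mulr0.
  by case/eqP: ve; apply: val_inj.
rewrite addr0 watZ We watZ wt !wcoefZ wcoef_word eqxx en mulr1.
pose m j := (delta j, io (W [:: j])).
have -> : [seq b j | j <- e] =
    elts (map m e1 ++ ((m i).1 + r, (m i).2 * t) :: map m e2).
  rewrite Ee /elts !map_cat /= -!map_comp {2}/b eqxx.
  by congr (_ ++ _ :: _); apply/eq_in_map => j je /=; rewrite /b;
    case: eqP => // ji; [case/negP: i1 | case/negP: i2]; rewrite -ji.
rewrite Theta_central //; last first.
  rewrite -map_cons -map_cat => p /mapP[j _ ->]; exact: hW1.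
have -> : elts (map m e1 ++ m i :: map m e2) = map io (elts (gens delta)).
  by rewrite -map_cons -map_cat -Ee /elts -!map_comp.
rewrite -(Tnat hio) watZ wt wcoefZ /tdeg big_map -/D mulrC.
by move/(congr1 ( *%R (sgn K (r * D)))); rewrite !mulrA sgn_sqr !mul1r.
Qed.

Lemma ucoef_const n (delta : 'I_n -> int) :
  ucoef delta (enum 'I_n) = ucoef (fun _ : 'I_n => 0) (enum 'I_n).
Proof.
pose d k (j : 'I_n) := if (j < k)%N then 0 else delta j.
have E k : (k <= n)%N -> ucoef delta (enum 'I_n) = ucoef (d k) (enum 'I_n).
  elim: k => [|k IH] kn.
    by congr ucoef; apply: funext => j; rewrite /d ltn0.
  rewrite IH 1?ltnW // -(ucoef_shift _ (Ordinal kn) (- delta (Ordinal kn))).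
  congr ucoef; apply: funext => j; rewrite /d ltnS.
  rewrite -[j == _]/(val j == k); case: (ltngtP j k) => jk; rewrite ?addr0 //.
  have -> : j = Ordinal kn by apply: val_inj.
  by rewrite subrr.
by rewrite (E n) //; congr ucoef; apply: funext => j; rewrite /d ltn_ord.
Qed.

(** A word of length n containing each of the n letters is a permutation; all other words are killed
    by the hypothesis on G. *)
Lemma sum_perm_words n (V : lmodType K) (F : n.-bseq 'I_n -> V) (G : seq 'I_n -> V) :
  (forall u : n.-bseq 'I_n, F u = G u) ->
  (forall u i, i \notin u -> G u = 0) ->
  \sum_(u : n.-bseq 'I_n | size u == n) F u =
  \sum_(pi : 'S_n) G [seq pi i | i <- enum 'I_n].
Proof.
move=> FG G0.
have hP (pi : 'S_n) : (size [seq pi i | i <- enum 'I_n] <= n)%N.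
  by rewrite size_map size_enum_ord.
pose h pi := Bseq (hP pi).
have hinj : injective h.
  move=> p q /(congr1 val)/= /eq_in_map pq; apply/permP => i.
  by apply: pq; rewrite mem_enum.
transitivity (\sum_(u in h @: [set: 'S_n]) F u); last first.
  by rewrite big_imset /= => [|p q _ _ /hinj //]; apply: eq_big => [pi|pi _]; rewrite ?inE ?FG.
rewrite [LHS]big_mkcond [RHS]big_mkcond; apply: eq_bigr => u _.
case: imsetP => [[pi _ ->]|hu]; first by rewrite /= size_map size_enum_ord eqxx.
case: eqP => // un; rewrite FG.
case: (boolP [forall i, i \in bseqval u]) => [/forallP ua|]; last first.
  by rewrite negb_forall => /existsP[i /G0].
case: hu; have uu : uniq u.
  apply: (leq_size_uniq (enum_uniq 'I_n)) => [i _|]; first exact: ua.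
  by rewrite un size_enum_ord.
have /tuple_permP[pi Epi] : perm_eq u (ord_tuple n).
  apply: uniq_perm => //; first by rewrite val_ord_tuple enum_uniq.
  by move=> i; rewrite ua val_ord_tuple mem_enum.
exists pi => //; apply: val_inj; rewrite /= Epi; apply: eq_map => i.
by rewrite tnth_ord_tuple.
Qed.

Lemma Theta_symr (A : grAlg K) (s : seq (int * A)) : homog s ->
  Theta (elts s) = ucoef (fun _ : 'I_(size s) => 0) (enum 'I_(size s)) *:
    symr s (fun w => \prod_(p <- w) p.2).
Proof.
move=> hs; set n := size s; rewrite (Theta_words (erefl n) hs).
pose d (i : 'I_n) := (degs s)`_i.
rewrite (sum_perm_words (G := fun u => ucoef d u *: \prod_(i <- u) (elts s)`_i)) //; last first.
  by move=> u i iu; rewrite (ucoef_missing _ iu) scale0r.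
rewrite -(symr_permE _ (erefl n)) scaler_sumr; apply: eq_bigr => pi _.
rewrite ucoef_perm ucoef_const scalerA mulrC; congr (_ * _ *: _).
  congr koszul; rewrite -[RHS](@permute1 n) ?size_map //.
  by rewrite /degs -map_comp; apply: eq_map => i; rewrite /= perm1.
rewrite /permute !big_map; apply: eq_bigr => i _.
by rewrite (nth_map 0) // -/n ltn_ord.
Qed.

(** On (1, ..., 1) in degree 0 all n! rearrangements give 1, so this value recovers the universal
    coefficient once n! is invertible. *)
Lemma ucoef0E n :
  Theta (nseq n (1 : groundAlg K)) =
  (ucoef (fun _ : 'I_n => 0) (enum 'I_n) * n`!%:R : K).
Proof.
pose s := nseq n (0 : int, 1 : groundAlg K).
have hs : homog s by move=> p; rewrite mem_nseq => /andP[_ /eqP->]; apply: hdeg1.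
have sn : size s = n by rewrite size_nseq.
have -> : nseq n (1 : groundAlg K) = elts s by rewrite /elts map_nseq.
rewrite Theta_symr //= sn; congr (_ * _).
rewrite (eq_symr (g := fun=> 1)); last first.
  move=> w ws; rewrite big_seq big1 // => p; rewrite (perm_mem ws).
  by rewrite mem_nseq => /andP[_ /eqP->].
rewrite -(symr_permE _ sn) (eq_bigr (fun=> 1)) => [|pi _].
  by rewrite sumr_const card_Sn.
rewrite (_ : koszul K pi (degs s) = 1) ?scale1r //.
rewrite /koszul big1 // => i _; rewrite big1 // => j _.
by rewrite /degs map_nseq !nth_nseq !if_same mulr0 sgn0.
Qed.

End Universal.

(** * The exponential and its derivatives *)

Section UnshuffleMore.

Variables (K : fieldType) (A : grAlg K) (V : lmodType K).
Local Notation P := (int * A)%type.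
Local Notation sg := (sgn K).
Implicit Types (s u v w a b c : seq P) (p q r : P).

Lemma eq_ush_homog s (F G : seq P -> seq P -> V) : homog s ->
  (forall u v, homog u -> homog v -> perm_eq (u ++ v) s -> F u v = G u v) ->
  ush s F = ush s G.
Proof.
move=> hs FG; apply: eq_ush => u v uv.
by have [hu hv] := perm_homog2 uv hs; apply: FG.
Qed.

(** If p and q fall in the same block, the hypotheses on F apply; unshuffles separating them are
    exchanged in pairs. *)
Lemma ush_swap u p q v (F : seq P -> seq P -> V) : homog (u ++ [:: p, q & v]) ->
  (forall a b c, homog (a ++ [:: p, q & b]) -> homog c ->
     F (a ++ [:: p, q & b]) c = sg (p.1 * q.1) *: F (a ++ [:: q, p & b]) c) ->
  (forall a b c, homog (a ++ [:: p, q & b]) -> homog c ->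
     F c (a ++ [:: p, q & b]) = sg (p.1 * q.1) *: F c (a ++ [:: q, p & b])) ->
  ush (u ++ [:: p, q & v]) F = sg (p.1 * q.1) *: ush (u ++ [:: q, p & v]) F.
Proof.
elim: u F => [|r u IH] F h F1 F2.
  have /homog_cons[hp /homog_cons[hq hv]] := h.
  rewrite /= !scalerDr -!ushZ -!ushD; apply: (eq_ush_homog hv) => a b ha hb _.
  rewrite !tdeg_cons (F1 [::]) ?(F2 [::]) //=; last 2 first.
  - by apply/homog_cons; split=> //; apply/homog_cons.
  - by apply/homog_cons; split=> //; apply/homog_cons.
  rewrite !scalerA !sgnMM -!addrA; congr (_ + _).
  rewrite [LHS]addrCA; congr (sgn K _ *: _ + (_ *: _ + sgn K _ *: _)); try ring.
  apply: (@sgn_par _ _ _ (- (p.1 * q.1))); ring.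
have /homog_cons[hr hu] := h.
rewrite !cat_cons !ush_cons scalerDr; congr (_ + _).
  apply: IH => // a b c ha hc.
    by apply: (F1 (r :: a)) => //; apply/homog_cons.
  by apply: F2 => //; apply/homog_cons.
apply: IH => // a b c ha hc.
  rewrite F1 //; last by apply/homog_cons.
  rewrite !scalerA mulrC; congr (_ * sgn K (_ * _) *: _).
  exact: tdeg_swap.
rewrite -!cat_cons F2 //; last by apply/homog_cons.
by rewrite !scalerA mulrC.
Qed.

(** Euler's identity: moving each argument in turn to the front of a symmetric map reproduces it
    once per argument. *)
Lemma ush_pick s (Y : seq P -> V) : homog s ->
  (forall u p q v, homog (u ++ [:: p, q & v]) ->
    Y (u ++ [:: p, q & v]) = sg (p.1 * q.1) *: Y (u ++ [:: q, p & v])) ->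
  ush s (fun u v => if u is [:: p] then Y (p :: v) else 0) = (size s)%:R *: Y s.
Proof.
elim: s Y => [|q s IH] Y h YY; first by rewrite /= scale0r.
have /homog_cons[hq hs] := h.
rewrite ush_cons /= -add1n natrD scalerDl scale1r; congr (_ + _).
  rewrite -[RHS](@ush0l _ _ _ s (fun v => Y (q :: v))).
  by apply: eq_ush => -[].
rewrite -(IH (fun v => Y (q :: v))) // => [|u p r v uh]; last first.
  by apply: (YY (q :: u)); apply/homog_cons.
apply: (eq_ush_homog hs) => -[|p [|r u]] v hu hv _; rewrite ?scaler0 //.
rewrite tdeg_cons tdeg_nil addr0 (YY [::] p) /=; last first.
  by have /homog_cons[hp _] := hu; apply/homog_cons; split=> //; apply/homog_cons.
by rewrite scalerA mulrC (mulrC q.1) sgn_sqr scale1r.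
Qed.

End UnshuffleMore.

(** * Symmetrized products as powers of a generic element *)

Section ProductCalculus.

Variables (K : fieldType) (A : grAlg K).
Local Notation P := (int * A)%type.
Local Notation sg := (sgn K).
Implicit Types (s u v w a b c : seq P) (p q r : P).

Definition lprod w : A := \prod_(p <- w) p.2.
Definition sprod s : A := symr s lprod.

Lemma lprod_cat u v : lprod (u ++ v) = lprod u * lprod v.
Proof. exact: big_cat. Qed.
Lemma lprod_nil : lprod [::] = 1. Proof. exact: big_nil. Qed.
Lemma lprod_cons p w : lprod (p :: w) = p.2 * lprod w.
Proof. exact: big_cons. Qed.

Lemma ush_mull s x (F : seq P -> seq P -> A) :
  x * ush s F = ush s (fun u v => x * F u v).
Proof.
by apply: (@ush_map K A A A (fun y : A => x * y)) => c y z; rewrite mulrDr grscalerAr.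
Qed.

Lemma ush_mulr s x (F : seq P -> seq P -> A) :
  ush s F * x = ush s (fun u v => F u v * x).
Proof.
by apply: (@ush_map K A A A (fun y : A => y * x)) => c y z; rewrite mulrDl grscalerAl.
Qed.

Lemma symr_map (V W : lmodType K) (f : V -> W) s (g : seq P -> V) : linear f ->
  f (symr s g) = symr s (fun w => f (g w)).
Proof.
move=> lf; have fins p w (h : seq P -> V) : f (ins p w h) = ins p w (fun x => f (h x)).
  elim: w h => [|q w IH] h /=; first by rewrite !addr0.
  by rewrite (linear_funD lf) (linear_funZ lf) IH.
elim: s g => [|p s IH] g //=; rewrite IH; apply: eq_symr => w _; exact: fins.
Qed.

(** The factors x, y and z let one statement cover plain products and products around a letter. *)
Lemma sprod_mul u v (x y z : A) :
  x * sprod u * y * sprod v * z = 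
  symr u (fun a => symr v (fun b => x * lprod a * y * lprod b * z)).
Proof.
have l1 : linear (fun t => x * t * y * sprod v * z).
  by move=> c t t'; rewrite mulrDr !mulrDl grscalerAr !grscalerAl.
rewrite [LHS](@symr_map A A _ u lprod l1); apply: eq_symr => a _.
apply: (@symr_map A A (fun t => x * lprod a * y * t * z) v lprod) => c t t'.
by rewrite mulrDr !mulrDl grscalerAr !grscalerAl.
Qed.

Lemma ins_lprod q w :
  ins q w lprod = sum_split w (fun a b => sg (q.1 * tdeg a) *: (lprod a * q.2 * lprod b)).
Proof.
suff E (x : A) : ins q w (fun y => x * lprod y) =
    sum_split w (fun a b => sg (q.1 * tdeg a) *: (x * lprod a * q.2 * lprod b)).
  have := E 1; under eq_ins do rewrite mul1r; move=> ->.
  by apply: eq_sum_split => a b _; rewrite mul1r.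
elim: w x => [|r w IH] x /=.
  by rewrite !addr0 tdeg_nil mulr0 sgn0 scale1r !lprod_nil lprod_cons lprod_nil !mulr1.
rewrite tdeg_nil mulr0 sgn0 scale1r lprod_nil mulr1 lprod_cons mulrA; congr (_ + _).
under eq_ins do rewrite lprod_cons mulrA.
rewrite IH -sum_splitZ; apply: eq_sum_split => a b _.
by rewrite scalerA sgnMM -mulrDr tdeg_cons lprod_cons !mulrA.
Qed.

Lemma sprod_cons q s :
  sprod (q :: s) = ush s (fun a b => sg (q.1 * tdeg a) *: (sprod a * q.2 * sprod b)).
Proof.
rewrite /sprod symr_cons; under eq_symr do rewrite ins_lprod.
rewrite symr_sum_split; apply: eq_ush => a b _.
rewrite (_ : symr a lprod * _ * _ = 1 * sprod a * q.2 * sprod b * 1); last by rewrite mul1r mulr1.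
rewrite sprod_mul -symrZ; apply: eq_symr => a' aa'; rewrite -symrZ.
by apply: eq_symr => b' _; rewrite (perm_tdeg aa') mul1r mulr1.
Qed.

(* The component of arity n is the n-th derivative of a |-> e^a at 0. *)
Definition eprod s : A := ((size s)`!%:R : K)^-1 *: sprod s.

(* The derivative of the exponential along the vector field Y. *)
Lemma grcomp_eprod e (Y : seq P -> A) s :
  grcomp e Y eprod s =
  ush s (fun a w => ush w (fun u b => ((((size a + size b).+1)%N)`!%:R : K)^-1 *:
    (sg (e * tdeg a) *: (sprod a * Y u * sprod b)))).
Proof.
rewrite /grcomp -(@ushA _ _ _ s (fun a u b => ((((size a + size b).+1)%N)`!%:R : K)^-1 *:
    (sg (e * tdeg a) *: (sprod a * Y u * sprod b)))).
transitivity (ush s (fun u v => ush v (fun a b => ((((size a + size b).+1)%N)`!%:R : K)^-1 *: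
    (sg ((e + tdeg u) * tdeg a) *: (sprod a * Y u * sprod b))))).
  apply: eq_ush => u v _; rewrite /eprod sprod_cons -ushZ; apply: eq_ush => a b ab.
  by rewrite /= -(perm_size ab) size_cat.
rewrite -(@ushA _ _ _ s (fun u a b => ((((size a + size b).+1)%N)`!%:R : K)^-1 *:
    (sg ((e + tdeg u) * tdeg a) *: (sprod a * Y u * sprod b)))).
apply: eq_ush => t b _; rewrite ushC; apply: eq_ush => a u _.
rewrite !scalerA -mulrA mulrCA !sgnMM; congr (_ * _ *: _).
by apply: (@sgn_par _ _ _ (tdeg u * tdeg a)); ring.
Qed.

(** In arity n, [sprod] stands for a^n and [ush] for the product of functions of a, so this is a^i
    a^(n-i) = a^n for each cut i. *)
Lemma ush_sprod (c : nat -> nat -> K) s :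
  ush s (fun u v => c (size u) (size v) *: (sprod u * sprod v)) =
  (\sum_(i < (size s).+1) c i (size s - i)%N) *: sprod s.
Proof.
have E w : sum_split w (fun a b => c (size a) (size b) *: (lprod a * lprod b)) =
    (\sum_(i < (size w).+1) c i (size w - i)%N) *: lprod w.
  have -> : sum_split w (fun a b => c (size a) (size b) *: (lprod a * lprod b)) =
      sum_split w (fun a b => c (size a) (size b)) *: lprod w.
    rewrite (@sum_split_map _ _ _ (fun x => x *: lprod w)) ?scale0r // => [|x y]; last exact: scalerDl.
    by apply: eq_sum_split => a b <-; rewrite lprod_cat.
  congr (_ *: _); elim: w c => [|q w IH] d /=; first by rewrite big_ord1 addr0.
  rewrite big_ord_recl subn0; congr (_ + _).
  by rewrite (IH (fun i j => d i.+1 j)); apply: eq_bigr.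
transitivity (symr s (fun w => sum_split w (fun a b => c (size a) (size b) *: (lprod a * lprod b)))).
  rewrite symr_sum_split; apply: eq_ush => u v _.
  rewrite (_ : sprod u * _ = 1 * sprod u * 1 * sprod v * 1); last by rewrite !mulr1 mul1r.
  rewrite sprod_mul -symrZ; apply: eq_symr => a au; rewrite -symrZ.
  by apply: eq_symr => b bv; rewrite (perm_size au) (perm_size bv) !mulr1 mul1r.
by rewrite -symrZ; apply: eq_symr => w ws; rewrite E (perm_size ws).
Qed.

End ProductCalculus.

Section Factorials.

Variable K : fieldType.
Hypothesis charK : [pchar K] =i pred0.

Lemma natr_neq0 n : (0 < n)%N -> (n%:R : K) != 0.
Proof. by rewrite (pcharf0P K).1 // lt0n. Qed.

Lemma fact_neq0 n : (n`!%:R : K) != 0.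
Proof. by rewrite natr_neq0 // fact_gt0. Qed.

Lemma sum_triangle (V : nmodType) n (g : nat -> nat -> V) :
  \sum_(i < n.+1) \sum_(k < (n - i).+1) g i k =
  \sum_(k < n.+1) \sum_(i < (n - k).+1) g i k.
Proof.
have E (h : nat -> nat -> V) : \sum_(i < n.+1) \sum_(k < (n - i).+1) h i k =
    \sum_(i < n.+1) \sum_(k < n.+1 | (i + k <= n)%N) h i k.
  apply: eq_bigr => i _; rewrite (big_ord_widen n.+1) ?ltnS ?leq_subr //.
  by apply: eq_bigl => k; rewrite ltnS leq_subRL // -ltnS.
rewrite E (E (fun k i => g i k)) (exchange_big_dep predT) //=.
by apply: eq_bigr => k _; apply: eq_bigl => i; rewrite addnC.
Qed.

(** The coefficients of e^(-z) e^z = 1, read off from (1 - 1)^n. *)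
Lemma sum_exp_inv n :
  \sum_(k < n.+1) (-1) ^+ k * (k`!%:R : K)^-1 * ((n - k)`!%:R)^-1 = (n == 0)%:R.
Proof.
apply: (mulfI (fact_neq0 n)); rewrite mulr_sumr.
have -> : n`!%:R * (n == 0)%:R = (1 - 1 : K) ^+ n.
  by rewrite subrr expr0n; case: n => [|n]; rewrite ?fact0 ?mulr1 ?mulr0.
rewrite exprDn; apply: eq_bigr => k _; rewrite expr1n mul1r.
have kn : (k <= n)%N by rewrite -ltnS.
rewrite -(bin_fact kn) !natrM -mulr_natl; field.
by rewrite !fact_neq0.
Qed.

End Factorials.

Lemma homEnd_endStar (K : fieldType) (A : grAlg K) i (f : A -> A) :
  homEnd i f -> endStar f.
Proof.
move=> hf; exists [:: i], (fun j => if j == i then f else fun=> 0); split.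
  move=> j; case: eqP => [->//|_]; split=> [c a b|k a _]; last exact: hdeg0.
  by rewrite scaler0 addr0.
by move=> a; rewrite big_seq1 eqxx.
Qed.

Lemma homEnd0 (K : fieldType) (A : grAlg K) i : homEnd i (fun _ : A => 0 : A).
Proof.
by split=> [c a b|k a _]; [rewrite scaler0 addr0 | exact: hdeg0].
Qed.

Lemma homEnd_id (K : fieldType) (A : grAlg K) : homEnd 0 (@id A).
Proof. by split=> // k a ha; rewrite add0r. Qed.

Lemma inAff_elt (K : fieldType) (A : grAlg K) e (x : A) :
  hdeg e x -> inAff_deg e (affElt x).
Proof. by move=> hx; split=> //; exact: homEnd0. Qed.

Lemma inAff_end (K : fieldType) (A : grAlg K) e (f : A -> A) :
  homEnd e f -> inAff_deg e (affEnd f).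
Proof. by move=> hf; split=> //; exact: hdeg0. Qed.

(** * The fields of the identity and of the unit *)

Section KoszulIdentities.

Variables (K : fieldType) (Psi : bracketAssignment K).
Hypothesis charK : [pchar K] =i pred0.
Hypothesis hPsi : isKoszul Psi.

Local Notation P A := (int * carrier A)%type.

Lemma Psi_natural (T : forall A : grAlg K, seq A -> A) (g : nat -> K) :
  (forall A : grAlg K, inD 0 (T A)) ->
  (forall (A B : grAlg K) (alpha : A -> B), grAlg_morphism alpha ->
     forall s, alpha (T A s) = T B (map alpha s)) ->
  (forall (A : grAlg K) i (c : A), hdeg i c -> supercentral i c ->
     forall s a, T A (rcons s (a * c)) = T A (rcons s a) * c) ->
  (forall n, T (groundAlg K) (nseq n 1) = (g n : K)) ->
  forall (A : grAlg K) (s : seq (P A)), homog s ->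
    T A (elts s) = g (size s) *: eprod s.
Proof.
move=> Td Tn Tc Tg A s hs.
have Tlin B : multilinear (T B) by case: (Td B).
have Tsym B : graded_symmetric (T B) by case: (Td B).
rewrite (Theta_symr Tlin Tsym Tn Tc hs) /eprod scalerA; congr (_ *: _).
have := ucoef0E Tlin Tsym Tn Tc (size s); rewrite Tg => ->.
by rewrite -[RHS]mulrA divff ?mulr1 // fact_neq0.
Qed.

Lemma Psi_end_nat (A : grAlg K) (s : seq (P A)) : homog s ->
  Psi (affEnd id) (elts s) = if s is [::] then 1 else 0.
Proof.
move=> hs; rewrite (Psi_natural (T := fun A => Psi (A := A) (affEnd id))
  (g := fun n => (n == 0)%:R)) //.
- case: s hs => [|p s] _; last by rewrite /= scale0r.
  by rewrite /= scale1r /eprod fact0 invr1 scale1r /sprod /= lprod_nil.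
- by move=> B; apply/(koszul_deg hPsi)/inAff_end/homEnd_id.
- move=> B C alpha ha; apply: (koszul_nat_end hPsi) => //;
    exact: homEnd_endStar (homEnd_id _).
- by move=> B i c hc cc s' a; apply: (koszul_central_end hPsi) hc _ _ _.
- case=> [|n]; first by rewrite (koszul0_end hPsi) //; exact: homEnd_endStar (homEnd_id _).
  by rewrite (koszul_ground hPsi) // size_nseq.
Qed.

Section OneAlgebra.
Variable A : grAlg K.
Local Notation PA := (int * A)%type.
Local Notation sg := (sgn K).
Implicit Types (s u v w : seq PA) (p q : PA).

Definition Psi_l (u : aff A) s := Psi u (elts s).

Lemma Psi_graded i (u : aff A) : inAff_deg i u -> graded i (Psi_l u).
Proof.
by move=> /(koszul_deg hPsi)[_ _ hd] s hs; rewrite -sum_degs; apply: hd.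
Qed.

Lemma Psi_swap i (u : aff A) : inAff_deg i u -> swap_sym (Psi_l u).
Proof. by move=> /(koszul_deg hPsi)[_ hs _]; apply: graded_symmetric_swap. Qed.

Lemma Psi_head i (u : aff A) : inAff_deg i u -> head_linear (Psi_l u).
Proof. by move=> /(koszul_deg hPsi)[hl _ _] d v c x y; apply: (hl [::]). Qed.

Lemma Psi_bracket i j (u w : aff A) s : inAff_deg i u -> inAff_deg j w -> homog s ->
  Psi_l (affBracket i j u w) s =
  grcomp j (Psi_l w) (Psi_l u) s - sg (i * j) *: grcomp i (Psi_l u) (Psi_l w) s.
Proof.
move=> hu hw hs; rewrite /Psi_l (koszul_lie hPsi hu hw hs) /NRbracket !barwedge_ush.
by [].
Qed.

Lemma grcomp_id_l e (G : seq PA -> A) s : graded e G -> homog s ->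
  grcomp e G (Psi_l (affEnd id)) s = 0.
Proof.
move=> hG hs; rewrite /grcomp -[RHS](@ush0 K A A s).
apply: (eq_ush_homog hs) => u v hu hv _.
by rewrite /Psi_l Psi_end_nat //; apply/homog_cons; split=> //; apply: hG.
Qed.

Lemma head_linear0 (F : seq PA -> A) d v : head_linear F -> F ((d, 0) :: v) = 0.
Proof.
by move=> lF; apply: linear_fun0 (lF d v).
Qed.

Lemma head_linearN (F : seq PA -> A) d x v : head_linear F ->
  F ((d, - x) :: v) = - F ((d, x) :: v).
Proof.
by move=> lF; rewrite -!scaleN1r; apply: linear_funZ (lF d v) (-1) x.
Qed.

(** In [Psi_Id, Psi_x] = Psi_x the derivative of the constant field Psi_Id vanishes; what remains is
    minus the derivative of Psi_x in the direction 1. *)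
Lemma Psi_elt_1 e (x : A) s : hdeg e x -> homog s ->
  Psi_l (affElt x) ((0, 1) :: s) = - Psi_l (affElt x) s.
Proof.
move=> hx hs; have hid := inAff_end (homEnd_id A); have hx' := inAff_elt hx.
have := Psi_bracket hid hx' hs.
have -> : affBracket 0 e (affEnd id) (affElt x) = affElt x.
  rewrite /affBracket /affElt /= scaler0 subr0; congr (_, _).
  by apply: funext => a; rewrite subr0.
rewrite (grcomp_id_l (Psi_graded hx') hs) mul0r sgn0 scale1r sub0r => ->.
rewrite opprK /grcomp -[LHS](@ush0l _ _ _ s (fun v => Psi_l (affElt x) ((0, 1) :: v))).
apply: (eq_ush_homog hs) => -[|q u] v hu hv _; rewrite /Psi_l Psi_end_nat //.
by have := head_linear0 (0 + tdeg (q :: u)) v (Psi_head hx').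
Qed.

End OneAlgebra.

Lemma Psi_elt1_ground n : Psi (affElt (1 : groundAlg K)) (nseq n 1) = ((-1) ^+ n : K).
Proof.
elim: n => [|n IH]; first exact: (koszul0_elt hPsi).
have hs : homog (nseq n (0 : int, 1 : groundAlg K)).
  by move=> p; rewrite mem_nseq => /andP[_ /eqP->]; apply: hdeg1.
have := Psi_elt_1 (hdeg1 _) hs; rewrite /Psi_l /elts /= map_nseq IH => ->.
by rewrite exprS mulN1r.
Qed.

Section OneAlgebraExp.
Variable A : grAlg K.
Local Notation PA := (int * A)%type.
Local Notation sg := (sgn K).
Implicit Types (s u v w : seq PA) (p q : PA).

Lemma Psi_elt1 s : homog s ->
  Psi_l (affElt 1) s = (-1) ^+ size s *: eprod s.
Proof.
move=> hs; rewrite /Psi_l (Psi_natural (T := fun A => Psi (A := A) (affElt 1))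
  (g := fun n => (-1) ^+ n)) //.
- by move=> B; apply/(koszul_deg hPsi)/inAff_elt/hdeg1.
- move=> B C alpha ha s'.
  by rewrite (koszul_nat_elt hPsi ha) (grAlg_morphism1 ha).
- by move=> B i c hc cc s' a; apply: (koszul_central_elt hPsi) hc _ _ _.
- exact: Psi_elt1_ground.
Qed.

(* expo agrees with eprod on homogeneous lists and, unlike eprod, is visibly
   multilinear and graded symmetric. *)
Definition expo s : A := (-1) ^+ size s *: Psi_l (affElt 1) s.

Lemma expoE s : homog s -> expo s = eprod s.
Proof.
move=> hs; rewrite /expo Psi_elt1 // scalerA -exprD addnn -mul2n exprM.
by rewrite sqrrN !expr1n scale1r.
Qed.

Lemma expo_head : head_linear expo.
Proof.
move=> d v c x y; rewrite /expo /= (Psi_head (inAff_elt (hdeg1 A)) d v c x y).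
by rewrite scalerDr !scalerA mulrC.
Qed.

Lemma expo_swap : swap_sym expo.
Proof.
move=> u p q v h; rewrite /expo (Psi_swap (inAff_elt (hdeg1 A)) h).
by rewrite !scalerA mulrC !size_cat.
Qed.

Lemma expo_nil : expo [::] = 1.
Proof. by rewrite /expo scale1r; apply: (koszul0_elt hPsi). Qed.

Lemma expo_1 s : homog s -> expo ((0, 1) :: s) = expo s.
Proof.
move=> hs; rewrite /expo (Psi_elt_1 (hdeg1 A)) //= exprS mulN1r.
by rewrite scaleNr scalerN opprK.
Qed.

Lemma expo_seq1 p : hdeg p.1 p.2 -> expo [:: p] = p.2.
Proof.
move=> hp; rewrite expoE; last by move=> q; rewrite inE => /eqP->.
by rewrite /eprod /sprod /= addr0 /lprod big_seq1 invr1 scale1r.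
Qed.

Lemma grcomp_eprod_homog e (G : seq PA -> A) s : graded e G -> homog s ->
  grcomp e G expo s = grcomp e G (@eprod K A) s.
Proof.
move=> gG hs; apply: (eq_ush_homog hs) => u v hu hv _; apply: expoE.
by apply/homog_cons; split=> //; apply: gG.
Qed.

(** The direction e^(-a) commutes with a, so the derivative of e^a along it is e^(-a) e^a = 1. *)
Lemma grcomp_elt1_expo s : homog s ->
  grcomp 0 (Psi_l (affElt 1)) expo s = if s is [::] then 1 else 0.
Proof.
move=> hs; rewrite (grcomp_eprod_homog (Psi_graded (inAff_elt (hdeg1 A)))) //.
rewrite grcomp_eprod.
pose c i k := \sum_(l < k.+1) ((-1) ^+ l * (l`!%:R : K)^-1) * (((i + (k - l)).+1)`!%:R)^-1.
transitivity (ush s (fun a w => c (size a) (size w) *: (sprod a * sprod w))).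
  apply: (eq_ush_homog hs) => a w ha hw _.
  rewrite -grscalerAr -(@ush_sprod _ _ (fun l j => ((-1) ^+ l * (l`!%:R : K)^-1) * (((size a + j).+1)`!%:R)^-1)).
  rewrite ush_mull; apply: (eq_ush_homog hw) => u b hu hb _.
  rewrite mul0r sgn0 scale1r Psi_elt1 // /eprod !grscalerAr !grscalerAl !scalerA mulrA.
  by congr (_ *: _); rewrite mulrC.
rewrite ush_sprod /c.
rewrite (sum_triangle (size s) (fun i l => (-1) ^+ l * (l`!%:R : K)^-1 * ((i + (size s - i - l)).+1)`!%:R^-1)).
rewrite (_ : \sum_(k < _) _ = (size s == 0)%:R).
  by case: {hs} s => [|p s]; rewrite ?scale0r // scale1r /sprod /= lprod_nil.
rewrite -(sum_exp_inv charK); apply: eq_bigr => k _.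
have kn : (k <= size s)%N by rewrite -ltnS.
rewrite -mulr_sumr; congr (_ * _).
(* The inner sum consists of n - k + 1 equal terms, n being the size of s, which turns 1/(n-k+1)!
   into 1/(n-k)!. *)
rewrite (eq_bigr (fun=> ((size s - k).+1)`!%:R^-1)) => [|i _]; last first.
  by rewrite subnAC subnKC // -ltnS.
rewrite sumr_const card_ord factS natrM -[LHS]mulr_natr.
by rewrite [_^-1]invfM mulrAC mulVf ?mul1r // natr_neq0.
Qed.

End OneAlgebraExp.

End KoszulIdentities.

(** * Derivatives of the exponential along elements and endomorphisms *)

Section ExponentialDerivatives.

Variables (K : fieldType) (Psi : bracketAssignment K).
Hypothesis charK : [pchar K] =i pred0.
Hypothesis hPsi : isKoszul Psi.
Variable A : grAlg K.
Local Notation PA := (int * A)%type.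
Local Notation sg := (sgn K).
Local Notation PsiA := (@Psi_l K Psi A).
Local Notation expA := (@expo K Psi A).
Implicit Types (s u v w : seq PA) (p q : PA).

Lemma head_linearZ (F : seq PA -> A) d c x v : head_linear F ->
  F ((d, c *: x) :: v) = c *: F ((d, x) :: v).
Proof.
by move=> lF; apply: linear_funZ (lF d v) c x.
Qed.

Lemma grcomp_swap e (G F : seq PA -> A) : graded e G -> swap_sym G ->
  head_linear F -> swap_sym F -> swap_sym (grcomp e G F).
Proof.
move=> gG sG lF sF u p q v h; rewrite /grcomp; apply: ush_swap => // a b c hab hc.
  rewrite (sG _ _ _ _ hab) head_linearZ //; congr (_ *: F ((_ + _, _) :: _)).
  exact: tdeg_swap.
rewrite -!cat_cons sF //; apply/homog_cons; split=> //; exact: gG.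
Qed.

Lemma grcomp_head e (G F : seq PA -> A) : head_linear G ->
  (forall u v d, linear (fun x => F (u ++ (d, x) :: v))) ->
  head_linear (grcomp e G F).
Proof.
move=> lG lF d s c x y; rewrite /grcomp !ush_cons scalerDr addrACA -!ush_lin.
congr (_ + _); apply: eq_ush => u v _.
  by rewrite (lG d u c x y) !tdeg_cons; apply: (lF [::]).
rewrite (lF [:: (e + tdeg u, G u)] v d c x y) scalerDr !scalerA.
by rewrite [_ * c]mulrC.
Qed.

Lemma expo_slot u v d : linear (fun x => expA (u ++ (d, x) :: v)).
Proof.
have [hl _ _] := koszul_deg hPsi (inAff_elt (hdeg1 A)) => c x y.
rewrite /expo /Psi_l !elts_cat /= (hl (elts u) (elts v) c x y).
by rewrite !size_cat /= scalerDr !scalerA mulrC.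
Qed.

Lemma eq_grcomp e (G H F : seq PA -> A) s : homog s ->
  (forall u, homog u -> G u = H u) -> grcomp e G F s = grcomp e H F s.
Proof.
by move=> hs GH; apply: (eq_ush_homog hs) => u v hu _ _; rewrite GH.
Qed.

Lemma Psi_0 s : PsiA (affElt 0) s = 0.
Proof.
have h0 : inAff (affElt (0 : A)) := homEnd_endStar (homEnd0 A 0).
have := koszul_lin hPsi (-1) (elts s) h0 h0.
rewrite scaleN1r addNr => E; rewrite -[RHS]E; congr (Psi _ _).
by rewrite /affLin /affElt /= scaler0 addr0.
Qed.

Let expo_lin : head_linear expA := @expo_head _ _ hPsi A.
Let expo_sw : swap_sym expA := @expo_swap _ _ hPsi A.

(** The argument 1 is absorbed either by Psi_x, with a minus sign, or by the exponential, with a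
    plus sign; the two terms cancel. *)
Lemma grcomp_elt_expo_1 e (x : A) s : hdeg e x -> homog s ->
  grcomp e (PsiA (affElt x)) expA ((0, 1) :: s) = 0.
Proof.
move=> hx hs; have gX := Psi_graded hPsi (inAff_elt hx).
rewrite /grcomp ush_cons -ushD -[RHS](@ush0 K A A s).
apply: (eq_ush_homog hs) => u v hu hv _.
rewrite mul0r sgn0 scale1r tdeg_cons add0r (Psi_elt_1 charK hPsi hx hu) head_linearN //.
rewrite (@expo_sw [::]) /=; last first.
  apply/homog_cons; split; first exact: gX.
  by apply/homog_cons; split=> //; apply: hdeg1.
rewrite mulr0 sgn0 scale1r (expo_1 charK hPsi) ?addNr //.
by apply/homog_cons; split=> //; apply: gX.
Qed.

(* The derivative Y of the exponential along Psi_x vanishes on lists starting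
   with 1, and its derivative along Psi_1 vanishes because [Psi_x, Psi_1] = 0.
   In arity n > 0 the latter reads - n Y_n + (lower components of Y) = 0. *)
Lemma grcomp_elt_expo e (x : A) s : hdeg e x -> homog s ->
  grcomp e (PsiA (affElt x)) expA s = if s is [::] then x else 0.
Proof.
move=> hx; have gX := Psi_graded hPsi (inAff_elt hx).
have sX := Psi_swap hPsi (inAff_elt hx).
have h1 := inAff_elt (hdeg1 A); have g1 := Psi_graded hPsi h1.
set Y := grcomp _ _ _.
have sY : swap_sym Y by apply: grcomp_swap.
have lX := Psi_head hPsi (inAff_elt hx).
have lY : head_linear Y by apply: grcomp_head => //; apply: expo_slot.
(* As [x, 1] = 0 the two derivatives may be exchanged, and the derivative of e^a along Psi_1 is
   constant. *)
have Y1 v : homog v -> grcomp 0 (PsiA (affElt 1)) Y v = 0.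
  move=> hv; have := grcomp_bracket hv expo_lin expo_sw gX g1.
  rewrite (@eq_grcomp _ _ (fun=> 0)) // => [|u hu]; last first.
    rewrite -(Psi_bracket hPsi (inAff_elt hx) h1 hu) -(Psi_0 u); congr (PsiA _ _).
    by rewrite /affBracket /affElt /= !scaler0 !subr0.
  rewrite {1}/grcomp (eq_ush (G := fun _ _ => 0)) => [|u w _]; last exact: head_linear0.
  rewrite ush0 => /esym/eqP; rewrite subr_eq0 => /eqP->.
  rewrite mulr0 sgn0 scale1r /grcomp -[RHS](@ush0 K A A v).
  apply: (eq_ush_homog hv) => u w hu hw _.
  rewrite -/(grcomp 0 (PsiA (affElt 1)) expA _) (grcomp_elt1_expo charK hPsi) //.
  by apply/homog_cons; split=> //; apply: gX.
have [m] := ubnP (size s); elim: m s => // m IH [|p s] sm hs.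
  rewrite /Y /grcomp /= tdeg_nil addr0 {1}/PsiA (koszul0_elt hPsi).
  by rewrite (expo_seq1 charK hPsi).
apply: (scalerI (natr_neq0 charK (ltn0Sn (size s)))); rewrite scaler0.
rewrite -[X in X *: _]/((size (p :: s))%:R) -(ush_pick hs sY).
have -> : ush (p :: s) (fun u v => if u is [:: q] then Y (q :: v) else 0) =
    - grcomp 0 (PsiA (affElt 1)) Y (p :: s); last by rewrite Y1 ?oppr0.
rewrite /grcomp -scaleN1r -ushZ; apply: (eq_ush_homog hs) => u v hu hv uv.
(* An empty block feeds 1 to Y, which gives 0; a single letter q enters as -q and gives the Euler
   sum; a longer block leaves Y a shorter nonempty list, settled by induction. *)
rewrite scaleN1r; case: u hu uv => [|q [|r u]] hu uv.
- by rewrite tdeg_nil addr0 {1}/PsiA (koszul0_elt hPsi) [Y _]grcomp_elt_expo_1 ?oppr0.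
- rewrite (Psi_elt1 charK hPsi hu) expr1 scaleN1r.
  have -> : eprod [:: q] = q.2 by rewrite /eprod /sprod /= addr0 /lprod big_seq1 invr1 scale1r.
  rewrite tdeg_cons tdeg_nil addr0 add0r (head_linearN _ _ _ lY) opprK.
  by rewrite -surjective_pairing.
- rewrite IH ?oppr0 //; last by apply/homog_cons; split=> //; exact: g1.
  by move: sm (perm_size uv); rewrite size_cat /=; lia.
Qed.

Lemma grcomp_end_expo e (f : A -> A) s : homEnd e f -> homog s ->
  grcomp e (PsiA (affEnd f)) expA s = f (expA s).
Proof.
move=> hf; have hF := inAff_end hf; have gF := Psi_graded hPsi hF.
have [lf df] := hf; have f0 := linear_fun0 lf.
set Y := grcomp _ _ _; pose Z s := Y s - f (expA s).
suff Z0 : homog s -> Z s = 0 by move=> /Z0/eqP; rewrite subr_eq0 => /eqP.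
have ZX (x : A) ex v : hdeg ex x -> homog v -> grcomp ex (PsiA (affElt x)) Z v = 0.
  move=> hx hv; have hX := inAff_elt hx; have gX := Psi_graded hPsi hX.
  have E1 : grcomp ex (PsiA (affElt x)) Y v = if v is [::] then f x else 0.
    have := grcomp_bracket hv expo_lin expo_sw gF gX.
    rewrite (@eq_grcomp _ _ (PsiA (affElt (f x)))) // => [|u hu]; last first.
      rewrite -(Psi_bracket hPsi hF hX hu); congr (PsiA _ _).
      by rewrite /affBracket /affElt /= scaler0 f0 !subr0.
    (* The inner derivative is the constant x, so deriving it again gives 0. *)
    have -> : grcomp e (PsiA (affEnd f)) (grcomp ex (PsiA (affElt x)) expA) v = 0; last first.
      rewrite scaler0 subr0 grcomp_elt_expo //; exact: df.
    rewrite {1}/grcomp -[RHS](@ush0 K A A v).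
    apply: (eq_ush_homog hv) => u w hu hw _; rewrite grcomp_elt_expo //.
    by apply/homog_cons; split=> //; apply: gF.
  rewrite /grcomp /Z; under eq_ush do rewrite -scaleN1r addrC.
  rewrite ush_lin -/(grcomp ex (PsiA (affElt x)) Y v) E1.
  rewrite -[X in _ *: X + _](@ush_map _ _ _ _ f) //.
  rewrite -/(grcomp ex (PsiA (affElt x)) expA v) grcomp_elt_expo // scaleN1r.
  by case: (v) => [|p w]; rewrite ?f0 ?oppr0 ?addr0 // addNr.
have [m] := ubnP (size s); elim: m s => // m IH [|p s] sm hs.
  rewrite /Z /Y /grcomp /= tdeg_nil addr0 {1}/PsiA.
  rewrite (koszul0_end hPsi (homEnd_endStar hf)).
  rewrite (expo_seq1 charK hPsi) ?(expo_nil hPsi) ?subrr //.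
  by have := df 0 1 (hdeg1 A); rewrite addr0.
have /homog_cons[hp hs'] := hs.
(* The direction x is chosen to be the first argument itself. The constant term of Psi_x then gives
   Z (p :: s), and its higher terms leave Z shorter lists. *)
rewrite -(ZX _ _ _ hp hs') /grcomp -[LHS](@ush0l _ _ _ s (fun v => Z (p :: v))).
apply: (eq_ush_homog hs') => -[|q u] v hu hv uv.
  by rewrite tdeg_nil addr0 {1}/PsiA (koszul0_elt hPsi) -surjective_pairing.
rewrite IH //; last first.
  by apply/homog_cons; split=> //; apply: (Psi_graded hPsi (inAff_elt hp)).
by move: sm (perm_size uv); rewrite size_cat /=; lia.
Qed.

End ExponentialDerivatives.

(** * Inverting the derivative of the exponential *)

Section FilteredSeries.

Variables (K : fieldType) (T : lmodType K) (Fil : nat -> T -> Prop).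
Hypothesis Fil0 : forall x, Fil 0 x.
Hypothesis Fil_zero : forall k, Fil k 0.
Hypothesis Fil_lin : forall k (c : K) x y, Fil k x -> Fil k y -> Fil k (c *: x + y).
Hypothesis Fil_le : forall k l x, (k <= l)%N -> Fil l x -> Fil k x.
Implicit Types (D U V : {linear T -> T}) (x y z : T) (c d : nat -> K).

Definition raising D := forall k x, Fil k x -> Fil k.+1 (D x).

Lemma FilZ k a x : Fil k x -> Fil k (a *: x).
Proof. by move=> hx; rewrite -[_ *: _]addr0; apply: Fil_lin. Qed.

Lemma FilD k x y : Fil k x -> Fil k y -> Fil k (x + y).
Proof. by move=> hx hy; rewrite -[x]scale1r; apply: Fil_lin. Qed.

Lemma FilN k x : Fil k x -> Fil k (- x).
Proof. by rewrite -scaleN1r; apply: FilZ. Qed.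

Lemma Fil_sum k (I : Type) (s : seq I) (P : pred I) (F : I -> T) :
  (forall i, P i -> Fil k (F i)) -> Fil k (\sum_(i <- s | P i) F i).
Proof. by move=> h; apply: big_ind => // x y; apply: FilD. Qed.

Lemma Fil_iter D k l x : raising D -> Fil k x -> Fil (l + k) (iter l D x).
Proof. by move=> rD hx; elim: l => //= l; apply: rD. Qed.

Definition eqF n x y := Fil n (x - y).

Lemma eqF_trans n x y z : eqF n x y -> eqF n y z -> eqF n x z.
Proof. by rewrite /eqF => /FilD h /h; rewrite addrA subrK. Qed.

Lemma eqF_sym n x y : eqF n x y -> eqF n y x.
Proof. by rewrite /eqF => /FilN; rewrite opprB. Qed.

Lemma iterD_lin D i a x y : iter i D (a *: x + y) = a *: iter i D x + iter i D y.
Proof. by elim: i => //= i ->; rewrite linearP. Qed.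

Lemma iter_0 D i : iter i D 0 = 0.
Proof. by elim: i => //= i ->; rewrite linear0. Qed.

Lemma iterZ D i a x : iter i D (a *: x) = a *: iter i D x.
Proof. by rewrite -[a *: x]addr0 iterD_lin iter_0 addr0. Qed.

Lemma iter_sum D i (I : Type) (s : seq I) (P : pred I) (F : I -> T) :
  iter i D (\sum_(j <- s | P j) F j) = \sum_(j <- s | P j) iter i D (F j).
Proof.
elim: i => //= i ->; exact: linear_sum.
Qed.

(** A truncated power series in D. For raising D the omitted terms lie in [Fil n], so congruences
    modulo the filtration replace infinite sums. *)
Definition ser n c D x := \sum_(i < n) c i *: iter i D x.

Lemma ser_eqF n c D x y : raising D -> eqF n x y -> eqF n (ser n c D x) (ser n c D y).
Proof.
move=> rD xy; rewrite /eqF /ser -sumrB; apply: Fil_sum => i _.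
rewrite -scalerBr; apply: FilZ.
have -> : iter i D x - iter i D y = iter i D (x - y).
  by rewrite addrC -scaleN1r -iterD_lin scaleN1r addrC.
by apply: Fil_le (Fil_iter i rD xy); rewrite leq_addl.
Qed.

Lemma sum_diag (W : nmodType) n (g : nat -> nat -> W) :
  \sum_(i < n.+1) \sum_(j < (n - i).+1) g i j =
  \sum_(m < n.+1) \sum_(i < m.+1) g i (m - i)%N.
Proof.
elim: n => [|n IH]; first by rewrite !big_ord1.
rewrite [RHS]big_ord_recr /= -IH big_ord_recr /= subnn big_ord1.
rewrite [X in _ = _ + X]big_ord_recr /= subnn addrA; congr (_ + _).
rewrite -big_split; apply: eq_bigr => i _ /=.
by rewrite subSn ?big_ord_recr // -ltnS.
Qed.

(** Terms with i + j > n lie in [Fil n.+1]. The family X is general so that it covers both powers of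
    an operator and the operators f_k. *)
Lemma ser_fam n c d U (X : nat -> T) : raising U -> (forall j, Fil j (X j)) ->
  eqF n.+1 (ser n.+1 c U (\sum_(j < n.+1) d j *: X j))
    (\sum_(m < n.+1) \sum_(i < m.+1) (c i * d (m - i)%N) *: iter i U (X (m - i)%N)).
Proof.
move=> rU rX.
rewrite -(sum_diag n (fun i j => (c i * d j) *: iter i U (X j))) /eqF /ser -sumrB.
apply: Fil_sum => i _; rewrite iter_sum scaler_sumr.
rewrite (bigID (fun j : 'I_n.+1 => (j < (n - i).+1)%N)) /=.
rewrite [X in _ - X](big_ord_widen n.+1 (fun j => (c i * d j) *: iter i U (X j))); last first.
  by rewrite ltnS leq_subr.
rewrite addrAC -sumrB big1 ?add0r => [|j _]; last first.
  by rewrite iterZ scalerA subrr.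
apply: Fil_sum => j; rewrite -leqNgt => ij; rewrite iterZ; apply/FilZ/FilZ.
by apply: Fil_le (Fil_iter i rU (rX j)); move: ij; lia.
Qed.

Lemma ser_mul n c d U V x : raising U -> raising V ->
  eqF n.+1 (ser n.+1 c U (ser n.+1 d V x))
    (\sum_(m < n.+1) \sum_(i < m.+1) (c i * d (m - i)%N) *: iter i U (iter (m - i) V x)).
Proof.
move=> rU rV; apply: (ser_fam n c d (X := fun j => iter j V x)) => // j.
by have := Fil_iter j rV (Fil0 x); rewrite addn0.
Qed.

Definition conv c d m := \sum_(i < m.+1) c i * d (m - i)%N.

Lemma ser_conv n c d D x : raising D ->
  eqF n.+1 (ser n.+1 c D (ser n.+1 d D x)) (ser n.+1 (conv c d) D x).
Proof.
move=> rD; rewrite [X in eqF _ _ X](_ : _ = \sum_(m < n.+1) \sum_(i < m.+1)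
    (c i * d (m - i)%N) *: iter i D (iter (m - i) D x)); first exact: ser_mul.
apply: eq_bigr => m _; rewrite /conv scaler_suml; apply: eq_bigr => i _.
by rewrite -iterD subnKC // -ltnS.
Qed.

Lemma ser_inv n c d D x : raising D ->
  (forall m, (m <= n)%N -> conv c d m = (m == 0%N)%:R) ->
  eqF n.+1 (ser n.+1 c D (ser n.+1 d D x)) x.
Proof.
move=> rD cd; apply: eqF_trans (ser_conv n c d x rD) _; rewrite /ser big_ord_recl cd //.
rewrite big1 ?scale1r ?addr0 => [|i _]; last by rewrite cd ?scale0r // -ltnS.
by rewrite /eqF subrr.
Qed.

(** Pascal's rule as the inductive step of a binomial theorem; it serves for powers of V + Z and for
    commutators with products. *)
Lemma sum_pascal (W : lmodType K) m (g : nat -> nat -> W) :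
  \sum_(q < m.+2) ('C(m.+1, q))%:R *: g (m.+1 - q)%N q =
  \sum_(q < m.+1) ('C(m, q))%:R *: g (m - q).+1 q +
  \sum_(q < m.+1) ('C(m, q))%:R *: g (m - q)%N q.+1.
Proof.
rewrite big_ord_recl bin0 subn0.
have -> : \sum_(q < m.+1) ('C(m.+1, lift ord0 q))%:R *: g (m.+1 - lift ord0 q)%N (lift ord0 q) =
    \sum_(q < m.+1) ('C(m, q.+1))%:R *: g (m - q)%N q.+1
    + \sum_(q < m.+1) ('C(m, q))%:R *: g (m - q)%N q.+1.
  rewrite -big_split; apply: eq_bigr => q _ /=.
  by rewrite /bump /= add1n binS natrD scalerDl subSS.
rewrite addrA; congr (_ + _).
rewrite big_ord_recr /= bin_small // scale0r addr0 [RHS]big_ord_recl bin0 subn0.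
congr (_ + _); apply: eq_bigr => q _; rewrite /= /bump /= add1n.
by rewrite -subSn // subSS.
Qed.

Section TwoOperators.

Variables (U V : {linear T -> T}).
Hypothesis UV : forall x, U (V x) = V (U x).

Lemma iter_comm i x : iter i U (V x) = V (iter i U x).
Proof. by elim: i => //= i ->; rewrite UV. Qed.

Lemma iter_comm2 i j x : iter i U (iter j V x) = iter j V (iter i U x).
Proof. by elim: j => //= j IH; rewrite iter_comm IH. Qed.

End TwoOperators.

Lemma bin_inv (u v w : K) : u != 0 -> v != 0 -> w != 0 ->
  w^-1 * v^-1 = (u * (v * w))^-1 * u.
Proof. by move=> u0 v0 w0; field; rewrite u0 v0 w0. Qed.

Section DifferenceQuotient.

Variables (U V Z : {linear T -> T}).
Hypothesis UV : forall x, U (V x) = V (U x).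
Hypothesis UE : forall x, U x = V x + Z x.

Let ZV x : Z (V x) = V (Z x).
Proof.
have E y : Z y = U y - V y by rewrite UE addrC addrA addNr add0r.
by rewrite !E UV linearB.
Qed.

Lemma iter_binomial m x :
  iter m U x = \sum_(q < m.+1) ('C(m, q))%:R *: iter (m - q) V (iter q Z x).
Proof.
elim: m x => [|m IH] x; first by rewrite big_ord1 bin0 scale1r.
rewrite (sum_pascal m (fun i q => iter i V (iter q Z x))) iterSr UE.
rewrite -[V x]scale1r iterD_lin scale1r !IH; congr (_ + _); apply: eq_bigr => q _.
  by rewrite (@iter_comm Z V ZV) -iterSr.
by rewrite -iterSr.
Qed.

(** The quotient ((V + Z)^(m+1) - V^(m+1)) / Z, obtained by induction because Z cannot be
    inverted. *)
Lemma sum_iter_quotient m x :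
  \sum_(i < m.+1) iter i U (iter (m - i) V x) =
  \sum_(q < m.+1) ('C(m.+1, q.+1))%:R *: iter (m - q) V (iter q Z x).
Proof.
elim: m x => [|m IH] x; first by rewrite !big_ord1 bin1 scale1r.
rewrite big_ord_recr [nat_of_ord _]/= subnn -[iter 0 V x]/x (iter_binomial m.+1).
have -> : \sum_(i < m.+1) iter i U (iter (m.+1 - i) V x) =
    \sum_(i < m.+1) iter i U (iter (m - i) V (V x)).
  by apply: eq_bigr => i _; rewrite subSn -?iterSr // -ltnS.
rewrite IH [RHS](eq_bigr (fun q : 'I_m.+2 => ('C(m.+1, q.+1))%:R *: iter (m.+1 - q) V (iter q Z x)
  + ('C(m.+1, q))%:R *: iter (m.+1 - q) V (iter q Z x))) => [|q _]; last first.
  by rewrite -scalerDl -natrD -binS.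
rewrite big_split /=; congr (_ + _); rewrite [RHS]big_ord_recr /= bin_small // scale0r addr0.
apply: eq_bigr => q _; rewrite (@iter_comm Z V ZV) -iterSr subSn // -ltnS.
by rewrite ltn_ord.
Qed.

(* (e^U - e^V) / (U - V) = e^V (e^Z - 1) / Z for U = V + Z, and Z / (e^Z - 1)
   is the generating series of the Bernoulli numbers. *)
Lemma quotient_inv n (B : nat -> K) x y : [pchar K] =i pred0 -> isBernoulli B ->
  raising V -> raising Z ->
  eqF n.+1 (\sum_(m < n.+1) (m.+1`!%:R^-1 : K) *:
     \sum_(i < m.+1) iter i U (iter (m - i) V x)) y ->
  eqF n.+1 x (ser n.+1 (fun m => B m / m`!%:R) Z
     (ser n.+1 (fun k => (-1) ^+ k / k`!%:R) V y)).
Proof.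
move=> charK hB rV rZ hxy.
(* Coefficients of (e^z - 1) / z and of e^z. *)
pose g q : K := (q.+1`!%:R)^-1; pose ep p : K := (p`!%:R)^-1.
have H : eqF n.+1 (ser n.+1 ep V (ser n.+1 g Z x)) y.
  apply: eqF_trans (ser_mul n ep g x rV rZ) _; apply: eqF_trans hxy.
  rewrite /eqF -sumrB big1 => [|m _]; first exact: Fil_zero.
  rewrite sum_iter_quotient scaler_sumr [X in X - _](reindex_inj rev_ord_inj) /=.
  rewrite -sumrB big1 // => q _; rewrite subSS subKn; last by rewrite -ltnS.
  have qm : (q <= m)%N by rewrite -ltnS.
  apply/eqP; rewrite subr_eq0 scalerA; apply/eqP; congr (_ *: _).
  have -> : m.+1`!%:R = 'C(m.+1, q.+1)%:R * (q.+1`!%:R * (m - q)`!%:R) :> K.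
    by rewrite -2!natrM -[(m - q)%N]/(m.+1 - q.+1)%N bin_fact.
  apply: bin_inv; [|exact: (fact_neq0 charK q.+1) | exact: (fact_neq0 charK (m - q))].
  by rewrite natr_neq0 // bin_gt0 ltnS.
have E1 : eqF n.+1 (ser n.+1 (fun k => (-1) ^+ k / k`!%:R) V y) (ser n.+1 g Z x).
  apply: eqF_trans (ser_eqF _ rV (eqF_sym H)) _; apply: ser_inv => // m _.
  by rewrite -(sum_exp_inv charK); apply: eq_bigr => k _.
apply: eqF_sym; apply: eqF_trans (ser_eqF _ rZ E1) _; apply: ser_inv => // m _.
(* The Bernoulli identity involves e^z - 1, without constant term; its coefficient in degree m + 1
   is the coefficient in degree m for (e^z - 1) / z. *)
have := hB m.+1; rewrite big_ord_recr /= subnn mulr0 addr0 eqSS => <-.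
apply: eq_bigr => k _; have km : (k <= m)%N by rewrite -ltnS.
by rewrite subSn.
Qed.

End DifferenceQuotient.

End FilteredSeries.

Section MoreSums.

Variables (K : fieldType) (T : nmodType) (V : lmodType K).
Local Notation P := (int * T)%type.

Lemma ush_sum (I : Type) (r : seq I) (Q : pred I) (F : I -> seq P -> seq P -> V) s :
  \sum_(i <- r | Q i) ush s (F i) = ush s (fun u v => \sum_(i <- r | Q i) F i u v).
Proof.
elim: r => [|i r IH].
  by rewrite big_nil -[LHS](@ush0 K T V s); apply: eq_ush => u v _; rewrite big_nil.
rewrite big_cons IH; case: ifP => Qi; rewrite -?ushD; apply: eq_ush => u v _;
  by rewrite big_cons Qi.
Qed.

Lemma symr_sum (I : Type) (r : seq I) (Q : pred I) (F : I -> seq P -> V) s :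
  symr s (fun w => \sum_(i <- r | Q i) F i w) = \sum_(i <- r | Q i) symr s (F i).
Proof.
elim: r => [|i r IH].
  by rewrite big_nil -[RHS](@symr0 K T V s); apply: eq_symr => w _; rewrite big_nil.
rewrite big_cons -IH; case: ifP => Qi; rewrite -?symrD; apply: eq_symr => w _;
  by rewrite big_cons Qi.
Qed.

Lemma ush_symr s t (F : seq P -> seq P -> seq P -> V) :
  ush s (fun u v => symr t (fun w => F w u v)) = symr t (fun w => ush s (F w)).
Proof.
elim: s F => [//|p s IH] F /=; rewrite (IH (fun w u v => F w (p :: u) v)).
rewrite symrD; congr (_ + _); rewrite -(IH (fun w u v => _ *: F w u (p :: v))).
by apply: eq_ush => u v _; rewrite symrZ.
Qed.

End MoreSums.

(** * Multiplication by the generic element *)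

Section WordOperators.

Variables (K : fieldType) (A : grAlg K) (e : int).
Local Notation PA := (int * A)%type.
Local Notation sg := (sgn K).
Local Notation T := (seq PA -> A).
Implicit Types (s u v w : seq PA) (p q : PA) (Y Z : T).

Definition spow k v : A := if size v == k then sprod v else 0.

Lemma spow0 v : spow 0 v = if v is [::] then 1 else 0.
Proof. by case: v => [|p v] //; rewrite /spow /sprod /= lprod_nil. Qed.

Lemma spow1 v : spow 1 v = if v is [:: q] then q.2 else 0.
Proof.
case: v => [|q [|r v]] //=.
by rewrite /spow /sprod /= addr0 lprod_cons lprod_nil mulr1.
Qed.

Lemma spowM k l s : ush s (fun u v => spow k u * spow l v) = spow (k + l)%N s.
Proof.
pose c i j : K := ((i == k) && (j == l))%:R.
transitivity (ush s (fun u v => c (size u) (size v) *: (sprod u * sprod v))).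
  apply: eq_ush => u v _; rewrite /spow /c.
  by case: eqP => _; case: eqP => _; rewrite ?scale1r ?scale0r ?mulr0 ?mul0r.
rewrite ush_sprod /spow /c; case: eqP => [->|sn].
  rewrite (bigD1 (Ordinal (leq_addr l k : (k < (k + l).+1)%N))) //= big1 => [|i ik].
    by rewrite addKn !eqxx addr0 scale1r.
  by case: eqP => // E; case/eqP: ik; apply: val_inj.
rewrite big1 ?scale0r // => i _; case: eqP => // ik; case: eqP => // il.
by case: sn; move: (ltn_ord i) ik il; lia.
Qed.

(** Right multiplication by a. In [Lop] the letter must pass Y u, whose degree is e + [tdeg u] for Y
    of degree e, hence the sign there. *)
Definition Rop Y : T := fun s => ush s (fun u v => Y u * spow 1 v).
Definition Lop Y : T := fun s =>
  ush s (fun u v => sg ((e + tdeg u) * tdeg v) *: (spow 1 v * Y u)).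
Definition Dop Y : T := fun s => Rop Y s - Lop Y s.
Definition Eop Y : T := fun s => Lop Y s - Rop Y s.

Lemma Rop_linear : linear Rop.
Proof.
move=> c Y Z; apply: funext => s.
rewrite -[RHS]/(c *: Rop Y s + Rop Z s) /Rop -ush_lin; apply: eq_ush => u v _.
by rewrite -[(c *: Y + Z) u]/(c *: Y u + Z u) mulrDl grscalerAl.
Qed.
HB.instance Definition _ := GRing.isLinear.Build K T T *:%R Rop Rop_linear.

Lemma Lop_linear : linear Lop.
Proof.
move=> c Y Z; apply: funext => s.
rewrite -[RHS]/(c *: Lop Y s + Lop Z s) /Lop -ush_lin; apply: eq_ush => u v _.
rewrite -[(c *: Y + Z) u]/(c *: Y u + Z u) mulrDr grscalerAr scalerDr !scalerA.
by rewrite mulrC.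
Qed.
HB.instance Definition _ := GRing.isLinear.Build K T T *:%R Lop Lop_linear.

Lemma Dop_linear : linear Dop.
Proof.
move=> c Y Z; apply: funext => s.
rewrite /Dop Rop_linear Lop_linear.
rewrite -[LHS]/(c *: Rop Y s + Rop Z s - (c *: Lop Y s + Lop Z s)).
rewrite -[RHS]/(c *: (Rop Y s - Lop Y s) + (Rop Z s - Lop Z s)).
by rewrite scalerBr opprD addrACA.
Qed.
HB.instance Definition _ := GRing.isLinear.Build K T T *:%R Dop Dop_linear.

Lemma Eop_linear : linear Eop.
Proof.
move=> c Y Z; apply: funext => s.
rewrite /Eop Rop_linear Lop_linear.
rewrite -[LHS]/(c *: Lop Y s + Lop Z s - (c *: Rop Y s + Rop Z s)).
rewrite -[RHS]/(c *: (Lop Y s - Rop Y s) + (Lop Z s - Rop Z s)).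
by rewrite scalerBr opprD addrACA.
Qed.
HB.instance Definition _ := GRing.isLinear.Build K T T *:%R Eop Eop_linear.

Definition Fil (k : nat) Y := forall s, homog s -> (size s < k)%N -> Y s = 0.

Lemma Fil_r0 Y : Fil 0 Y. Proof. by []. Qed.
Lemma Fil_z k : Fil k 0. Proof. by []. Qed.
Lemma Fil_l k (c : K) Y Z : Fil k Y -> Fil k Z -> Fil k (c *: Y + Z).
Proof.
move=> hY hZ s hs sk; rewrite -[LHS]/(c *: Y s + Z s) hY // hZ //.
by rewrite scaler0 addr0.
Qed.
Lemma Fil_mono k l Y : (k <= l)%N -> Fil l Y -> Fil k Y.
Proof. by move=> kl hY s hs sk; apply: hY => //; apply: leq_trans kl. Qed.

Lemma Rop_raising : raising Fil Rop.
Proof.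
move=> k Y hY s hs sk; rewrite /Rop -[RHS](@ush0 K A A s).
apply: (eq_ush_homog hs) => u v hu hv uv; rewrite /spow.
case: eqP => [v1|_]; last by rewrite mulr0.
rewrite hY ?mul0r //.
by have := perm_size uv; rewrite size_cat v1 addn1 => E; rewrite -ltnS E.
Qed.

Lemma Lop_raising : raising Fil Lop.
Proof.
move=> k Y hY s hs sk; rewrite /Lop -[RHS](@ush0 K A A s).
apply: (eq_ush_homog hs) => u v hu hv uv; rewrite /spow.
case: eqP => [v1|_]; last by rewrite mul0r scaler0.
rewrite hY ?mulr0 ?scaler0 //.
by have := perm_size uv; rewrite size_cat v1 addn1 => E; rewrite -ltnS E.
Qed.

Lemma Dop_raising : raising Fil Dop.
Proof.
move=> k Y hY s hs sk; have hR : Rop Y s = 0 := Rop_raising hY hs sk.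
have hL : Lop Y s = 0 := Lop_raising hY hs sk.
by rewrite -[LHS]/(Dop Y s) /Dop hR hL subrr.
Qed.

Lemma Eop_raising : raising Fil Eop.
Proof.
move=> k Y hY s hs sk; have hR : Rop Y s = 0 := Rop_raising hY hs sk.
have hL : Lop Y s = 0 := Lop_raising hY hs sk.
by rewrite -[LHS]/(Eop Y s) /Eop hR hL subrr.
Qed.

Lemma iter_Rop j Y s : iter j Rop Y s = ush s (fun u v => Y u * spow j v).
Proof.
elim: j s => [|j IH] s.
  rewrite /= -[LHS](@ush0r _ _ _ s Y); apply: eq_ush => u v _.
  by rewrite spow0; case: v; rewrite ?mulr1 ?mulr0.
rewrite iterS /Rop.
transitivity (ush s (fun t z => ush t (fun u v => Y u * spow j v * spow 1 z))).
  by apply: eq_ush => t z _; rewrite IH ush_mulr.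
rewrite (ushA s (fun u v z => Y u * spow j v * spow 1 z)).
apply: eq_ush => u x _; rewrite -(addn1 j) -spowM ush_mull.
by apply: eq_ush => v z _; rewrite mulrA.
Qed.

Lemma Lop_front Y s :
  Lop Y s = ush s (fun u v => sg (e * tdeg u) *: (spow 1 u * Y v)).
Proof.
rewrite [RHS]ushC; apply: eq_ush => u v _; rewrite scalerA sgnMM.
by congr (sgn K _ *: _); ring.
Qed.

Lemma iter_Lop j Y s :
  iter j Lop Y s = ush s (fun u v => sg (e * tdeg u) *: (spow j u * Y v)).
Proof.
elim: j s => [|j IH] s.
  rewrite /= -[LHS](@ush0l _ _ _ s Y); apply: eq_ush => u v _.
  rewrite spow0; case: u => [|r u]; last by rewrite mul0r scaler0.
  by rewrite (@tdeg_nil A) mulr0 sgn0 scale1r mul1r.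
rewrite iterS Lop_front.
transitivity (ush s (fun z t => ush t (fun u v => sg (e * (tdeg z + tdeg u)) *: (spow 1 z * spow j u * Y v)))).
  apply: eq_ush => z t _; rewrite IH ush_mull -ushZ.
  by apply: eq_ush => u v _; rewrite grscalerAr scalerA sgnMM mulrDr mulrA.
rewrite -(ushA s (fun z u v => sg (e * (tdeg z + tdeg u)) *: (spow 1 z * spow j u * Y v))).
apply: eq_ush => x v _; rewrite -(add1n j). rewrite -spowM ush_mulr -ushZ.
by apply: eq_ush => z u qu; rewrite -(perm_tdeg qu) tdeg_cat.
Qed.

Lemma LopRop Y : Lop (Rop Y) = Rop (Lop Y).
Proof.
apply: funext => s; rewrite Lop_front.
transitivity (ush s (fun z t => ush t (fun u v => sg (e * tdeg z) *: (spow 1 z * Y u * spow 1 v)))).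
  by apply: eq_ush => z t _; rewrite ush_mull -ushZ; apply: eq_ush => u v _; rewrite mulrA.
rewrite -(ushA s (fun z u v => sg (e * tdeg z) *: (spow 1 z * Y u * spow 1 v))).
apply: eq_ush => t v _; rewrite Lop_front ush_mulr.
by apply: eq_ush => z u _; rewrite grscalerAl.
Qed.

(** The arities of u and v single out i and m - i, leaving one term. *)
Lemma sum_spow n u v (x : A) : (size u + size v <= n)%N ->
  \sum_(m < n.+1) (m.+1`!%:R^-1 : K) *:
     \sum_(i < m.+1) spow i u * x * spow (m - i)%N v =
  (((size u + size v).+1)%N`!%:R^-1 : K) *: (sprod u * x * sprod v).
Proof.
move=> uvn.
transitivity (\sum_(m < n.+1) \sum_(i < m.+1)
    (((i + (m - i)).+1)%N`!%:R^-1 : K) *: (spow i u * x * spow (m - i)%N v)).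
  apply: eq_bigr => m _; rewrite scaler_sumr; apply: eq_bigr => i _.
  by rewrite subnKC // -ltnS.
rewrite -(sum_diag n (fun i j => (((i + j).+1)%N`!%:R^-1 : K) *: (spow i u * x * spow j v))).
have un : (size u < n.+1)%N by lia.
rewrite (bigD1 (Ordinal un)) //= [X in _ + X]big1 => [|i ui]; last first.
  rewrite big1 // => j _; rewrite /spow; case: eqP => [E|_]; last by rewrite !mul0r scaler0.
  by case/eqP: ui; apply: val_inj.
have vn : (size v < (n - size u).+1)%N by lia.
rewrite (bigD1 (Ordinal vn)) //= [X in _ + X + _]big1 => [|j vj]; last first.
  rewrite /spow; case: (size v =P j) => [E|_]; last by rewrite mulr0 scaler0.
  by case/eqP: vj; apply: val_inj.
by rewrite /spow !eqxx !addr0.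
Qed.

(** The derivative of the exponential along Y written as (e^L - e^R) / (L - R) applied to Y,
    truncated beyond the arity of s. *)
Lemma grcomp_series n Y s : (size s <= n)%N ->
  (\sum_(m < n.+1) (m.+1`!%:R^-1 : K) *:
     \sum_(i < m.+1) iter i Lop (iter (m - i) Rop Y)) s = grcomp e Y (@eprod K A) s.
Proof.
move=> sn; rewrite grcomp_eprod fct_sumE.
transitivity (\sum_(m < n.+1) ush s (fun a t => ush t (fun u b => (m.+1`!%:R^-1 : K) *:
    \sum_(i < m.+1) sg (e * tdeg a) *: (spow i a * Y u * spow (m - i)%N b)))).
  apply: eq_bigr => m _.
  rewrite -[LHS]/((m.+1`!%:R^-1 : K) *: (\sum_(i < m.+1) iter i Lop (iter (m - i) Rop Y)) s).
  rewrite fct_sumE (eq_bigr (fun i : 'I_m.+1 => ush s (fun a t => ush t (fun u b =>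
      sg (e * tdeg a) *: (spow i a * Y u * spow (m - i)%N b))))) => [|i _]; last first.
    rewrite iter_Lop; apply: eq_ush => a t _; rewrite iter_Rop ush_mull -ushZ.
    by apply: eq_ush => u b _; rewrite mulrA.
  rewrite ush_sum -ushZ; apply: eq_ush => a t _; rewrite ush_sum -ushZ.
  by apply: eq_ush => u b _.
rewrite ush_sum; apply: eq_ush => a t at_s; rewrite ush_sum; apply: eq_ush => u b ub.
rewrite [RHS]scalerA [X in _ = X *: _]mulrC -[RHS]scalerA -(sum_spow (n := n)) ?scaler_sumr; last first.
  by rewrite (leq_trans _ sn) // -(perm_size at_s) size_cat leq_add2l -(perm_size ub) size_cat leq_addl.
apply: eq_bigr => m _; rewrite -scaler_sumr !scalerA; congr (_ *: _).
by rewrite mulrC.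
Qed.

End WordOperators.

(** * Nested braces and iterated commutators *)

Section NestedBraces.

Variables (K : fieldType) (A : grAlg K) (e : int).
Local Notation PA := (int * A)%type.
Local Notation sg := (sgn K).
Local Notation T := (seq PA -> A).
Local Notation De := (@Dop K A e).
Local Notation Le := (@Lop K A e).
Local Notation Re := (@Rop K A).
Local Notation spowA := (@spow K A).
Implicit Types (s u v w : seq PA) (p q : PA) (Y Z : T).

Lemma foldl_hbrace_deg p s : (foldl (@hbrace K A) p s).1 = p.1 + tdeg s.
Proof.
elim: s p => [|q s IH] p; first by rewrite tdeg_nil addr0.
by rewrite tdeg_cons addrA /= IH.
Qed.

Lemma nestBrace_rcons p s q :
  nestBrace p (rcons s q) =
  nestBrace p s * q.2 - sg ((p.1 + tdeg s) * q.1) *: (q.2 * nestBrace p s).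
Proof. by rewrite /nestBrace -cats1 foldl_cat /= foldl_hbrace_deg. Qed.

Variable bs : seq PA -> PA.
Hypothesis bs_deg : forall w, (bs w).1 = e + tdeg w.

(** Braces with m further copies of a around a start [bs] on k letters; [bs] is kept abstract to
    cover both x a_1 ... a_k and f_k. *)
Definition nest (m k : nat) : T := fun s =>
  if size s == (k + m)%N then
    symr s (fun w => nestBrace (bs (take k w)) (drop k w)) else 0.

(** Applying R - L to a nested brace braces it with a new last letter, by [symr_rcons]. *)
Lemma Dop_nest m k : De (nest m k) = nest m.+1 k.
Proof.
apply: funext => s; case: s => [|p s].
  rewrite /nest addnS /= /Dop /Rop /Lop /= spow1.
  by rewrite mulr0 mul0r scaler0 subrr.
set s' := p :: s; rewrite {2}/nest symr_rcons // /Dop /Rop /Lop.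
rewrite -scaleN1r addrC -ush_lin.
transitivity (ush s' (fun u v => if size s' == (k + m.+1)%N then
   if v is [:: q] then symr u (fun w => nestBrace (bs (take k (rcons w q))) (drop k (rcons w q)))
   else 0 else 0)); last first.
  by case: eqP => // _; rewrite ush0.
apply: eq_ush => u v uv; rewrite spow1.
case: v uv => [|q [|r v]] uv; rewrite ?mulr0 ?mul0r ?scaler0 ?addr0 ?if_same //.
rewrite -(perm_size uv) size_cat addn1 addnS eqSS /nest.
case: eqP => [su|_]; last by rewrite mulr0 mul0r !scaler0 addr0.
have lf : linear (fun x : A => x * q.2 - sg ((e + tdeg u) * q.1) *: (q.2 * x)).
  move=> c x y; rewrite mulrDl mulrDr grscalerAl grscalerAr !scalerDr.
  by rewrite scalerN !scalerA mulrC opprD addrACA.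
rewrite tdeg_cons tdeg_nil addr0 scaleN1r addrC.
rewrite (symr_map u (fun w => nestBrace (bs (take k w)) (drop k w)) lf).
apply: eq_symr => w wu; have sw : (k <= size w)%N by rewrite (perm_size wu) su leq_addr.
rewrite -cats1 takel_cat // drop_cat.
case: ltngtP sw => // [kw _|kw _].
  rewrite cats1 nestBrace_rcons bs_deg -addrA -tdeg_cat cat_take_drop.
  by rewrite (perm_tdeg wu).
rewrite kw subnn drop0 drop_oversize ?kw // take_oversize ?kw //.
by rewrite -[[:: q]]/(rcons [::] q) nestBrace_rcons bs_deg tdeg_nil addr0 (perm_tdeg wu).
Qed.

Lemma iter_Dop_nest m k : iter m De (nest 0 k) = nest m k.
Proof. by elim: m => //= m ->; apply: Dop_nest. Qed.

Lemma ser_nest n (b c : nat -> K) s : size s = n ->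
  ser n.+1 b De (\sum_(k < n.+1) c k *: nest 0 k) s =
  symr s (fun w => \sum_(k < n.+1) (b (n - k)%N * c k) *:
     nestBrace (bs (take k w)) (drop k w)).
Proof.
move=> sn; rewrite symr_sum /ser fct_sumE.
transitivity (\sum_(m < n.+1) \sum_(k < n.+1) (b m * c k) *: nest m k s).
  apply: eq_bigr => m _.
  rewrite iter_sum -[LHS]/(b m *: ((\sum_(i < n.+1) iter m De (c i *: nest 0 i)) s)).
  rewrite fct_sumE scaler_sumr; apply: eq_bigr => k _.
  by rewrite iterZ iter_Dop_nest -[in LHS]/(c k *: nest m k s) scalerA.
rewrite exchange_big /=; apply: eq_bigr => k _.
have kn : (k <= n)%N by rewrite -ltnS.
have nk : (n - k < n.+1)%N by rewrite ltnS leq_subr.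
rewrite (bigD1 (Ordinal nk)) //= big1 => [|m mk].
  by rewrite addr0 /nest sn subnKC // eqxx symrZ.
rewrite /nest sn; case: eqP => [E|_]; last by rewrite scaler0.
by case/eqP: mk; apply: val_inj => /=; lia.
Qed.

End NestedBraces.

Section Commutators.

Variables (K : fieldType) (A : grAlg K) (e : int) (f : A -> A).
Hypothesis lf : linear f.
Local Notation PA := (int * A)%type.
Local Notation sg := (sgn K).
Local Notation T := (seq PA -> A).
Local Notation Le := (@Lop K A e).
Local Notation spowA := (@spow K A).
Implicit Types (s u v w : seq PA) (p q : PA) (Y Z : T).

Definition adf w : A -> A := (foldl (@adL K A) (e, f) w).2.

Lemma foldl_adL_deg (g : int * (A -> A)) w : (foldl (@adL K A) g w).1 = g.1 + tdeg w.
Proof.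
elim: w g => [|q w IH] g; first by rewrite tdeg_nil addr0.
by rewrite tdeg_cons addrA /= IH.
Qed.

Lemma adf_rcons w q (b : A) :
  adf (rcons w q) b = adf w (q.2 * b) - sg ((e + tdeg w) * q.1) *: (q.2 * adf w b).
Proof. by rewrite /adf -cats1 foldl_cat /= foldl_adL_deg. Qed.

Lemma adf_linear w : linear (adf w).
Proof.
elim/last_ind: w => [|w q IH] c x y; first exact: lf.
rewrite !adf_rcons mulrDr grscalerAr !IH mulrDr grscalerAr !scalerDr.
by rewrite scalerN !scalerA mulrC opprD addrACA.
Qed.

(** Left multiplication by a before f acts, hence without the sign of degree e present in [Lop]. *)
Definition lmul Y : T := fun s => ush s (fun u v => spowA 1 u * Y v).

Definition adf_act k Y : T := fun s =>
  ush s (fun u v => if size u == k then symr u (fun w => adf w (Y v)) else 0).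

Lemma adf_act0 Y : adf_act 0 Y = f \o Y.
Proof.
apply: funext => s; rewrite -[RHS](@ush0l _ _ _ s (fun v => f (Y v))).
by apply: eq_ush => -[|p u] v _.
Qed.

(** The definition of the commutator, g L_a = [g, L_a] + L_a g up to sign, for g the k-fold
    commutator of f. *)
Lemma adf_actS k Y : adf_act k (lmul Y) = adf_act k.+1 Y + Le (adf_act k Y).
Proof.
apply: funext => s.
rewrite -[RHS]/(adf_act k.+1 Y s + Le (adf_act k Y) s).
pose F u v (x : A) := if size u == k then symr u (fun w => adf w (x * Y v)) else 0.
pose G u v := if size u == k then symr u (fun w => adf w (Y v)) else 0.
have E1 : adf_act k (lmul Y) s = ush s (fun t x => ush x (fun z v => F t v (spowA 1 z))).
  apply: eq_ush => t x _; rewrite /F; case: ifP => _; last by rewrite ush0.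
  rewrite ush_symr; apply: eq_symr => w _.
  exact: (ush_map _ _ (adf_linear w)).
have E2 : Le (adf_act k Y) s = ush s (fun t x => ush x (fun z v =>
    sg ((e + tdeg t) * tdeg z) *: (spowA 1 z * G t v))).
  transitivity (ush s (fun t z => ush t (fun u v =>
     sg ((e + tdeg u + tdeg v) * tdeg z) *: (spowA 1 z * G u v)))).
    apply: eq_ush => t z _; rewrite /adf_act ush_mull -ushZ.
    apply: eq_ush => u v uv; congr (sg _ *: _).
    by rewrite -(perm_tdeg uv) tdeg_cat addrA.
  rewrite (ushA s (fun u v z => sg ((e + tdeg u + tdeg v) * tdeg z) *: (spowA 1 z * G u v))).
  apply: eq_ush => u x _; rewrite ushC; apply: eq_ush => z v _.
  rewrite scalerA sgnMM; congr (_ *: _); apply: (@sgn_par _ _ _ (tdeg v * tdeg z)); ring.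
rewrite E1 E2 -[LHS](subrK (Le (adf_act k Y) s)) E2; congr (_ + _).
rewrite -scaleN1r addrC -ush_lin.
under eq_ush do rewrite -ush_lin.
(* Regroups the old commutator letters t with the new letter z, so that [symr_rcons] recognizes a
   rearrangement of k + 1 letters ending in z. *)
rewrite -(ushA s (fun t z v => -1 *: (sg ((e + tdeg t) * tdeg z) *: (spowA 1 z * G t v)) + F t v (spowA 1 z))).
apply: eq_ush => u v _.
have F0 t : F t v 0 = 0.
  rewrite /F; case: ifP => // _; rewrite -[RHS](@symr0 K A A t); apply: eq_symr => w _.
  by rewrite mul0r (linear_fun0 (adf_linear w)).
transitivity (if size u == k.+1 then ush u (fun t z => if z is [:: q] then
    symr t (fun w => adf (rcons w q) (Y v)) else 0) else 0); last first.
  by case: eqP => // su; rewrite symr_rcons //; case: (u) su.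
have -> : (if size u == k.+1 then ush u (fun t z => if z is [:: q] then
    symr t (fun w => adf (rcons w q) (Y v)) else 0) else 0) =
    ush u (fun t z => if size u == k.+1 then if z is [:: q] then
    symr t (fun w => adf (rcons w q) (Y v)) else 0 else 0).
  by case: eqP => // _; rewrite ush0.
apply: eq_ush => t z tz; rewrite spow1.
case: z tz => [|q [|r z]] tz; rewrite ?mul0r ?F0 ?scaler0 ?addr0 ?if_same //.
rewrite -(perm_size tz) size_cat addn1 eqSS /F /G.
case: eqP => _; last by rewrite mulr0 !scaler0 addr0.
rewrite (@symr_map _ A A A (fun x => q.2 * x)) => [|c x y]; last first.
  by rewrite mulrDr grscalerAr.
rewrite scalerA -symr_lin; apply: eq_symr => w wt.
rewrite adf_rcons tdeg_cons tdeg_nil addr0 (perm_tdeg wt) addrC.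
by rewrite mulN1r scaleNr.
Qed.

Lemma adf_act_iter n i Y :
  adf_act i (iter n lmul Y) =
  \sum_(j < n.+1) ('C(n, j))%:R *: iter j Le (adf_act (i + (n - j))%N Y).
Proof.
elim: n i => [|n IH] i; first by rewrite big_ord1 bin0 scale1r /= addn0.
rewrite iterS adf_actS !IH.
rewrite (sum_pascal n (fun a j => iter j Le (adf_act (i + a)%N Y))); congr (_ + _).
  by apply: eq_bigr => j _; rewrite addSnnS.
rewrite linear_sum; apply: eq_bigr => j _; exact: linearZ.
Qed.

Lemma iter_lmul n : iter n lmul (spowA 0) = spowA n.
Proof.
elim: n => //= n ->; apply: funext => s.
by rewrite -(add1n n) -spowM.
Qed.

Definition fop_sym k := adf_act k (spowA 0).

Lemma fop_symE k : fop_sym k = nest (fop (e, f)) 0 k.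
Proof.
apply: funext => s; rewrite /nest addn0.
rewrite -[RHS](@ush0r _ _ _ s (fun s => if size s == k then symr s (fun w =>
  nestBrace (fop (e, f) (take k w)) (drop k w)) else 0)).
apply: eq_ush => u v _; rewrite spow0; case: eqP => [su|_]; last by case: v.
case: v => [|p v].
  apply: eq_symr => w wu; rewrite take_oversize ?drop_oversize ?(perm_size wu) ?su //.
rewrite -[RHS](@symr0 K A A u); apply: eq_symr => w _.
exact: linear_fun0 (adf_linear w).
Qed.

(** The n-th coefficient of f(e^a) = e^L applied to the sum of f_k / k!, up to n!. *)
Lemma spow_fop n : f \o spowA n =
  \sum_(j < n.+1) ('C(n, j))%:R *: iter j Le (fop_sym (n - j)%N).
Proof. by rewrite -adf_act0 -iter_lmul adf_act_iter. Qed.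

End Commutators.

(** * The closed formulas *)

Section Inversion.

Variables (K : fieldType) (A : grAlg K) (e : int).
Hypothesis charK : [pchar K] =i pred0.
Local Notation PA := (int * A)%type.
Local Notation T := (seq PA -> A).
Local Notation De := (@Dop K A e).
Local Notation Ee := (@Eop K A e).
Local Notation Le := (@Lop K A e).
Local Notation Re := (@Rop K A).
Local Notation spowA := (@spow K A).
Local Notation eqF := (eqF (@Fil K A)).
Implicit Types (s u v w : seq PA) (p q : PA) (Y Z : T).

Lemma eqF_at n Y Z s : eqF n.+1 Y Z -> homog s -> (size s <= n)%N -> Y s = Z s.
Proof. by move=> YZ hs sn; apply/eqP; rewrite -subr_eq0; apply/eqP/YZ. Qed.

Lemma at_eqF n Y Z : (forall s, homog s -> (size s <= n)%N -> Y s = Z s) ->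
  eqF n.+1 Y Z.
Proof. by move=> YZ s hs sn; rewrite -[LHS]/(Y s - Z s) YZ ?subrr. Qed.

Lemma iter_RopLop m Y : \sum_(i < m.+1) iter i Re (iter (m - i) Le Y) =
  \sum_(i < m.+1) iter i Le (iter (m - i) Re Y).
Proof.
rewrite (reindex_inj rev_ord_inj); apply: eq_bigr => i _ /=.
rewrite subSS subKn; last by rewrite -ltnS.
by rewrite -(@iter_comm2 _ _ Le Re (@LopRop _ _ _)).
Qed.

Variable (B : nat -> K).
Hypothesis hB : isBernoulli B.

Let F0 := @Fil_r0 K A.
Let Fz := @Fil_z K A.
Let Fl := @Fil_l K A.
Let Fm := @Fil_mono K A.

(** The decomposition L = R + (L - R), suited to a constant y: e^(-R) turns x into products x
    a^k. *)
Lemma invert_left n (G y : T) :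
  (forall s, homog s -> (size s <= n)%N -> grcomp e G (@eprod K A) s = y s) ->
  eqF n.+1 G (ser n.+1 (fun m => B m / m`!%:R) Ee
     (ser n.+1 (fun k => (-1) ^+ k / k`!%:R) Re y)).
Proof.
move=> h; apply: (quotient_inv F0 Fz Fl Fm (U := Le)) => //.
- exact: LopRop.
- by move=> Y; apply: funext => s; rewrite -[RHS]/(Re Y s + (Le Y s - Re Y s)) addrC subrK.
- exact: Rop_raising.
- exact: Eop_raising.
by apply: at_eqF => s hs sn; rewrite grcomp_series // h.
Qed.

(** The decomposition R = L + (R - L), suited to y = f(e^a): e^(-L) turns it into commutators. *)
Lemma invert_right n (G y : T) :
  (forall s, homog s -> (size s <= n)%N -> grcomp e G (@eprod K A) s = y s) ->
  eqF n.+1 G (ser n.+1 (fun m => B m / m`!%:R) De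
     (ser n.+1 (fun k => (-1) ^+ k / k`!%:R) Le y)).
Proof.
move=> h; apply: (quotient_inv F0 Fz Fl Fm (U := Re)) => //.
- by move=> Y; rewrite -[LHS]LopRop.
- by move=> Y; apply: funext => s; rewrite -[RHS]/(Le Y s + (Re Y s - Le Y s)) addrC subrK.
- exact: Lop_raising.
- exact: Dop_raising.
apply: at_eqF => s hs sn; rewrite -h // -(grcomp_series _ _ sn).
by congr (_ s); apply: eq_bigr => m _; rewrite iter_RopLop.
Qed.

Lemma iter_Eop m Y : iter m Ee Y = (-1) ^+ m *: iter m De Y.
Proof.
elim: m => [|m IH]; first by rewrite scale1r.
rewrite iterS IH linearZ /=.
have -> : Ee (iter m De Y) = - De (iter m De Y).
  apply: funext => s.
  by rewrite -[RHS]/(- (Re (iter m De Y) s - Le (iter m De Y) s)) opprB.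
by rewrite exprS mulN1r scaleNr -scalerN.
Qed.

Lemma ser_Eop n (b : nat -> K) Y :
  ser n b Ee Y = ser n (fun m => (-1) ^+ m * b m) De Y.
Proof.
by apply: eq_bigr => m _; rewrite iter_Eop scalerA mulrC.
Qed.

Lemma foldl_hmul p w :
  foldl (@hmul K A) p w = (p.1 + tdeg w, p.2 * lprod w).
Proof.
elim: w p => [|q w IH] p /=; first by rewrite tdeg_nil lprod_nil addr0 mulr1 -surjective_pairing.
by rewrite IH tdeg_cons lprod_cons /= addrA mulrA.
Qed.

Lemma elt_formula n (G : T) (x : A) s : homog s -> size s = n ->
  (forall s, homog s -> (size s <= n)%N ->
     grcomp e G (@eprod K A) s = if s is [::] then x else 0) ->
  G s = symr s (fun w => \sum_(k < n.+1)
    ((-1) ^+ n * B (n - k)%N / (k`!%:R * (n - k)`!%:R)) *: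
    nestBrace (foldl (@hmul K A) (e, x) (take k w)) (drop k w)).
Proof.
move=> hs sn /invert_left h; rewrite (eqF_at h hs) ?sn //.
have -> : ser n.+1 (fun k => (-1) ^+ k / k`!%:R) Re (fun s => if s is [::] then x else 0) =
    \sum_(k < n.+1) ((-1) ^+ k / k`!%:R) *: nest (foldl (@hmul K A) (e, x)) 0 k.
  apply: eq_bigr => k _; congr (_ *: _); apply: funext => t.
  rewrite iter_Rop /nest addn0.
  transitivity (x * spowA k t).
    rewrite -[RHS](@ush0l _ _ _ t (fun v => x * spowA k v)).
    by apply: eq_ush => -[|p u] v _; rewrite ?mul0r.
  rewrite /spow; case: eqP => [tk|_]; last by rewrite mulr0.
  rewrite /sprod (@symr_map _ A A A (fun z => x * z)) => [|c y z]; last first.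
    by rewrite mulrDr grscalerAr.
  apply: eq_symr => w wt; rewrite take_oversize ?drop_oversize ?(perm_size wt) ?tk //.
  by rewrite /nestBrace /= foldl_hmul.
rewrite ser_Eop (ser_nest _ (fun m => (-1) ^+ m * (B m / m`!%:R)) (fun k => (-1) ^+ k / k`!%:R) sn).
  apply: eq_symr => w _; apply: eq_bigr => k _; congr (_ *: _).
  have kn : (k <= n)%N by rewrite -ltnS.
  (* The factor with n - k comes from L - R = -(R - L), the one with k from e^(-R). *)
  have -> : (-1) ^+ n = (-1) ^+ (n - k) * (-1) ^+ k :> K by rewrite -exprD subnK.
  by rewrite invfM; ring.
by move=> w; rewrite foldl_hmul.
Qed.

Lemma end_formula n (G : T) (f : A -> A) s : linear f -> homog s -> size s = n ->
  (forall s, homog s -> (size s <= n)%N ->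
     grcomp e G (@eprod K A) s = f (eprod s)) ->
  G s = symr s (fun w => \sum_(k < n.+1)
    (B (n - k)%N / (k`!%:R * (n - k)`!%:R)) *:
    nestBrace (fop (e, f) (take k w)) (drop k w)).
Proof.
move=> lf hs sn /invert_right h.
pose ep k : K := (k`!%:R)^-1; pose em k : K := (-1) ^+ k / k`!%:R.
have fZ := linear_funZ lf.
pose S : T := \sum_(k < n.+1) ep k *: fop_sym e f k.
(* Here f(e^a) = e^L S is shown with S the sum of f_k / k!; applying e^(-L) then gives S in [y2]. *)
have y1 : eqF n.+1 (fun s => f (eprod s)) (ser n.+1 ep Le S).
  apply: (eqF_trans Fl (y := \sum_(k < n.+1) ep k *: (f \o spowA k))).
    apply: at_eqF => t ht tn; rewrite fct_sumE.
    have tn' : (size t < n.+1)%N by rewrite ltnS.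
    rewrite (bigD1 (Ordinal tn')) //= big1 => [|k kt].
      by rewrite addr0 /eprod fZ -[RHS]/(ep (size t) *: f (spowA (size t) t)) /spow eqxx.
    rewrite -[LHS]/(ep k *: f (spowA k t)) /spow; case: eqP => [E|_]; last first.
      by rewrite -(scale0r (0 : A)) fZ !scale0r scaler0.
    by case/eqP: kt; apply: val_inj.
  apply: (eqF_sym Fz Fl).
  have rX k : Fil k (fop_sym e f k).
    by move=> t ht tk; rewrite (fop_symE e lf) /nest /= addn0; case: eqP tk => [->|//]; rewrite ltnn.
  apply: (eqF_trans Fl (ser_fam Fz Fl Fm n ep ep (@Lop_raising K A e) rX)).
  apply: at_eqF => t ht tn; congr (_ t); apply: eq_bigr => m _.
  rewrite (spow_fop e lf) scaler_sumr; apply: eq_bigr => i _; rewrite scalerA.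
  congr (_ *: _); have im : (i <= m)%N by rewrite -ltnS.
  rewrite /ep; have -> : m`!%:R = 'C(m, i)%:R * ((m - i)`!%:R * i`!%:R) :> K.
    by rewrite [X in _ * X]mulrC -2!natrM bin_fact.
  apply: bin_inv; [|exact: fact_neq0 | exact: fact_neq0].
  by rewrite natr_neq0 // bin_gt0.
have y2 : eqF n.+1 (ser n.+1 em Le (fun s => f (eprod s))) S.
  apply: (eqF_trans Fl (ser_eqF Fz Fl Fm _ (@Lop_raising K A e) y1)).
  apply: (ser_inv F0 Fz Fl Fm) => [|m _]; first exact: Lop_raising.
  by rewrite -(sum_exp_inv charK); apply: eq_bigr.
rewrite (eqF_at (eqF_trans Fl h (ser_eqF Fz Fl Fm _ (@Dop_raising K A e) y2)) hs) ?sn //.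
rewrite /S (eq_bigr (fun k : 'I_n.+1 => ep k *: nest (fop (e, f)) 0 k)) => [|k _]; last first.
  by rewrite fop_symE.
rewrite (ser_nest _ _ ep sn) => [|w]; last by rewrite /fop /= foldl_adL_deg.
apply: eq_symr => w _; apply: eq_bigr => k _; congr (_ *: _).
by rewrite /ep invfM; ring.
Qed.

End Inversion.

Theorem theorem4p3 (K : fieldType) (charK : [pchar K] =i pred0)
    (B : nat -> K) (hB : isBernoulli B)
    (Psi : bracketAssignment K) (hPsi : isKoszul Psi)
    (A : grAlg K) (n : nat) (a : n.-tuple (int * A)) (ha : homog a) :
  (forall (e : int) (x : A), hdeg e x ->
     Psi A (affElt x) (elts a) =
     \sum_(pi : 'S_n) koszul K pi (degs a) *:
       \sum_(k < n.+1) ((-1) ^+ n * B (n - k)%N / (k`!%:R * (n - k)`!%:R)) *: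
         nestBrace (foldl (@hmul K A) (e, x) (take k (permute pi a)))
                   (drop k (permute pi a)))
  /\
  (forall (e : int) (f : A -> A), homEnd e f ->
     Psi A (affEnd f) (elts a) =
     \sum_(pi : 'S_n) koszul K pi (degs a) *:
       \sum_(k < n.+1) (B (n - k)%N / (k`!%:R * (n - k)`!%:R)) *:
         nestBrace (fop (e, f) (take k (permute pi a)))
                   (drop k (permute pi a))).
Proof.
have sa : size a = n := size_tuple a.
split=> [e x hx | e f hf].
  rewrite (symr_permE (fun w => \sum_(k < n.+1)
    ((-1) ^+ n * B (n - k)%N / (k`!%:R * (n - k)`!%:R)) *:
    nestBrace (foldl (@hmul K A) (e, x) (take k w)) (drop k w)) sa).
  apply: (elt_formula charK hB (G := Psi_l Psi (affElt x))) => // s hs _.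
  rewrite -(grcomp_elt_expo charK hPsi hx hs); apply/esym.
  exact/(grcomp_eprod_homog charK hPsi)/hs/(Psi_graded hPsi (inAff_elt hx)).
rewrite (symr_permE (fun w => \sum_(k < n.+1)
  (B (n - k)%N / (k`!%:R * (n - k)`!%:R)) *:
  nestBrace (fop (e, f) (take k w)) (drop k w)) sa).
apply: (end_formula charK hB (G := Psi_l Psi (affEnd f)) hf.1) => // s hs _.
rewrite -(expoE charK hPsi hs) -(grcomp_end_expo charK hPsi hf hs); apply/esym.
exact/(grcomp_eprod_homog charK hPsi)/hs/(Psi_graded hPsi (inAff_end hf)).
Qed.
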